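(* Let $H:\mathbb{R}^n\rightrightarrows\mathbb{R}^n$ be upper semicontinuous with non-empty compact convex values, let $\Lambda\subset\mathbb{R}^n$, and let $V:\mathbb{R}^n\to\mathbb{R}$ be a path-differentiable Lyapunov function for $\Lambda$ with respect to $x'(t)\in H(x(t))$. Let $\mu\in\mathcal P(\mathbb{R}^n\times\mathbb{R}^n)$ be a closed measure such that $v_\mu(x)\in H(x)$ for $\pi_*\mu$-almost every $x$. Then $v_\mu(x)\in\partial V(x)^\perp$ for $\pi_*\mu$-almost every $x$.
   Context: Solutions of $x'(t)\in H(x(t))$: absolutely continuous $\gamma:[0,\infty)\to\mathbb{R}^n$ with $\gamma'(t)\in H(\gamma(t))$ a.e. A continuous $V$ is a Lyapunov function for $\Lambda$ if every solution satisfies, for all $t>0$, $V(\gamma(t))\le V(\gamma(0))$, with strict inequality if $\gamma(0)\notin\Lambda$. $\partial V$ is the Clarke subdifferential: $\partial V(x)=\overline{\mathrm{conv}}\{v:\exists y_i\to x,\ y_i$ differentiability points of $V$, $\nabla V(y_i)\to v\}$. $V$ (locally Lipschitz) is path-differentiable if for every locally Lipschitz curve $\gamma$, $V\circ\gamma$ is a.e. differentiable with $(V\circ\gamma)'(t)=\langle w,\gamma'(t)\rangle$ for all $w\in\partial V(\gamma(t))$. For $A\subset\mathbb{R}^n$, $A^\perp=\{u:\langle u,a\rangle=0\ \forall a\in A\}$. $\pi(x,v)=x$; $v_\mu(x)=\int v\,d\mu_x(v)$ where $\mu=\int\mu_x\,d(\pi_*\mu)(x)$ is the disintegration. A compactly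 supported $\mu\in\mathcal P(\mathbb{R}^n\times\mathbb{R}^n)$ is closed if $\int\langle\nabla g(x),v\rangle\,d\mu(x,v)=0$ for all $g\in\mathcal C^\infty(\mathbb{R}^n,\mathbb{R})$. *)

(* Defs.v *)
From HB Require Import structures.
From mathcomp Require Import all_boot all_order all_algebra.
From mathcomp Require Import all_classical all_reals all_analysis.
Set Implicit Arguments. Unset Strict Implicit. Unset Printing Implicit Defensive.
Import Order.TTheory GRing.Theory Num.Theory.
Import numFieldNormedType.Exports.
Local Open Scope classical_set_scope.
Local Open Scope ring_scope.

Section Borel_rV.
Variables (R : realType) (n : nat).
HB.instance Definition _ := Pointed.on 'rV[R]_n.
HB.instance Definition rV_isMeasurable :
  isMeasurable default_measure_display 'rV[R]_n :=
  @isMeasurable.Build _ (g_sigma_algebraType (@open 'rV[R]_n))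
    (measurable : set (set (g_sigma_algebraType (@open 'rV[R]_n))))
    measurable0 (@measurableC _ _) (@bigcupT_measurable _ _).
End Borel_rV.

Section Defs.
Variables (R : realType) (n : nat).
Local Notation Rn := 'rV[R]_n.

Definition dotrv (u v : Rn) : R := \sum_(i < n) u ord0 i * v ord0 i.

Definition perp_set (A : set Rn) : set Rn :=
  [set u | forall a, A a -> dotrv u a = 0].

Definition usc (H : Rn -> set Rn) : Prop :=
  forall (x : Rn) (U : set Rn), open U -> H x `<=` U ->
    \forall y \near x, H y `<=` U.

Definition convex_values (H : Rn -> set Rn) : Prop :=
  forall x a b (t : R), H x a -> H x b -> 0 <= t <= 1 ->
    H x (t *: a + (1 - t) *: b).

Definition abs_cont_on (a b : R) (g : R -> Rn) : Prop :=
  forall e : R, 0 < e -> exists2 d : R, 0 < d &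
    forall (k : nat) (s t : 'I_k -> R),
      (forall i, a <= s i /\ s i <= t i /\ t i <= b) ->
      (forall i j, i != j -> t i <= s j \/ t j <= s i) ->
      \sum_(i < k) (t i - s i) < d ->
      \sum_(i < k) `|g (t i) - g (s i)| < e.

(* solution of x'(t) \in H(x(t)) on [0, +oo) (only the restriction of g to
   [0, +oo) matters) *)
Definition is_solution (H : Rn -> set Rn) (g : R -> Rn) : Prop :=
  (forall b, 0 <= b -> abs_cont_on 0 b g) /\
  {ae (@lebesgue_measure R), forall t : R, 0 < t ->
      derivable g t 1 /\ H (g t) ('D_1 g t)}.

Definition lyapunov (H : Rn -> set Rn) (Lam : set Rn) (V : Rn -> R) : Prop :=
  continuous V /\
  forall g, is_solution H g -> forall t : R, 0 < t ->
    V (g t) <= V (g 0) /\ (~ Lam (g 0) -> V (g t) < V (g 0)).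

Definition grad_at (V : Rn -> R) (y : Rn) : Rn :=
  \row_(i < n) ('d V y (delta_mx ord0 i : Rn)).

Definition clarke_limits (V : Rn -> R) (x : Rn) : set Rn :=
  [set w | exists y : nat -> Rn,
     [/\ (forall k, differentiable V (y k)),
         y @ \oo --> x &
         (fun k => grad_at V (y k)) @ \oo --> w]].

Definition conv_hull (A : set Rn) : set Rn :=
  [set z | exists (k : nat) (l : 'I_k -> R) (a : 'I_k -> Rn),
     [/\ (forall i, 0 <= l i), \sum_(i < k) l i = 1,
         (forall i, A (a i)) & z = \sum_(i < k) l i *: a i]].

Definition clarke_subdiff (V : Rn -> R) (x : Rn) : set Rn :=
  closure (conv_hull (clarke_limits V x)).

Fixpoint Ck (k : nat) (g : Rn -> R) : Prop :=
  match k with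
  | 0 => continuous g
  | k'.+1 => (forall x, differentiable g x) /\ forall v : Rn, Ck k' (fun x => 'D_v g x)
  end.

Definition smooth_fun (g : Rn -> R) : Prop := forall k, Ck k g.

End Defs.

Definition locally_lipschitz (K : realType) (U W : normedModType K) (f : U -> W) : Prop :=
  forall x : U, exists r L : K, 0 < r /\
    forall y z, ball x r y -> ball x r z -> `|f y - f z| <= L * `|y - z|.

Definition path_differentiable (R : realType) (n : nat) (V : 'rV[R]_n -> R) : Prop :=
  locally_lipschitz V /\
  forall g : R -> 'rV[R]_n, locally_lipschitz g ->
    {ae (@lebesgue_measure R), forall t : R,
      [/\ derivable (V \o g) t 1, derivable g t 1 &
          forall w, clarke_subdiff V (g t) w -> 'D_1 (V \o g) t = dotrv w ('D_1 g t)]}.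

Section Measures.
Variables (R : realType) (n : nat).
Local Notation Rn := 'rV[R]_n.

Definition compactly_supported (mu : probability (Rn * Rn)%type R) : Prop :=
  exists K : set (Rn * Rn)%type, compact K /\ mu (~` K) = 0%E.

Definition closed_measure (mu : probability (Rn * Rn)%type R) : Prop :=
  compactly_supported mu /\
  forall g : Rn -> R, smooth_fun g ->
    (\int[mu]_z ('D_(z.2) g z.1)%:E = 0)%E.

Definition proj_measure (mu : probability (Rn * Rn)%type R) : set Rn -> \bar R :=
  pushforward mu fst.

Definition proj_ae (mu : probability (Rn * Rn)%type R) (P : set Rn) : Prop :=
  (proj_measure mu).-negligible (~` P).

Definition is_disintegration (mu : probability (Rn * Rn)%type R)
    (k : R.-pker Rn ~> (Rn * Rn)%type) : Prop :=
  (forall A, measurable A -> mu A = \int[proj_measure mu]_x k x A)%E /\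
  proj_ae mu [set x | k x ([set x] `*` [set: Rn]) = 1%E].

Definition v_mu (k : R.-pker Rn ~> (Rn * Rn)%type) (x : Rn) : Rn :=
  \row_(i < n) fine (\int[k x]_z (z.2 ord0 i)%:E)%E.

End Measures.

(* Main.v *)
Require Import Defs.
From HB Require Import structures.
From mathcomp Require Import all_boot all_order all_algebra.
From mathcomp Require Import all_classical all_reals all_analysis.
From mathcomp Require Import measurable_realfun.
From mathcomp Require Import ring lra.
Import Order.TTheory GRing.Theory Num.Theory.
Import numFieldNormedType.Exports.
Set Implicit Arguments.
Unset Strict Implicit.
Unset Printing Implicit Defensive.
Local Open Scope classical_set_scope.
Local Open Scope ring_scope.

(** Write [v] for [v_mu] and [nu] for the projection of [mu]. Closedness of [mu]
    says that [\int 'D_(v x) g x dnu = 0] for every smooth [g]. No superposition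
    principle is needed, because a single curve suffices, and duality provides it.
    Let [L (x, u) >= 0] be convex in [u] with [\int L (x, v x) dnu < c]. Discretise
    time with step [h], and space with a finite net [y]. If no chain of net points
    has normalised discounted [L]-cost at most [c], then the discounted value
    function [u] satisfies [u i - u j <= cost i j - c]. A softmin of the paraboloids
    [|x - y i|^2 / (2 kappa) - h * u i] is a smooth [g] with
    ['D_(v x) g x <= L (x, v x) - c] up to a small error, and integrating this
    contradicts closedness. As [h] tends to 0, cheap chains converge to a Lipschitz
    curve [gam] whose normalised discounted [L]-cost is at most [c].

    Suppose [v x] is not orthogonal to the subdifferential of [V] on a set of
    positive measure. This set contains a closed set [A] with [nu A > 0] on which
    [(x, v x)] is a limit of pairs [(y, u)] with [|<grad V y, u>| >= delta]. Let [L]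
    increase to the indicator of the complement of [A] plus an infinite penalty for
    leaving the good points or for [u <> v x]. The curve [gam] is then a solution
    of the inclusion and spends a definite proportion of its discounted time in [A],
    where path-differentiability gives [(V \o gam)' <= - delta]. Since [V] is
    nonincreasing and bounded along [gam], this is impossible for a small
    discount rate. *)

(** * Smooth functions and the softmin of paraboloids *)

(** Two obstacles shape the construction. First, [v] is only measurable, while the duality needs a
    continuous Lagrangian. In [lagrangian], continuous fields [w i] approach [v] with integral
    errors [2^-(i+1)], and open sets [U i] of measure at most [2^-(i+1)] cover the null set of bad
    points. All penalties together then have a small integral. Where their sum is finite its terms
    tend to 0, so the point is good and the velocity equals the limit of the [w i], which is [v].

    Second, velocities of chains need not converge. The cost of the limit curve is therefore read
    off difference quotients over dyadic times, which do converge; by convexity, a quotient over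
    many steps costs no more than the mean of the steps, up to the displacement of the base point.

    Discounting serves twice. It bounds [h * u] independently of [h], so the opening of the
    paraboloids can be fixed before the time step. It also makes the total decrease of [V], which is
    bounded, small against the total weight [1 / rho]. *)

Section Ck_theory.
Context {R : realType} {n : nat}.
Local Notation Rn := 'rV[R]_n.
Implicit Types (f g : Rn -> R) (k : nat).

Lemma Ck_differentiable k g x : Ck k.+1 g -> differentiable g x.
Proof. by case. Qed.

Lemma Ck_continuous k g : Ck k g -> continuous g.
Proof.
case: k => [//|k] [dg _] x.
exact: differentiable_continuous (dg x).
Qed.

Lemma CkW k g : Ck k.+1 g -> Ck k g.
Proof.
elim: k g => [|k IH] g; first exact: Ck_continuous.
by case=> dg Dg; split => // v; exact: IH.
Qed.

Lemma Ck_cst k (c : R) : Ck k (fun _ : Rn => c).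
Proof.
elim: k c => [|k IH] c; first exact: cst_continuous.
split=> [x|v]; first exact: differentiable_cst.
rewrite (_ : (fun x => 'D_v _ x) = fun=> 0) //.
by apply/funext => x; rewrite derive_cst.
Qed.

Lemma Ck_add k f g : Ck k f -> Ck k g -> Ck k (fun x => f x + g x).
Proof.
elim: k f g => [|k IH] f g; first by rewrite /= => cf cg x; exact: (continuousD (cf x) (cg x)).
move=> [df Df] [dg Dg]; split=> [x|v]; first exact: differentiableD.
rewrite (_ : (fun x => 'D_v _ x) = fun x => 'D_v f x + 'D_v g x); first exact: IH (Df v) (Dg v).
by apply/funext => x; rewrite deriveD//; exact: diff_derivable.
Qed.

Lemma Ck_mul k f g : Ck k f -> Ck k g -> Ck k (fun x => f x * g x).
Proof.
elim: k f g => [|k IH] f g; first by rewrite /= => cf cg x; exact: (continuousM (cf x) (cg x)).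
move=> Cf Cg; have [df Df] := Cf; have [dg Dg] := Cg.
split=> [x|v]; first exact: differentiableM.
rewrite (_ : (fun x => 'D_v _ x) = fun x => f x * 'D_v g x + g x * 'D_v f x).
  by apply: Ck_add; apply: IH => //; try exact: CkW; [exact: Dg|exact: Df].
by apply/funext => x; rewrite deriveM//; exact: diff_derivable.
Qed.

Lemma Ck_sum k (I : finType) (F : I -> Rn -> R) :
  (forall i, Ck k (F i)) -> Ck k (fun x => \sum_i F i x).
Proof.
move=> CF.
suff : forall s : seq I, Ck k (fun x => \sum_(i <- s) F i x) by apply.
elim=> [|i s IH].
  under eq_fun do rewrite big_nil.
  exact: Ck_cst.
under eq_fun do rewrite big_cons.
exact: Ck_add.
Qed.

Lemma derive_coord (i : 'I_n) (x v : Rn) :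
  'D_v (fun y : Rn => y ord0 i) x = v ord0 i.
Proof.
rewrite deriveE; last exact: differentiable_coord.
have @f : {linear Rn -> R}.
  by exists (fun N : Rn => N ord0 i); do 2![eexists]; do ?[constructor];
    rewrite ?mxE// => ? *; rewrite ?mxE//; move=> ?; rewrite !mxE.
rewrite (_ : (fun _ => _) = f) // diff_lin//; exact/coord_continuous.
Qed.

Lemma Ck_coord k (i : 'I_n) : Ck k (fun x : Rn => x ord0 i).
Proof.
case: k => [|k]; first by move=> x; exact: coord_continuous.
split=> [x|v]; first exact: differentiable_coord.
under eq_fun do rewrite derive_coord.
exact: Ck_cst.
Qed.

Lemma differentiable_comp1 (p : R -> R) (dp : R) f x :
  differentiable f x -> is_derive (f x) 1 p dp -> differentiable (fun y => p (f y)) x.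
Proof.
move=> df [pd _]; apply: (@differentiable_comp _ _ _ _ f p) => //.
exact/derivable1_diffP.
Qed.

Lemma derive_comp1 (p : R -> R) (dp : R) f x v :
  differentiable f x -> is_derive (f x) 1 p dp ->
  'D_v (fun y => p (f y)) x = 'D_v f x * dp.
Proof.
move=> df pd; have := pd => -[/derivable1_diffP dpx pE].
rewrite deriveE; last exact: differentiable_comp1 df pd.
rewrite (@diff_comp _ _ _ _ f p)// /= diff1E// derive1E pE -deriveE//.
Qed.

Lemma Ck_expR k f : Ck k f -> Ck k (fun x => expR (f x)).
Proof.
elim: k f => [|k IH] f.
  by rewrite /= => cf x; apply: continuous_comp; [exact: cf|exact: continuous_expR].
move=> Cf; have [df Df] := Cf; split=> [x|v].
  exact: (differentiable_comp1 (df x) (is_derive_expR _)).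
rewrite (_ : (fun x => 'D_v _ x) = fun x => 'D_v f x * expR (f x)).
  by apply: Ck_mul; [exact: Df|apply: IH; exact: CkW].
by apply/funext => x; rewrite (derive_comp1 v (df x) (is_derive_expR _)).
Qed.

Lemma is_derive1_inv (x : R) : x != 0 -> is_derive x 1 (fun y : R => y^-1) (- x ^- 2).
Proof.
move=> x0; split; first exact: (@derivableV _ _ id x 1 x0).
rewrite (@deriveV _ _ id x 1 x0)//.
by rewrite derive_id /GRing.scale/= mulr1.
Qed.

Lemma Ck_inv k f : (forall x, f x != 0) -> Ck k f -> Ck k (fun x => (f x)^-1).
Proof.
move=> f0.
elim: k f f0 => [|k IH] f f0.
  by rewrite /= => cf x; exact: (cvgV (f0 x) (cf x)).
move=> Cf; have [df Df] := Cf; split=> [x|v].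
  exact: (differentiable_comp1 (df x) (is_derive1_inv (f0 _))).
rewrite (_ : (fun x => 'D_v _ x) = fun x => 'D_v f x * (-1 * ((f x)^-1 * (f x)^-1))).
  have Ci : Ck k (fun x => (f x)^-1) by apply: IH => //; exact: CkW.
  apply: Ck_mul; [exact: Df|apply: Ck_mul; first exact: Ck_cst].
  exact: Ck_mul.
apply/funext => x; rewrite (derive_comp1 v (df x) (is_derive1_inv (f0 _))).
by rewrite mulN1r -invfM expr2.
Qed.

Lemma Ck_ln k f : (forall x, 0 < f x) -> Ck k f -> Ck k (fun x => ln (f x)).
Proof.
move=> f0; case: k => [|k].
  by rewrite /= => cf x; apply: continuous_comp; [exact: cf|exact: continuous_ln].
move=> Cf; have [df Df] := Cf; split=> [x|v].
  exact: (differentiable_comp1 (df x) (is_derive1_ln (f0 _))).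
rewrite (_ : (fun x => 'D_v _ x) = fun x => 'D_v f x * (f x)^-1).
  apply: Ck_mul; [exact: Df|apply: Ck_inv; last exact: CkW].
  by move=> x; rewrite gt_eqF.
by apply/funext => x; rewrite (derive_comp1 v (df x) (is_derive1_ln (f0 _))).
Qed.

Lemma derive_sumF (I : finType) (F : I -> Rn -> R) x v :
  (forall i, Ck 1 (F i)) ->
  'D_v (fun x => \sum_i F i x) x = \sum_i 'D_v (F i) x.
Proof.
move=> CF.
suff : forall s : seq I, Ck 1 (fun x => \sum_(i <- s) F i x) /\
    'D_v (fun x => \sum_(i <- s) F i x) x = \sum_(i <- s) 'D_v (F i) x.
  by move=> /(_ (index_enum I))[].
elim=> [|i s [C1 IH]].
  rewrite big_nil (_ : (fun x => _) = fun=> 0); last first.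
    by apply/funext => z; rewrite big_nil.
  by split; [exact: Ck_cst|rewrite derive_cst].
rewrite big_cons (_ : (fun x => _) = fun x => F i x + \sum_(i <- s) F i x); last first.
  by apply/funext => z; rewrite big_cons.
split; first exact: Ck_add.
by rewrite deriveD ?IH//; apply/diff_derivable/(@Ck_differentiable 0).
Qed.

End Ck_theory.

Section softmin.
Context {R : realType} {n : nat} {I : finType}.
Local Notation Rn := 'rV[R]_n.
Variables (y : I -> Rn) (U : I -> R) (kappa beta : R) (i0 : I).
Hypotheses (kappa0 : 0 < kappa) (beta0 : 0 < beta).

(** The square is summed over coordinates because the norm of ['rV] is the maximum norm, which is
    not smooth. *)
Definition paraboloid (i : I) (x : Rn) : R :=
  U i + \sum_(l < n) (x ord0 l - y i ord0 l) * (x ord0 l - y i ord0 l) * (2 * kappa)^-1.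

Definition gibbs_sum (x : Rn) : R := \sum_i expR (- beta * paraboloid i x).

Definition gibbs_weight (i : I) (x : Rn) : R :=
  expR (- beta * paraboloid i x) / gibbs_sum x.

(** A free energy at inverse temperature [beta]. The plain minimum of the paraboloids is not smooth;
    here the derivative is the average of theirs under the Gibbs weights. *)
Definition softmin (x : Rn) : R := - beta^-1 * ln (gibbs_sum x).

Lemma gibbs_term_le i x : expR (- beta * paraboloid i x) <= gibbs_sum x.
Proof.
rewrite /gibbs_sum (bigD1 i)//= lerDl sumr_ge0//.
Qed.

Lemma gibbs_sum_gt0 x : 0 < gibbs_sum x.
Proof. exact: lt_le_trans (expR_gt0 _) (gibbs_term_le i0 x). Qed.

Lemma Ck_paraboloid k i : Ck k (paraboloid i).
Proof.
apply: Ck_add; first exact: Ck_cst.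
apply: Ck_sum => l; apply: Ck_mul; last exact: Ck_cst.
have C : Ck k (fun x : Rn => x ord0 l - y i ord0 l).
  by apply: Ck_add; [exact: Ck_coord|exact: Ck_cst].
exact: Ck_mul.
Qed.

Lemma Ck_gibbs_term k i : Ck k (fun x => expR (- beta * paraboloid i x)).
Proof.
by apply: Ck_expR; apply: Ck_mul; [exact: Ck_cst|exact: Ck_paraboloid].
Qed.

Lemma Ck_gibbs_sum k : Ck k gibbs_sum.
Proof. by apply: Ck_sum => i; exact: Ck_gibbs_term. Qed.

Lemma smooth_softmin : smooth_fun softmin.
Proof.
move=> k; apply: Ck_mul; first exact: Ck_cst.
by apply: Ck_ln; [exact: gibbs_sum_gt0|exact: Ck_gibbs_sum].
Qed.

Lemma derive_paraboloid i x v :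
  'D_v (paraboloid i) x = dotrv (x - y i) v / kappa.
Proof.
rewrite /paraboloid deriveD; last 2 first.
- exact/diff_derivable/differentiable_cst.
- apply/diff_derivable; apply: (@Ck_differentiable _ _ 0).
  apply: Ck_sum => l; apply: Ck_mul; last exact: Ck_cst.
  by apply: Ck_mul; apply: Ck_add; try exact: Ck_coord; exact: Ck_cst.
rewrite derive_cst add0r derive_sumF; last first.
  move=> l; apply: Ck_mul; last exact: Ck_cst.
  by apply: Ck_mul; apply: Ck_add; try exact: Ck_coord; exact: Ck_cst.
rewrite /dotrv mulr_suml; apply: eq_bigr => l _.
have dc : derivable (fun x0 : Rn => x0 ord0 l - y i ord0 l) x v.
  apply/diff_derivable; apply: (@Ck_differentiable _ _ 0).
  by apply: Ck_add; [exact: Ck_coord|exact: Ck_cst].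
have Dc : 'D_v (fun x0 : Rn => x0 ord0 l - y i ord0 l) x = v ord0 l.
  rewrite deriveB; last exact/diff_derivable/differentiable_cst; last first.
    exact/diff_derivable/differentiable_coord.
  by rewrite derive_cst subr0 derive_coord.
rewrite deriveM; last exact/diff_derivable/differentiable_cst; last exact: derivableM.
rewrite derive_cst deriveM// Dc !mxE /GRing.scale/=.
by field; rewrite gt_eqF.
Qed.

Lemma derive_softmin x v :
  'D_v softmin x = \sum_i gibbs_weight i x * (dotrv (x - y i) v / kappa).
Proof.
have S0 := gibbs_sum_gt0 x.
have dS : differentiable gibbs_sum x by exact: (Ck_differentiable _ (Ck_gibbs_sum 1)).
have dl := differentiable_comp1 dS (is_derive1_ln S0).
rewrite /softmin deriveM; last exact: diff_derivable; last first.
  exact/diff_derivable/differentiable_cst.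
rewrite derive_cst scaler0 addr0 (derive_comp1 _ dS (is_derive1_ln S0)).
rewrite /gibbs_sum derive_sumF; last by move=> i; exact: Ck_gibbs_term.
rewrite -/(gibbs_sum x) mulr_suml scaler_sumr; apply: eq_bigr => i _.
have dp : differentiable (paraboloid i) x by exact: (Ck_differentiable _ (Ck_paraboloid 1 i)).
have dbp : differentiable (fun x => - beta * paraboloid i x) x.
  exact: (Ck_differentiable _ (Ck_mul (Ck_cst 1 _) (Ck_paraboloid 1 i))).
rewrite (derive_comp1 _ dbp (is_derive_expR _)).
rewrite deriveM; last exact: diff_derivable; last first.
  exact/diff_derivable/differentiable_cst.
rewrite derive_cst scaler0 addr0 derive_paraboloid /gibbs_weight /GRing.scale/=.
by field; rewrite !gt_eqF.
Qed.

Lemma gibbs_weight_ge0 i x : 0 <= gibbs_weight i x.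
Proof. by rewrite divr_ge0 ?expR_ge0// ltW// gibbs_sum_gt0. Qed.

Lemma gibbs_weight_sum1 x : \sum_i gibbs_weight i x = 1.
Proof. by rewrite -mulr_suml divff// gt_eqF// gibbs_sum_gt0. Qed.

(** This is [t * expR (- t) <= 1] at [t = beta * d]. A paraboloid well above another one has so
    little weight that an error proportional to its excess costs only [beta^-1]. *)
Lemma gibbs_weight_gap i j x :
  gibbs_weight i x * (paraboloid i x - paraboloid j x) <= beta^-1.
Proof.
set d := _ - _.
have S0 := gibbs_sum_gt0 x.
rewrite /gibbs_weight mulrAC ler_pdivrMr//.
apply: (@le_trans _ _ (beta^-1 * expR (- beta * paraboloid j x))); last first.
  by rewrite ler_pM2l ?invr_gt0// gibbs_term_le.
rewrite mulrC ler_pdivlMl//.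
rewrite (_ : - beta * paraboloid j x = beta * d + (- beta * paraboloid i x)); last first.
  by rewrite /d; ring.
rewrite expRD mulrA ler_pM2r ?expR_gt0//.
by apply: le_trans (expR_ge1Dx _); rewrite lerDr.
Qed.

(* Exact identity for paraboloids of equal opening: it turns a discrete
   slope bound on [U] into a bound on the gradient of [paraboloid i]. *)
Lemma paraboloid_slope i j x :
  dotrv (x - y i) (y j - y i) / kappa =
  U j - U i + dotrv (y j - y i) (y j - y i) / (2 * kappa) +
  (paraboloid i x - paraboloid j x).
Proof.
rewrite /paraboloid /dotrv.
rewrite [RHS](_ : _ = (\sum_(l < n) (y j - y i) ord0 l * (y j - y i) ord0 l) / (2 * kappa) +
  (\sum_(l < n) (x ord0 l - y i ord0 l) * (x ord0 l - y i ord0 l) / (2 * kappa) -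
   \sum_(l < n) (x ord0 l - y j ord0 l) * (x ord0 l - y j ord0 l) / (2 * kappa))); last first.
  by ring.
rewrite !mulr_suml -sumrB -big_split/=; apply: eq_bigr => l _.
by rewrite !mxE; field; rewrite gt_eqF.
Qed.

End softmin.

(** * Maximum norm, dot product and finite nets *)

Section rV_norm.
Context {R : realType} {n : nat}.
Local Notation Rn := 'rV[R]_n.
Implicit Types u v w : Rn.

Lemma normr_coord_le u i : `|u ord0 i| <= `|u|.
Proof.
rewrite [leRHS]/Num.norm/= mx_normrE.
exact: (le_bigmax _ (fun ij : 'I_1 * 'I_n => `|u ij.1 ij.2|) (ord0, i)).
Qed.

Lemma normr_rV_le u (M : R) : 0 <= M -> (forall i, `|u ord0 i| <= M) -> `|u| <= M.
Proof.
move=> M0 uM; rewrite [leLHS]/Num.norm/= mx_normrE.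
by apply: bigmax_le => // -[i j] _; rewrite (ord1 i).
Qed.

Lemma normr_dotrv u v : `|dotrv u v| <= n%:R * `|u| * `|v|.
Proof.
apply: (le_trans (ler_norm_sum _ _ _)).
apply: (@le_trans _ _ (\sum_(i < n) `|u| * `|v|)).
  by apply: ler_sum => i _; rewrite normrM ler_pM// normr_coord_le.
by rewrite sumr_const card_ord -[leLHS]mulr_natl mulrA.
Qed.

Lemma dotrv_ge0 u : 0 <= dotrv u u.
Proof. by apply: sumr_ge0 => i _; rewrite -expr2 sqr_ge0. Qed.

Lemma sqr_normr_le_dotrv u : `|u| * `|u| <= dotrv u u.
Proof.
have [n0|n0] := eqVneq `|u| 0; first by rewrite n0 mul0r dotrv_ge0.
have [[i j] /= uij] := mx_norm_neq0 n0.
rewrite (_ : `|u| = `|u i j|)//.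
rewrite -normrM ger0_norm; last by rewrite -expr2 sqr_ge0.
rewrite (ord1 i) /dotrv (bigD1 j)//= lerDl sumr_ge0// => k _.
by rewrite -expr2 sqr_ge0.
Qed.

Lemma dotrvDr u v w : dotrv u (v + w) = dotrv u v + dotrv u w.
Proof. by rewrite -big_split; apply: eq_bigr => i _; rewrite mxE mulrDr. Qed.

Lemma dotrvZr (a : R) u v : dotrv u (a *: v) = a * dotrv u v.
Proof. by rewrite [RHS]mulr_sumr; apply: eq_bigr => i _; rewrite mxE mulrCA. Qed.

Lemma dotrv_sumr (I : Type) (s : seq I) (P : pred I) u (F : I -> Rn) :
  dotrv u (\sum_(i <- s | P i) F i) = \sum_(i <- s | P i) dotrv u (F i).
Proof.
rewrite exchange_big; apply: eq_bigr => i _ /=.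
by rewrite summxE mulr_sumr.
Qed.

Lemma compact_closed_normr_le (M : R) : compact [set x : Rn | `|x| <= M].
Proof.
apply: bounded_closed_compact.
  by exists M; split => [|t Mt x /= xM]; [exact: num_real|exact: le_trans (ltW Mt)].
rewrite (_ : [set x : Rn | _] = [set x : Rn | `|x| \in `]-oo, M]]); last first.
  by apply/seteqP; split => x /=; rewrite in_itv.
apply: (@closed_comp _ _ (fun x : Rn => `|x|) [set r | r \in `]-oo, M]]).
  by move=> x _; exact: norm_continuous.
exact: interval_closed.
Qed.

(** The index type ['I_m.+1] records that the net is non-empty, which the positivity of the Gibbs
    sum and the choice of a lowest paraboloid require. *)
Lemma finite_net (M e : R) : 0 <= M -> 0 < e ->
  exists (m : nat) (y : 'I_m.+1 -> Rn), (forall i, `|y i| <= M) /\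
    forall x : Rn, `|x| <= M -> exists i, `|y i - x| <= e.
Proof.
move=> M0 e0; have := @compact_closed_normr_le M; rewrite compact_cover.
move=> /(_ _ [set x : Rn | `|x| <= M] (fun x => ball x e)) [].
- by move=> x _; exact: ball_open.
- by move=> x /= xM; exists x => //; exact: ballxx.
move=> F FM Fcov.
have [|y0 Fy0 _] := Fcov 0; first by rewrite /= normr0.
pose s := finmap.enum_fset F.
have s0 : (0 < size s)%N.
  have : y0 \in s by exact: Fy0.
  by case: s.
exists (size s).-1, (fun i => nth y0 s i); split=> [i|x xM].
  have : nth y0 s i \in s by rewrite mem_nth// (leq_trans (ltn_ord i))// prednK.
  by move=> /FM; rewrite inE.
have [z Fz zx] := Fcov x xM.
have zs : z \in s by exact: Fz.
have izs : (index z s < (size s).-1.+1)%N by rewrite prednK// index_mem.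
exists (Ordinal izs) => /=; rewrite nth_index//.
by move: zx; rewrite -ball_normE => /ltW.
Qed.

End rV_norm.

(** * Duality: cheap chains or subsolutions *)

Section potential.
Context {R : realType} {T : Type}.
Variables (E : T -> T -> Prop) (cost : T -> T -> R) (lam c B : R).
Hypotheses (lam0 : 0 < lam) (lam1 : lam < 1) (Exx : forall x, E x x)
  (cost0 : forall x y, 0 <= cost x y) (costxx : forall x, cost x x <= B).

Definition chain (p : nat -> T) := forall k, E (p k) (p k.+1).

Definition chain_cost (p : nat -> T) (K : nat) : R :=
  \sum_(k < K) lam ^+ k * cost (p k) (p k.+1).

(* The potential is the discounted value function: if it were below
   [c / (1 - lam)] somewhere, a cheap chain would exist. *)
Lemma potential_or_chain :
  (exists p, chain p /\ forall K, chain_cost p K <= c / (1 - lam)) \/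
  (exists u : T -> R, (forall x, 0 <= u x <= B / (1 - lam)) /\
    forall x y, E x y -> u x - u y <= cost x y - c).
Proof.
have l1 : 0 < 1 - lam by rewrite subr_gt0.
have [|nP] := pselect (exists p, chain p /\ forall K, chain_cost p K <= c / (1 - lam)).
  by left.
right.
(* The total cost is encoded by bounds on all partial sums, so no series has to converge. *)
pose S x := [set b | exists p, [/\ p 0%N = x, chain p & forall K, chain_cost p K <= b]].
have SB x : S x (B / (1 - lam)).
  exists (fun=> x); split => // K; rewrite /chain_cost -mulr_suml.
  have B0 : 0 <= B := le_trans (cost0 x x) (costxx x).
  have ge0 : 0 <= \sum_(i < K) lam ^+ i by apply: sumr_ge0 => i _; rewrite exprn_ge0// ltW.
  apply: (le_trans (ler_wpM2l ge0 (costxx x))).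
  rewrite mulrC ler_wpM2l// -[leRHS]mul1r ler_pdivlMr// mulrC.
  by rewrite -opprB mulNr -subrX1 opprB gerBl exprn_ge0// ltW.
have cS x b : S x b -> c / (1 - lam) <= b.
  move=> [p [_ Ep pb]]; rewrite leNgt; apply/negP => bc; apply: nP.
  by exists p; split => // K; exact: le_trans (ltW bc).
have S0 x b : S x b -> 0 <= b.
  by move=> [p [_ _ /(_ 0%N)]]; rewrite /chain_cost big_ord0.
have hS x : has_inf (S x).
  split; first by exists (B / (1 - lam)).
  by exists 0 => b /S0.
exists (fun x => inf (S x)); split=> [x|x y Exy].
  apply/andP; split; first by apply: lb_le_inf; [case: (hS x)|move=> b /S0].
  by apply: ge_inf => //; case: (hS x).
(* Dynamic programming: prepending [x] to a chain from [y] delays that chain by one step, hence the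
   factor [lam]. *)
have step b : S y b -> inf (S x) <= cost x y + lam * b.
  move=> [p [p0 Ep pb]]; apply: ge_inf; first by case: (hS x).
  exists (fun k => if k is k'.+1 then p k' else x); split=> // [[|k]|[|K]] //=.
  - by rewrite p0.
  - rewrite /chain_cost big_ord0 addr_ge0// mulr_ge0 ?(ltW lam0)//.
    by apply: (S0 y); exists p.
  rewrite /chain_cost big_ord_recl/= expr0 mul1r p0 lerD2l.
  rewrite (_ : \sum_(i < K) _ = lam * chain_cost p K); first by rewrite ler_pM2l.
  by rewrite mulr_sumr; apply: eq_bigr => i _; rewrite exprS mulrA.
(* The absence of cheap chains enters here. It bounds the term [(1 - lam) * inf (S y)], lost to the
   discount, from below by [c]. *)
have cu : c / (1 - lam) <= inf (S y) by apply: lb_le_inf; [case: (hS y)|move=> b /cS].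
have : inf (S x) <= cost x y + lam * inf (S y).
  rewrite -lerBlDl -ler_pdivrMl//; apply: lb_le_inf; first by case: (hS y).
  by move=> b /step; rewrite -lerBlDl ler_pdivrMl.
rewrite ler_pdivrMr// in cu.
move=> h; have : inf (S y) * (1 - lam) = inf (S y) - lam * inf (S y) by ring.
by move: h cu; lra.
Qed.

End potential.

(** * Slope of the softmin attached to a discrete potential *)

Section softmin_slope.
Context {R : realType} {n m : nat}.
Local Notation Rn := 'rV[R]_n.
Variables (y : 'I_m.+1 -> Rn) (U : 'I_m.+1 -> R) (L : Rn -> Rn -> R).
Variables (M r h eps eta kappa D c beta : R).
Hypotheses (M0 : 0 <= M) (r0 : 0 < r) (r1 : r <= 1) (h0 : 0 < h)
  (eta0 : 0 < eta) (kappa0 : 0 < kappa) (D0 : 0 <= D) (c0 : 0 <= c) (beta0 : 0 < beta).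
Hypothesis ynet : forall x : Rn, `|x| <= M + 2 -> exists i, `|y i - x| <= eps.
Hypothesis Lge0 : forall x v, 0 <= L x v.
Hypothesis Lmod : forall x x' v v', `|x| <= M -> `|v| <= M ->
  `|x' - x| <= r -> `|v' - v| <= r -> L x' v' <= L x v + eta.
Hypothesis Uslope : forall i j, `|y j - y i| <= h * (M + 1) ->
  U j - U i <= h * (L (y i) (h^-1 *: (y j - y i)) - c).
Hypothesis Ubnd : forall i, - D <= U i <= 0.
Hypotheses (hM : h * M <= 1) (epsr : eps <= h * r)
  (epsk : n%:R * r * eps <= eta * (kappa * h)) (eps2 : n%:R * (eps * eps) <= 2 * kappa)
  (hk : h * n%:R * ((M + 1) * (M + 1)) <= eta * (2 * kappa))
  (rk : (D + 1) * (4 * kappa) <= r * r).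

Local Notation f := (paraboloid y U kappa).
Local Notation C := (h^-1 + 4 * n%:R * M / r + c).

Lemma dotrv_self_le (u : Rn) (a : R) : `|u| <= a -> dotrv u u <= n%:R * (a * a).
Proof.
move=> ua; apply: (le_trans (ler_norm _)); apply: (le_trans (normr_dotrv _ _)).
by rewrite -mulrA ler_wpM2l// ler_pM.
Qed.

(** The velocity [v] is rounded to the velocity [v'] of the edge from [y i] to a net point [y j]
    near [y i + h *: v]; then [paraboloid_slope] is divided by [h] and [Uslope] inserted. The three
    [eta] pay for moving [L] from [(y i, v')] to [(x, v)], for the quadratic term, and for the slope
    along [v - v']. *)
Lemma slope_near x v i i0 : `|x| <= M -> `|v| <= M -> (forall j, f i0 x <= f j x) ->
  `|y i - x| <= r ->
  dotrv (x - y i) v / kappa <= L x v - c + 3 * eta + h^-1 * (f i x - f i0 x).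
Proof.
move=> xM vM fmin yx.
(* The radius [M + 2] of the net comes from here: [y i] is within [r <= 1] of [x], and the step
   [h *: v] has length at most 1. *)
have [j jz] : exists j, `|y j - (y i + h *: v)| <= eps.
  apply: ynet; rewrite (_ : y i + h *: v = (y i - x) + x + h *: v); last by rewrite subrK.
  apply: (le_trans (ler_normD _ _)); rewrite normrZ (gtr0_norm h0).
  apply: (@le_trans _ _ ((r + M) + h * M)); last by have := r1; have := hM; lra.
  rewrite lerD ?ler_pM2l//.
  by apply: (le_trans (ler_normD _ _)); rewrite lerD.
pose v' := h^-1 *: (y j - y i).
have yv' : y j - y i = h *: v' by rewrite /v' scalerA divff ?gt_eqF// scale1r.
have vv' : `|v' - v| <= eps / h.
  rewrite ler_pdivlMr// mulrC -[X in X * _](gtr0_norm h0) -normrZ scalerBr -yv'.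
  by rewrite -addrA -opprD.
have vv'r : `|v' - v| <= r by apply: (le_trans vv'); rewrite ler_pdivrMr// mulrC.
have v'M : `|v'| <= M + 1.
  rewrite (_ : v' = v + (v' - v)); last by rewrite addrC subrK.
  by apply: (le_trans (ler_normD _ _)); rewrite lerD// (le_trans vv'r).
have yM : `|y j - y i| <= h * (M + 1) by rewrite yv' normrZ (gtr0_norm h0) ler_pM2l.
have H1 := paraboloid_slope y U kappa0 i j x.
have H2 := Uslope yM; rewrite -/v' in H2.
have H3 := Lmod xM vM yx vv'r.
have H4 := fmin j.
have H5 : dotrv (y j - y i) (y j - y i) / (2 * kappa) <= h * eta.
  rewrite ler_pdivrMr ?mulr_gt0//; apply: (le_trans (dotrv_self_le yM)).
  rewrite (_ : n%:R * _ = h * (h * n%:R * ((M + 1) * (M + 1)))); last by ring.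
  by rewrite -[leRHS]mulrA ler_pM2l.
have H6 : dotrv (x - y i) v' / kappa <= L x v - c + 2 * eta + h^-1 * (f i x - f i0 x).
  rewrite -(ler_pM2l h0) mulrA -dotrvZr -yv' H1 mulrDr mulrA divff ?gt_eqF// mul1r.
  have H2' : U j - U i <= h * (L x v + eta - c).
    by apply: (le_trans H2); rewrite ler_pM2l//; lra.
  have -> : h * (L x v - c + 2 * eta) = h * (L x v + eta - c) + h * eta by ring.
  by lra.
have H7 : dotrv (x - y i) (v - v') / kappa <= eta.
  rewrite ler_pdivrMr//; apply: (le_trans (ler_norm _)); apply: (le_trans (normr_dotrv _ _)).
  apply: (@le_trans _ _ (n%:R * r * (eps / h))).
    by rewrite ler_pM ?mulr_ge0//; [rewrite ler_wpM2l// distrC|rewrite distrC].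
  by rewrite mulrA ler_pdivrMr// -[leRHS]mulrA.
rewrite (_ : v = v' + (v - v')); last by rewrite addrC subrK.
rewrite dotrvDr mulrDl [v' + _]addrC subrK.
by lra.
Qed.

(** With [a] the distance from [x] to [y i], the slope grows like [a / kappa], but the excess of
    [f i] over the minimum grows like [a * a / kappa]. Indeed a net point near [x] has value at most
    1, so by [rk] the excess is at least [r * a / (4 * kappa)], and this dominates the slope up to
    the factor [4 * n%:R * M / r]. The excess is also at least 1, which absorbs [c]. *)
Lemma slope_far x v i i0 : `|x| <= M -> `|v| <= M -> (forall j, f i0 x <= f j x) ->
  r < `|y i - x| ->
  dotrv (x - y i) v / kappa <= L x v - c + (4 * n%:R * M / r + c) * (f i x - f i0 x).
Proof.
move=> xM vM fmin yx.
set a := `|y i - x| in yx.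
have [j jx] : exists j, `|y j - x| <= eps by apply: ynet; lra.
have k2 : 0 < 2 * kappa by rewrite mulr_gt0.
have fE l : f l x = U l + dotrv (x - y l) (x - y l) / (2 * kappa).
  by rewrite /paraboloid /dotrv mulr_suml; congr (_ + _); apply: eq_bigr => q _; rewrite !mxE.
have Hj : f j x <= 1.
  have /andP[_ U0] := Ubnd j.
  have : dotrv (x - y j) (x - y j) / (2 * kappa) <= 1.
    rewrite ler_pdivrMr// mul1r; apply: le_trans eps2.
    by apply: dotrv_self_le; rewrite distrC.
  by rewrite fE; lra.
have Hi : - D + a * a / (2 * kappa) <= f i x.
  have /andP[UD _] := Ubnd i.
  by rewrite fE lerD// ler_pM2r ?invr_gt0// /a distrC sqr_normr_le_dotrv.
have ra : r * a <= a * a by rewrite ler_pM2r ?(ltW yx)// (lt_trans r0).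
have rr : r * r <= r * a by rewrite ler_pM2l// ltW.
have E4 (z : R) : z / (2 * kappa) = 2 * (z / (4 * kappa)) by field; rewrite gt_eqF.
have k4 : 0 < 4 * kappa by rewrite mulr_gt0.
have rka : D + 1 <= r * a / (4 * kappa).
  by rewrite ler_pdivlMr//; apply: le_trans rr.
have gap : r * a / (4 * kappa) <= f i x - f i0 x.
  have := fmin j; rewrite E4 in Hi.
  have : r * a / (4 * kappa) <= a * a / (4 * kappa) by rewrite ler_pM2r ?invr_gt0.
  by lra.
set d := f i x - f i0 x in gap *.
have H1 : dotrv (x - y i) v / kappa <= 4 * n%:R * M / r * d.
  apply: (@le_trans _ _ (n%:R * a * M / kappa)).
    rewrite ler_pM2r ?invr_gt0//; apply: (le_trans (ler_norm _)).
    apply: (le_trans (normr_dotrv _ _)).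
    by rewrite ler_pM ?mulr_ge0// /a distrC.
  rewrite (_ : n%:R * a * M / kappa = 4 * n%:R * M / r * (r * a / (4 * kappa))); last first.
    by field; rewrite !gt_eqF.
  by rewrite ler_wpM2l// divr_ge0 ?mulr_ge0// ltW.
have H2 : c <= c * d by rewrite ler_peMr//; have := D0; lra.
have := Lge0 x v.
by rewrite mulrDl; lra.
Qed.

(** The near and far estimates are both of the form [q + C * excess] with one constant [C].
    Averaging with the Gibbs weights keeps [q], and each of the [m.+1] excess terms contributes at
    most [C / beta] by [gibbs_weight_gap]. *)
Lemma derive_softmin_le x v : `|x| <= M -> `|v| <= M ->
  'D_v (softmin y U kappa beta) x <= L x v - c + 3 * eta + C * (m.+1%:R / beta).
Proof.
move=> xM vM; rewrite (derive_softmin y U ord0 kappa0 beta0).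
have [i0 fmin] : exists i0, forall j, f i0 x <= f j x.
  by case: (@arg_minP _ _ _ (ord0 : 'I_m.+1) xpredT (fun i => f i x)) => // i _ H; exists i => j; exact: H.
have C0 : 0 <= C by rewrite !addr_ge0 ?divr_ge0 ?mulr_ge0 ?invr_ge0// ltW.
have slope i : dotrv (x - y i) v / kappa <= L x v - c + 3 * eta + C * (f i x - f i0 x).
  have d0 : 0 <= f i x - f i0 x by rewrite subr_ge0.
  have [yx|yx] := leP `|y i - x| r.
    apply: (le_trans (slope_near xM vM fmin yx)); rewrite lerD2l ler_wpM2r//.
    by rewrite -addrA lerDl addr_ge0// divr_ge0 ?mulr_ge0// ltW.
  apply: (le_trans (slope_far xM vM fmin yx)); rewrite lerD//; first by have := eta0; lra.
  by rewrite ler_wpM2r// -addrA lerDr invr_ge0 ltW.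
set q := L x v - c + 3 * eta in slope *.
pose th := gibbs_weight y U kappa beta.
apply: (@le_trans _ _ (\sum_i (th i x * q + C * (th i x * (f i x - f i0 x))))).
  apply: ler_sum => i _.
  rewrite (_ : _ + _ = th i x * (q + C * (f i x - f i0 x))); last by ring.
  by rewrite ler_wpM2l// (gibbs_weight_ge0 _ _ _ _ i0).
rewrite big_split/= -mulr_suml (gibbs_weight_sum1 _ _ _ _ i0).
rewrite mul1r lerD2l -mulr_sumr ler_wpM2l//.
rewrite (_ : m.+1%:R / beta = \sum_(i < m.+1) beta^-1); last first.
  by rewrite sumr_const card_ord -[RHS]mulr_natl.
by apply: ler_sum => i _; exact: (gibbs_weight_gap _ _ _ i0).
Qed.

End softmin_slope.

Section discrete_chain.
Context {R : realType} {n : nat}.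
Local Notation Rn := 'rV[R]_n.

(** A consequence of [1 + a <= expR a]. It compares the total weight [1 / (1 - expR (- a))] of a
    discounted sum with [1 / a], its continuous counterpart. *)
Lemma discount_gap (a : R) : 0 < a -> a / (1 - expR (- a)) <= 1 + a.
Proof.
move=> a0; have e1 : expR (- a) < 1 by rewrite expR_lt1 oppr_lt0.
rewrite ler_pdivrMr ?subr_gt0// expRN.
have a1 : 0 < 1 + a by rewrite addr_gt0.
rewrite mulrBr mulr1 -lerBlDl.
have : (1 + a) / expR a <= 1 by rewrite ler_pdivrMr ?expR_gt0// mul1r expR_ge1Dx.
by lra.
Qed.

(** Integrability belongs to the condition because the contradiction in [discrete_chain] compares
    this integral with another one. *)
Definition closed_along (nu : probability Rn R) (D : set Rn) (v : Rn -> Rn) :=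
  forall g : Rn -> R, smooth_fun g ->
    nu.-integrable D (fun x => ('D_(v x) g x)%:E) /\
    (\int[nu]_(x in D) ('D_(v x) g x)%:E = 0)%E.

(** One-sided, since only upper bounds on [L] at nearby points are used. The nearby point is not
    confined to the disk, as a net point close to [x] may lie outside it. *)
Definition semicontinuous_modulus (M : R) (L : Rn -> Rn -> R) :=
  forall eta, 0 < eta -> exists2 r, 0 < r & forall x x' v v',
    `|x| <= M -> `|v| <= M -> `|x' - x| <= r -> `|v' - v| <= r ->
    L x' v' <= L x v + eta.

(** The order of the choices is what makes the constants compatible: [r] from the modulus of [L],
    then [kappa] from a bound [Dd] that does not involve [h], then the threshold [h0]; for a given
    [h] the mesh [eps], and last [beta], which depends on the number of net points. *)
Lemma discrete_chain (nu : probability Rn R) (D : set Rn) (v : Rn -> Rn)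
    (M B c rho : R) (L : Rn -> Rn -> R) :
  measurable D -> nu D = 1%E -> 0 <= M -> 0 < rho ->
  (forall x, D x -> `|x| <= M /\ `|v x| <= M) ->
  closed_along nu D v ->
  (forall x u, 0 <= L x u) -> (forall x, `|x| <= M + 2 -> L x 0 <= B) ->
  semicontinuous_modulus M L ->
  nu.-integrable D (fun x => (L x (v x))%:E) ->
  (\int[nu]_(x in D) (L x (v x))%:E < c%:E)%E ->
  exists2 h0, 0 < h0 & forall h, 0 < h -> h <= h0 ->
  exists p : nat -> Rn, [/\ forall k, `|p k| <= M + 2,
    forall k, `|p k.+1 - p k| <= h * (M + 1) &
    forall K, \sum_(k < K) expR (- (rho * h)) ^+ k * L (p k) (h^-1 *: (p k.+1 - p k))
      <= c / (1 - expR (- (rho * h)))].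
Proof.
move=> mD nuD M0 rho0 DM Dv L0 LB Lmod iL Lc.
have fL : (\int[nu]_(x in D) (L x (v x))%:E)%E \is a fin_num by exact: integrable_fin_num.
set l := fine (\int[nu]_(x in D) (L x (v x))%:E)%E.
have lE : (\int[nu]_(x in D) (L x (v x))%:E)%E = l%:E by rewrite /l fineK.
have l0 : 0 <= l.
  by rewrite /l fine_ge0// integral_ge0// => x _; rewrite lee_fin.
have lc : l < c by rewrite -lte_fin -lE.
(* The softmin estimate loses [4 * eta], three in the slopes and one through [beta]. The integrated
   inequality [0 <= l + 4 * eta - c] is then false. *)
pose eta := (c - l) / 8.
have eta0 : 0 < eta by rewrite divr_gt0// subr_gt0.
have etaE : eta * 8 = c - l by rewrite /eta divfK.
clearbody eta.
have [r' r'0 r'P] := Lmod _ eta0.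
pose r := Num.min r' 1.
have r0 : 0 < r by rewrite lt_min r'0 ltr01.
have r1 : r <= 1 by rewrite ge_min lexx orbT.
have rP x x' u u' : `|x| <= M -> `|u| <= M -> `|x' - x| <= r -> `|u' - u| <= r ->
    L x' u' <= L x u + eta.
  have rr' : r <= r' by rewrite ge_min lexx.
  by move=> xM uM h1 h2; apply: r'P => //; exact: le_trans rr'.
clearbody r.
have B0 : 0 <= B by apply: le_trans (LB 0 _); rewrite ?L0// normr0; lra.
(* An upper bound of [h * u] valid for every [h <= 1]: the potential is at most [B / (1 - lam)], and
   [discount_gap] controls [h / (1 - lam)]. *)
pose Dd := B * (1 + rho) / rho.
have Dd0 : 0 <= Dd by rewrite divr_ge0 ?mulr_ge0//; lra.
have DdE : Dd = B * (1 + rho) / rho by [].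
clearbody Dd.
pose kappa := r * r / (4 * (Dd + 1)).
have kappa0 : 0 < kappa by rewrite divr_gt0 ?mulr_gt0//; lra.
have kE : (Dd + 1) * (4 * kappa) = r * r.
  by rewrite /kappa; field; rewrite gt_eqF//; lra.
clearbody kappa.
have n0 : 0 <= n%:R :> R by rewrite ler0n.
have M1 : 0 < M + 1 by lra.
have n1 : 0 < n%:R + 1 :> R by lra.
have M10 : 0 < (M + 1) * (M + 1) by rewrite mulr_gt0.
pose h0 := Num.min (Num.min 1 (M + 1)^-1) (eta * (2 * kappa) / ((n%:R + 1) * ((M + 1) * (M + 1)))).
have h00 : 0 < h0.
  by rewrite !lt_min ltr01 invr_gt0 M1/= divr_gt0 ?mulr_gt0//.
exists h0 => // h hp hh0.
have [hl1 hlM hlk] : [/\ h <= 1, h * (M + 1) <= 1 &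
    h * ((n%:R + 1) * ((M + 1) * (M + 1))) <= eta * (2 * kappa)].
  move: hh0; rewrite !le_min => /andP[/andP[h1 h2] h3]; split => //.
    by rewrite -ler_pdivlMr ?mul1r.
  by rewrite -ler_pdivlMr// mulr_gt0//.
set lam := expR (- (rho * h)).
have lam0 : 0 < lam by exact: expR_gt0.
have lam1 : lam < 1 by rewrite expR_lt1 oppr_lt0 mulr_gt0.
pose eps := Num.min (Num.min (h * r) (eta * (kappa * h) / (n%:R * r + 1)))
                    (Num.min 1 (2 * kappa / (n%:R + 1))).
have nr0 : 0 < n%:R * r + 1 by rewrite ltr_wpDl// mulr_ge0// ltW.
have eps0 : 0 < eps.
  by rewrite !lt_min ltr01 !divr_gt0 ?mulr_gt0//.
have [e1 e2 e3 e4] : [/\ eps <= h * r, eps * (n%:R * r + 1) <= eta * (kappa * h),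
    eps <= 1 & eps * (n%:R + 1) <= 2 * kappa].
  have : eps <= eps by [].
  rewrite {2}/eps !le_min => /andP[/andP[h1 h2] /andP[h3 h4]]; split => //.
    by rewrite -ler_pdivlMr.
  by rewrite -ler_pdivlMr.
have [|m [y [yM ynet]]] := @finite_net R n (M + 2) eps _ eps0; first by lra.
(* Room for the speed [M] of the field plus the rounding to the net, which changes a velocity by at
   most [eps / h <= 1]. *)
pose E (i j : 'I_m.+1) : Prop := `|y j - y i| <= h * (M + 1).
pose cost i j := L (y i) (h^-1 *: (y j - y i)).
have hM1 : 0 <= h * (M + 1) by rewrite mulr_ge0 ?(ltW hp)//; lra.
have E0 i : E i i by rewrite /E subrr normr0.
have cB i : cost i i <= B by rewrite /cost subrr scaler0; exact: LB.
have [[q [Eq qC]]|[u [uB uS]]] :=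
    @potential_or_chain R _ E cost lam c B lam0 lam1 E0 (fun i j => L0 _ _ : 0 <= cost i j) cB.
  by exists (y \o q); split => //= k; exact: Eq.
exfalso.
pose U i := - (h * u i).
have Ubnd i : - Dd <= U i <= 0.
  have /andP[u0 uu] := uB i.
  rewrite /U lerN2 oppr_le0 mulr_ge0 ?(ltW hp)// andbT.
  apply: (@le_trans _ _ (h * (B / (1 - lam)))); first by rewrite ler_pM2l.
  have := discount_gap (mulr_gt0 rho0 hp); rewrite -/lam => dg.
  rewrite DdE (_ : h * (B / (1 - lam)) = B * (rho * h / (1 - lam)) / rho); last first.
    by field; rewrite !gt_eqF// subr_gt0.
  rewrite ler_pM2r ?invr_gt0// ler_wpM2l// (le_trans dg)// lerD2l.
  by rewrite -[leRHS]mulr1 ler_pM2l.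
have Uslope i j : `|y j - y i| <= h * (M + 1) ->
    U j - U i <= h * (L (y i) (h^-1 *: (y j - y i)) - c).
  move=> Eij; rewrite /U (_ : _ - _ = h * (u i - u j)); last by ring.
  by rewrite ler_pM2l//; exact: uS.
pose C := h^-1 + 4 * n%:R * M / r + c.
have c0 : 0 <= c by exact: le_trans (ltW lc).
have C0 : 0 < C.
  rewrite ltr_wpDr// ltr_wpDr ?invr_gt0// divr_ge0// ?(ltW r0)// !mulr_ge0//.
pose beta := C * m.+1%:R / eta.
have beta0 : 0 < beta by rewrite divr_gt0// mulr_gt0.
have Cb : C * (m.+1%:R / beta) = eta.
  by rewrite /beta; field; rewrite !gt_eqF.
have key x : D x -> 'D_(v x) (softmin y U kappa beta) x <= L x (v x) + (4 * eta - c).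
  move=> /DM[xM vM].
  have := @derive_softmin_le R n m y U L M r h eps eta kappa Dd c beta.
  move=> /(_ M0 r0 r1 hp eta0 kappa0 Dd0 c0 beta0 ynet L0 rP Uslope Ubnd).
  move=> /(_ _ e1 _ _ _ _ _ (v x) xM vM) H.
  apply: le_trans (H _ _ _ _ _) _.
  - by have := ltW hp; lra.
  - by apply: le_trans e2; rewrite [leRHS]mulrDr mulr1 [eps * _]mulrC lerDl ltW.
  - apply: le_trans e4; rewrite mulrA.
    apply: (@le_trans _ _ (n%:R * eps)); first by rewrite ler_piMr// mulr_ge0// ltW.
    by rewrite mulrDr mulr1 mulrC lerDl ltW.
  - apply: le_trans hlk; rewrite -[leLHS]mulrA ler_pM2l// ler_pM2r// lerDl//.
  - by rewrite kE.
  by rewrite -/C Cb; lra.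
have [ig g0] := Dv _ (smooth_softmin y U kappa beta (ord0 : 'I_m.+1)).
have iR : nu.-integrable D (fun x => (L x (v x) + (4 * eta - c))%:E).
  under eq_fun do rewrite EFinD.
  apply: integrableD => //.
  by apply: finite_measure_integrable_cst.
have : (0 <= \int[nu]_(x in D) (L x (v x) + (4 * eta - c))%:E)%E.
  rewrite -g0; apply: le_integral => // x /set_mem Dx.
  by rewrite lee_fin; exact: key.
under eq_integral do rewrite EFinD.
rewrite integralD//; last exact: finite_measure_integrable_cst.
have -> : (\int[nu]_(x in D) (4 * eta - c)%:E = (4 * eta - c)%:E)%E.
  by rewrite integral_cst// -[RHS]mule1; congr (_ * _)%E.
rewrite lE -EFinD lee_fin.
by move: etaE lc; lra.
Qed.

End discrete_chain.

(** Stronger than uniform continuity of the restriction to [K]: the second point may lie outside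
    [K]. *)
Lemma compact_modulus {R : realType} {T : pseudoMetricType R} (f : T -> R) (K : set T) :
  continuous f -> compact K -> forall eta, 0 < eta -> exists2 r, 0 < r &
  forall x x', K x -> ball x r x' -> `|f x' - f x| <= eta.
Proof.
move=> cf cK eta eta0.
suff H : \forall r \near 0^'+, K `<=` (fun x => forall x', ball x r x' -> `|f x' - f x| <= eta).
  have [r [/= r0 rP]] := filter_ex (filterI (nbhs_right_gt (0 : R)) H).
  by exists r => // x x' Kx; exact: rP.
apply: (compact_near_coveringP K).1 => // x Kx.
  have e2 : 0 < eta / 2 by rewrite divr_gt0.
  have /cvgrPdist_le/(_ _ e2)/nbhs_ballP[d /= d0 dP] := cf x.
  have d20 : 0 < d / 2 by rewrite divr_gt0.
  exists (ball x (d / 2), [set r | 0 < r < d / 2]) => /=.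
    split; first exact: nbhsx_ballx.
    near=> r => /=; apply/andP; split => //; near: r; exact: nbhs_right_lt.
  move=> [x' r] /= [xx' /andP[r0 rd]] x'' rx''.
  have x1 : `|f x - f x'| <= eta / 2.
    by apply: dP; apply: le_ball xx'; lra.
  have x2 : `|f x - f x''| <= eta / 2.
    apply: dP; rewrite (splitr d); apply: ball_triangle xx' _.
    by apply: le_ball rx''; exact: ltW.
  rewrite (_ : f x'' - f x' = (f x - f x') - (f x - f x'')); last by ring.
  by apply: (le_trans (ler_normB _ _)); rewrite (splitr eta) lerD.
Unshelve. all: by end_near. Qed.

(** * From chains to curves *)

Section joint_continuity.
Context {R : realType} {n : nat}.
Local Notation Rn := 'rV[R]_n.
Variable L : Rn -> Rn -> R.
Hypothesis cL : continuous (fun z : Rn * Rn => L z.1 z.2).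

Let compact_bidisk (M : R) : compact [set z : Rn * Rn | `|z.1| <= M /\ `|z.2| <= M].
Proof.
rewrite (_ : mkset _ = [set x : Rn | `|x| <= M] `*` [set x : Rn | `|x| <= M])//.
by apply: compact_setX; exact: compact_closed_normr_le.
Qed.

Lemma continuous_modulus (M : R) : semicontinuous_modulus M L.
Proof.
move=> eta eta0; have [r r0 rP] := compact_modulus cL (@compact_bidisk M) eta0.
have r20 : 0 < r / 2 by rewrite divr_gt0.
exists (r / 2) => // x x' v v' xM vM xx vv.
have /= := rP (x, v) (x', v') (conj xM vM); rewrite ler_norml => H.
have /H/andP[_] : ball (x, v) r (x', v').
  by split; rewrite /= -ball_normE/= distrC; lra.
by rewrite lerBlDl.
Qed.

Lemma continuous_disk_bound (M : R) : exists B, forall x, `|x| <= M -> L x 0 <= B.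
Proof.
have [M0|M0] := ltP M 0.
  by exists 0 => x xM; have := le_trans (normr_ge0 x) xM; lra.
have [r r0 rP] := compact_modulus cL (@compact_bidisk M) (@ltr01 R).
have [m [y [yM ynet]]] := @finite_net R n M (r / 2) M0 (divr_gt0 r0 (ltr0n _ 2)).
exists (1 + \sum_i `|L (y i) 0|) => x xM.
have [i yx] := ynet _ xM.
have /= := rP (y i, 0) (x, 0); rewrite yM normr0 => /(_ (conj erefl M0)) H.
have := H _; rewrite ler_norml => H'.
have /H'/andP[_ h] : ball (y i, 0 : Rn) r (x, 0 : Rn).
  by split; rewrite /= -ball_normE/= ?subrr ?normr0//; lra.
have : L (y i) 0 <= \sum_i `|L (y i) 0|.
  rewrite (bigD1 i)//=; apply: (le_trans (ler_norm _)); rewrite lerDl.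
  exact: sumr_ge0.
by lra.
Qed.

Lemma cvg_compose2 {T : Type} (F : set_system T) {FF : Filter F} (f g : T -> Rn) x v :
  f @ F --> x -> g @ F --> v -> L (f t) (g t) @[t --> F] --> L x v.
Proof.
move=> fx gv.
apply: continuous2_cvg fx gv; exact: (@cL (x, v)).
Qed.

Lemma continuous_compose2 {T : topologicalType} (f g : T -> Rn) :
  continuous f -> continuous g -> continuous (fun t => L (f t) (g t)).
Proof. by move=> cf cg t; apply: cvg_compose2; [exact: cf|exact: cg]. Qed.

End joint_continuity.

Section discounted_sums.
Context {R : realType}.

(** Shifting the index by [l] re-weights a discounted sum by [lam ^- l], which is at most
    [lam ^- q]. The mean over the [q.+1] shifts therefore has the same bound. *)
Lemma discounted_shift_average (lam S eta : R) (q : nat) (a b : nat -> R) :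
  0 < lam -> lam < 1 -> 0 <= eta -> (forall k, 0 <= a k) ->
  (forall K, \sum_(k < K) lam ^+ k * a k <= S) ->
  (forall k, b k <= q.+1%:R^-1 * \sum_(l < q.+1) (a (k + l)%N + eta)) ->
  forall K, \sum_(k < K) lam ^+ k * b k <= lam ^- q * S + eta / (1 - lam).
Proof.
move=> lam0 lam1 eta0 a0 aS bq K.
have ln0 : lam != 0 by rewrite gt_eqF.
have geo : \sum_(k < K) lam ^+ k <= (1 - lam)^-1.
  rewrite -[leRHS]mul1r ler_pdivlMr ?subr_gt0// mulrC.
  by rewrite -opprB mulNr -subrX1 opprB gerBl exprn_ge0// ltW.
have part l : (l <= q)%N -> \sum_(k < K) lam ^+ k * a (k + l)%N <= lam ^- q * S.
  move=> lq; have S0 : 0 <= S by have := aS 0%N; rewrite big_ord0.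
  apply: (@le_trans _ _ (lam ^- l * S)); last first.
    rewrite ler_wpM2r// lef_pV2 ?posrE ?exprn_gt0//.
    by rewrite ler_wiXn2l// ?ltW.
  rewrite ler_pdivlMl ?exprn_gt0// mulr_sumr; apply: le_trans _ (aS (l + K)%N).
  rewrite big_split_ord/=.
  rewrite [leLHS](_ : _ = \sum_(i < K) lam ^+ (l + i) * a (l + i)%N).
    by rewrite lerDr sumr_ge0// => i _; rewrite mulr_ge0// exprn_ge0// ltW.
  by apply: eq_bigr => i _; rewrite exprD mulrA addnC.
apply: (@le_trans _ _ (\sum_(k < K) q.+1%:R^-1 * \sum_(l < q.+1) (lam ^+ k * a (k + l)%N + lam ^+ k * eta))).
  apply: ler_sum => k _; apply: (@le_trans _ _ (lam ^+ k * (q.+1%:R^-1 * \sum_(l < q.+1) (a (k + l)%N + eta)))).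
    by rewrite ler_pM2l ?exprn_gt0.
  rewrite mulrCA ler_pM2l ?invr_gt0// mulr_sumr.
  by apply: ler_sum => l _; rewrite mulrDr.
rewrite -mulr_sumr exchange_big/= ler_pdivrMl//.
apply: (@le_trans _ _ (\sum_(l < q.+1) (lam ^- q * S + eta / (1 - lam)))).
  apply: ler_sum => l _; rewrite big_split/= lerD//; first by rewrite part// -ltnS.
  by rewrite -mulr_suml mulrC ler_wpM2l.
by rewrite sumr_const card_ord -[leLHS]mulr_natl.
Qed.

End discounted_sums.

Section step_functions.
Context {R : realType}.
Local Notation leb := (@lebesgue_measure R).

Local Notation halfline := (`[0, +oo[%classic : set R).

Let step_itv (h : R) k : set R := `[k%:R * h, k.+1%:R * h[%classic.

Let step_itv_bigcup (h : R) : 0 < h -> \bigcup_k step_itv h k = halfline.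
Proof.
move=> h0; apply/seteqP; split=> [t [k _]|t] /=.
  rewrite /step_itv/= !in_itv/= andbT => /andP[kt _]; apply: le_trans _ kt.
  by rewrite mulr_ge0// ltW.
rewrite in_itv/= andbT => t0; exists (Num.truncn (t / h)) => //.
have := truncn_itv (divr_ge0 t0 (ltW h0)).
by rewrite /step_itv/= in_itv/= ler_pdivlMr// ltr_pdivrMr.
Qed.

Let step_itv_trunc (h : R) k t : 0 < h -> step_itv h k t -> Num.truncn (t / h) = k.
Proof.
move=> h0; rewrite /step_itv/= in_itv/= => kt.
by apply: truncn_def; rewrite ler_pdivlMr// ltr_pdivrMr.
Qed.

(** On the [k]-th interval the discount is at most its value at the left end, which is the [k]-th
    weight of the sum; the interval contributes the factor [h]. *)
Lemma integral_step_le (h rho S : R) (a : nat -> R) :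
  0 < h -> 0 < rho -> (forall k, 0 <= a k) ->
  (forall K, \sum_(k < K) expR (- (rho * h)) ^+ k * a k <= S) ->
  measurable_fun halfline (fun t : R => expR (- (rho * t)) * a (Num.truncn (t / h))) /\
  (\int[leb]_(t in halfline) (expR (- (rho * t)) * a (Num.truncn (t / h)))%:E <= (h * S)%:E)%E.
Proof.
move=> h0 rho0 a0 aS.
have mE k : measurable (step_itv h k) by exact: measurable_itv.
have ce : continuous (fun t : R => expR (- (rho * t))).
  move=> t; apply: continuous_comp; last exact: continuous_expR.
  by apply: continuousN; apply: mulrl_continuous.
have mf : measurable_fun halfline (fun t : R => expR (- (rho * t)) * a (Num.truncn (t / h))).
  rewrite -(step_itv_bigcup h0); apply/measurable_fun_bigcup => // k.
  apply: (eq_measurable_fun (fun t : R => expR (- (rho * t)) * a k)).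
    by move=> t /set_mem kt; rewrite (step_itv_trunc h0 kt).
  apply: measurable_funM => //.
  by apply: measurable_funTS; exact: continuous_measurable_fun.
split=> //; rewrite -(step_itv_bigcup h0) ge0_integral_bigcup//; last 3 first.
- by rewrite (step_itv_bigcup h0); exact/measurable_EFinP.
- by move=> t _; rewrite lee_fin mulr_ge0.
- move=> i j _ _ [t [it jt]].
  by rewrite -(step_itv_trunc h0 it) (step_itv_trunc h0 jt).
apply: lime_le.
  by apply: is_cvg_nneseries => k _ _; apply: integral_ge0 => t _; rewrite lee_fin mulr_ge0.
apply: nearW => K.
apply: (@le_trans _ _ (\sum_(0 <= k < K) (h * (expR (- (rho * h)) ^+ k * a k))%:E)%E).
  apply: lee_sum => k _.
  apply: (@le_trans _ _ (\int[leb]_(t in step_itv h k) (cst (expR (- (rho * h)) ^+ k * a k)%:E t))%E).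
    apply: ge0_le_integral => //; first exact: mE.
    - by move=> t _; rewrite lee_fin mulr_ge0.
    - apply/measurable_EFinP; apply: measurable_funS mf => //.
      by rewrite -(step_itv_bigcup h0); exact: bigcup_sup.
    - move=> t kt; rewrite lee_fin (step_itv_trunc h0 kt) ler_wpM2r//.
      move: kt; rewrite /step_itv/= in_itv/= => /andP[kt _].
      rewrite -expRM_natl ler_expR mulrN lerN2 mulrCA ler_pM2l//.
  rewrite integral_cst; last exact: mE.
  rewrite [X in (_ * X)%E](_ : _ = h%:E).
    by rewrite -EFinM lee_fin mulrC.
  rewrite /step_itv; apply: (eq_trans (lebesgue_measure_itv _)) => /=.
  rewrite lte_fin ltr_pM2r// ltr_nat ltnSn.
  by rewrite -EFinD -mulrBl -natrB// subSnn mul1r.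
rewrite sumEFin lee_fin -mulr_sumr ler_pM2l// big_mkord; exact: aS.
Qed.

End step_functions.

Section equicontinuous_limit.
Context {R : realType} {n : nat}.
Local Notation Rn := 'rV[R]_n.

Lemma ultra_compact_lim {I : Type} {T : topologicalType} (U : set_system I) (K : set T) (f : I -> T) :
  UltraFilter U -> compact K -> (forall i, K (f i)) -> exists2 p, K p & f @ U --> p.
Proof.
move=> UU cK fK.
have [p [Kp clp]] := cK (f @ U) _ (@filterE _ U _ (f @^-1` K) fK).
exists p => // A pA.
have [//|UA] := in_ultra_setVsetC (f @^-1` A) UU.
by have [q [qA' qA]] := clp (~` A) A UA pA.
Qed.

(* An ultrafilter gives a limit at every time at once; the common modulus then
   turns it into a convergent subsequence, through finer and finer grids. *)
Lemma equi_lipschitz_limit (K Q : R) (g : nat -> R -> Rn) (h : nat -> R) :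
  0 <= K -> (forall m t, `|g m t| <= Q) ->
  (forall m s t, `|g m t - g m s| <= K * (`|t - s| + h m)) ->
  h @ \oo --> 0 ->
  exists gam : R -> Rn, [/\ forall t, `|gam t| <= Q,
    forall s t, `|gam t - gam s| <= K * `|t - s| &
    exists phi : nat -> nat, (forall j, (j <= phi j)%N) /\
      forall t, 0 <= t -> g (phi j) t @[j --> \oo] --> gam t].
Proof.
move=> K0 gQ gK h0.
have [U [UU sU]] := ultraFilterLemma eventually_filter.
have PU : ProperFilter U by exact: ultra_proper.
have /choice[gam gamP] : forall t, exists p : Rn, `|p| <= Q /\ g m t @[m --> U] --> p.
  move=> t; have [p pQ gp] := ultra_compact_lim UU (@compact_closed_normr_le R n Q) (gQ ^~ t).
  by exists p.
have gamQ t : `|gam t| <= Q by case: (gamP t).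
have gcv t : g m t @[m --> U] --> gam t by case: (gamP t).
have hU : h @ U --> 0 by apply: cvg_trans h0 => A; exact: sU.
have gamK s t : `|gam t - gam s| <= K * `|t - s|.
  have c1 : `|g m t - g m s| @[m --> U] --> `|gam t - gam s|.
    by apply: cvg_norm; apply: cvgB.
  have c2 : K * (`|t - s| + h m) @[m --> U] --> K * (`|t - s| + 0).
    by apply: cvgMr; apply: cvgD => //; exact: cvg_cst.
  rewrite -[`|t - s|]addr0; apply: (ler_cvg_to c1 c2).
  by apply: nearW => m; exact: gK.
exists gam; split => //.
pose e j : R := 2 ^- j.
have e0 j : 0 < e j by rewrite invr_gt0 exprn_gt0.
(* The grid of mesh [2 ^- j] on [[0, j]] is finite, so one set of the ultrafilter serves all its
   points, and such sets meet every tail. *)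
have /choice[phi phiP] : forall j : nat, exists m, (j <= m)%N /\ h m <= e j /\
    forall i : 'I_(j * 2 ^ j).+1, `|gam (i%:R * e j) - g m (i%:R * e j)| <= e j.
  move=> j; apply: (@filter_ex _ U).
  apply: filterI; first by apply: sU; exists j.
  apply: filterI.
    have /cvgrPdist_le/(_ _ (e0 j)) := hU.
    by apply: filterS => m /=; rewrite sub0r normrN => /(le_trans (ler_norm _)).
  apply: filter_forall => i.
  by have /cvgrPdist_le/(_ _ (e0 j)) := gcv (i%:R * e j).
exists phi; split=> [j|t t0]; first by case: (phiP j).
have ecv : e j @[j --> \oo] --> 0.
  have := @cvg_geometric R 1 2^-1; rewrite ger0_norm ?invr_ge0// invf_lt1// ltr1n => /(_ isT).
  by apply: cvg_trans; apply: near_eq_cvg; near=> j; rewrite /e /= mul1r exprVn.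
apply/cvgrPdist_le => eps eps0.
(* The budget in units of the mesh: [K] to move [gam] to the grid, 1 at the grid point, and [2 * K]
   to move [g] back, whose modulus carries the extra [h m]. *)
have C0 : 0 < 3 * K + 1 by lra.
have /cvgrPdist_le/(_ _ (divr_gt0 eps0 C0)) := ecv.
apply: filter_app; near=> j; rewrite sub0r normrN (gtr0_norm (e0 j)) ler_pdivlMr// => ej.
apply: le_trans ej.
have [_ [hj gj]] := phiP j.
set i := Num.truncn (t / e j).
have /truncn_itv/andP[it ti] : 0 <= t / e j by rewrite divr_ge0// ltW.
rewrite -/i ler_pdivlMr// in it; rewrite -/i ltr_pdivrMr// in ti.
have iB : (i < (j * 2 ^ j).+1)%N.
  rewrite ltnS -(ler_nat R) natrM natrX; apply: (le_trans (y := t / e j)).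
    by rewrite ler_pdivlMr.
  rewrite /e invrK ler_wpM2r ?exprn_ge0//.
  by near: j; exact: nbhs_infty_ger.
have ti2 : `|t - i%:R * e j| <= e j.
  by rewrite ger0_norm ?subr_ge0// lerBlDl; move: ti; rewrite -natr1 mulrDl mul1r => /ltW.
rewrite (_ : gam t - g (phi j) t = (gam t - gam (i%:R * e j)) +
   (gam (i%:R * e j) - g (phi j) (i%:R * e j)) + (g (phi j) (i%:R * e j) - g (phi j) t)); last first.
  by rewrite !subrKA.
have A1 : `|gam t - gam (i%:R * e j)| <= K * e j.
  by apply: (le_trans (gamK _ _)); rewrite ler_wpM2l.
have A2 := gj (Ordinal iB); rewrite /= in A2.
have A3 : `|g (phi j) (i%:R * e j) - g (phi j) t| <= K * (e j + e j).
  apply: (le_trans (gK _ _ _)); rewrite ler_wpM2l// lerD//.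
  by rewrite distrC.
apply: (le_trans (ler_normD _ _)); apply: (le_trans (lerD (ler_normD _ _) (lexx _))).
by move: A1 A2 A3; rewrite !mulrDr; lra.
Unshelve. all: by end_near. Qed.

End equicontinuous_limit.

Section chain_quotients.
Context {R : realType} {n : nat}.
Local Notation Rn := 'rV[R]_n.
Local Notation leb := (@lebesgue_measure R).
Local Notation halfline := (`[0, +oo[%classic : set R).

(** Only equal weights are needed, because the quotient of a chain over [q.+1] steps is the plain
    mean of its velocities. *)
Definition jensen_convex (L : Rn -> Rn -> R) := forall x q (u : nat -> Rn),
  L x (q.+1%:R^-1 *: \sum_(l < q.+1) u l) <= q.+1%:R^-1 * \sum_(l < q.+1) L x (u l).

(** The chain is cheap for [L], while the limit is later taken with a smaller Lagrangian [LN] that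
    stays fixed. Jensen bounds [LN] at the quotient by the mean of [LN] at the single velocities;
    [shift] moves the base points along the chain at the price [eta]. *)
Lemma chain_quotient_bound (p : nat -> Rn) (h rho M c eta : R) (q : nat) (L LN : Rn -> Rn -> R) :
  0 < h -> 0 < rho -> 0 <= eta ->
  (forall k, `|p k.+1 - p k| <= h * (M + 1)) ->
  (forall K, \sum_(k < K) expR (- (rho * h)) ^+ k * L (p k) (h^-1 *: (p k.+1 - p k))
      <= c / (1 - expR (- (rho * h)))) ->
  (forall x u, 0 <= LN x u <= L x u) -> jensen_convex LN ->
  (forall k l u, (l <= q)%N -> `|u| <= M + 1 -> LN (p k) u <= LN (p (k + l)%N) u + eta) ->
  let F t := expR (- (rho * t)) * LN (p (Num.truncn (t / h)))
     ((q.+1%:R * h)^-1 *: (p (Num.truncn (t / h) + q.+1)%N - p (Num.truncn (t / h)))) in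
  measurable_fun halfline F /\
  (\int[leb]_(t in halfline) (F t)%:E <=
    ((1 + rho * h) / rho * (expR (rho * (q.+1%:R * h)) * c + eta))%:E)%E.
Proof.
move=> h0 rho0 eta0 ph pS LNL jLN shift F.
set lam := expR (- (rho * h)) in pS *.
have lam0 : 0 < lam by exact: expR_gt0.
have lam1 : lam < 1 by rewrite expR_lt1 oppr_lt0 mulr_gt0.
pose v k := h^-1 *: (p k.+1 - p k).
have vM k : `|v k| <= M + 1.
  by rewrite normrZ ger0_norm ?invr_ge0 ?(ltW h0)// ler_pdivrMl.
pose b k := LN (p k) ((q.+1%:R * h)^-1 *: (p (k + q.+1)%N - p k)).
have L0 x u : 0 <= L x u by case/andP: (LNL x u) => /le_trans; apply.
have bE k : (q.+1%:R * h)^-1 *: (p (k + q.+1)%N - p k) = q.+1%:R^-1 *: \sum_(l < q.+1) v (k + l)%N.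
  rewrite -scaler_sumr invfM scalerA; congr (_ *: _).
  under eq_bigr do rewrite -addnS.
  by rewrite -(big_mkord xpredT (fun l => p (k + l.+1)%N - p (k + l)%N)) telescope_sumr// addn0.
have bb : forall K, \sum_(k < K) lam ^+ k * b k <= lam ^- q * (c / (1 - lam)) + eta / (1 - lam).
  apply: (@discounted_shift_average _ _ _ _ q (fun k => L (p k) (v k))) => // k.
  rewrite /b bE; apply: (le_trans (jLN _ _ (fun l => v (k + l)%N))).
  rewrite ler_pM2l ?invr_gt0//; apply: ler_sum => l _.
  apply: (le_trans (shift k l _ _ _)) => //; first by rewrite -ltnS.
  by rewrite lerD2r; case/andP: (LNL (p (k + l)%N) (v (k + l)%N)).
have b0 k : 0 <= b k by case/andP: (LNL (p k) ((q.+1%:R * h)^-1 *: (p (k + q.+1)%N - p k))).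
have [mF IF] := integral_step_le h0 rho0 b0 bb.
split=> //; apply: (le_trans IF); rewrite lee_fin.
have dg := discount_gap (mulr_gt0 rho0 h0); rewrite -/lam in dg.
have lq : lam ^- q <= expR (rho * (q.+1%:R * h)).
  rewrite /lam -expRM_natl -expRN ler_expR mulrN opprK mulrCA ler_pM2l// ler_pM2r//.
  by rewrite ler_nat.
have c0 : 0 <= c.
  by have := pS 0%N; rewrite big_ord0 pmulr_lge0 ?invr_gt0 ?subr_gt0.
have -> : h * (lam ^- q * (c / (1 - lam)) + eta / (1 - lam)) =
    (rho * h / (1 - lam)) / rho * (lam ^- q * c + eta).
  by field; rewrite !gt_eqF ?subr_gt0// exprn_gt0.
have l1 : 0 <= 1 - lam by rewrite subr_ge0 ltW.
rewrite ler_pM ?divr_ge0 ?l1 ?addr_ge0 ?mulr_ge0 ?invr_ge0 ?exprn_ge0 ?subr_ge0 ?(ltW lam1) ?(ltW lam0) ?(ltW rho0) ?(ltW h0)//.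
- by rewrite ler_pM2r ?invr_gt0.
- by rewrite lerD2r ler_wpM2r.
Qed.

End chain_quotients.

Section fatou_bounds.
Context d (T : measurableType d) (R : realType).
Variables (mu : {measure set T -> \bar R}) (D : set T).
Hypothesis mD : measurable D.

Lemma limn_einf_le_cst (u : nat -> \bar R) (B : \bar R) :
  (forall j, (u j <= B)%E) -> (limn_einf u <= B)%E.
Proof.
move=> uB; rewrite limn_einf_lim; apply: lime_le; first exact: is_cvg_einfs.
apply: nearW => j; apply: le_trans (uB j).
by apply: ereal_inf_lbound; exists j => /=.
Qed.

Lemma fatou_le_cst (f : nat -> T -> \bar R) (B : \bar R) :
  (forall j, measurable_fun D (f j)) -> (forall j x, D x -> (0 <= f j x)%E) ->
  (forall j, (\int[mu]_(x in D) f j x <= B)%E) ->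
  (\int[mu]_(x in D) limn_einf (f^~ x) <= B)%E.
Proof.
move=> mf f0 fB; apply: (le_trans (fatou mu mD mf f0)); exact: limn_einf_le_cst.
Qed.

Lemma fatou_cvg_le_cst (f : nat -> T -> \bar R) (g : T -> \bar R) (B : \bar R) :
  (forall j, measurable_fun D (f j)) -> (forall j x, D x -> (0 <= f j x)%E) ->
  (forall j, (\int[mu]_(x in D) f j x <= B)%E) ->
  (forall x, D x -> f j x @[j --> \oo] --> g x) ->
  (\int[mu]_(x in D) g x <= B)%E.
Proof.
move=> mf f0 fB fg; apply: le_trans (fatou_le_cst mf f0 fB).
rewrite le_eqVlt; apply/orP; left; apply/eqP; apply: eq_integral => x /set_mem Dx.
by have [-> _] := cvg_limn_einf_sup (fg x Dx).
Qed.

End fatou_bounds.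

Section discounted_curve.
Context {R : realType} {n : nat}.
Local Notation Rn := 'rV[R]_n.
Local Notation leb := (@lebesgue_measure R).
Local Notation halfline := (`[0, +oo[%classic : set R).

Lemma expr2V_gt0 s : 0 < 2 ^- s :> R.
Proof. by rewrite invr_gt0 exprn_gt0. Qed.

Lemma cvg_expr2V : 2 ^- s @[s --> \oo] --> (0 : R).
Proof.
have := @cvg_geometric R 1 2^-1; rewrite ger0_norm ?invr_ge0// invf_lt1// ltr1n => /(_ isT).
by apply: cvg_trans; apply: near_eq_cvg; near=> j; rewrite /= mul1r exprVn.
Unshelve. all: by end_near. Qed.

Lemma cvg_mul_expr2V (a : R) : a * 2 ^- s @[s --> \oo] --> (0 : R).
Proof.
have H : a * 2 ^- s @[s --> \oo] --> a * (0 : R).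
  by apply: cvgMr; exact: cvg_expr2V.
by rewrite mulr0 in H.
Qed.

Lemma lipschitz_curve_continuous (K : R) (f : R -> Rn) :
  (forall s t, `|f t - f s| <= K * `|t - s|) -> continuous f.
Proof.
move=> fK x; apply/cvgrPdist_le => e e0.
have K1 : 0 < `|K| + 1 by rewrite ltr_wpDl.
near=> y; rewrite distrC; apply: (le_trans (fK _ _)).
apply: (@le_trans _ _ ((`|K| + 1) * `|x - y|)).
  by rewrite distrC ler_wpM2r// (le_trans (ler_norm K))// lerDl.
rewrite -ler_pdivlMl//; near: y; apply: cvgr_dist_le => //.
by rewrite mulr_gt0// invr_gt0.
Unshelve. all: by end_near. Qed.

Lemma chain_dist (p : nat -> Rn) (a : R) k l :
  (forall i, `|p i.+1 - p i| <= a) -> `|p (k + l)%N - p k| <= l%:R * a.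
Proof.
move=> pa; elim: l => [|l IH]; first by rewrite addn0 subrr normr0 mul0r.
rewrite addnS -(subrKA (p (k + l)%N)); apply: (le_trans (ler_normD _ _)).
by rewrite -natr1 mulrDl mul1r addrC lerD.
Qed.

Lemma step_curve_modulus (p : nat -> Rn) (h K s t : R) :
  0 < h -> 0 <= K -> (forall i, `|p i.+1 - p i| <= h * K) -> 0 <= s -> 0 <= t ->
  `|p (Num.truncn (t / h)) - p (Num.truncn (s / h))| <= K * (`|t - s| + h).
Proof.
move=> h0 K0 ph; wlog st : s t / s <= t.
  move=> H s0 t0; have [st|/ltW ts] := leP s t; first exact: H.
  by rewrite distrC [`|t - s|]distrC; exact: H.
move=> s0 t0; set i := Num.truncn (s / h); set j := Num.truncn (t / h).
have /truncn_itv/andP[_ si] : 0 <= s / h by rewrite divr_ge0// ltW.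
have /truncn_itv/andP[jt _] : 0 <= t / h by rewrite divr_ge0// ltW.
have ij : (i <= j)%N by apply: le_truncn; rewrite ler_pM2r ?invr_gt0.
rewrite -/i in si; rewrite -/j in jt.
rewrite ltr_pdivrMr// in si; rewrite ler_pdivlMr// in jt.
rewrite -(subnKC ij); apply: (le_trans (chain_dist _ _ ph)).
rewrite mulrA mulrC ler_wpM2l// natrB// mulrBl ger0_norm ?subr_ge0//.
by move: si jt; rewrite -natr1 mulrDl mul1r; lra.
Qed.

(** There are two successive limits. For fixed [N] and a fixed observation time [2 ^- s], the
    quotients of the chains converge pointwise and Fatou gives the bound [c' / rho] for [L N] along
    [gam]. Then [N] grows, [s N] with it, and Fatou is applied again. *)
Theorem discounted_curve (nu : probability Rn R) (D : set Rn) (v : Rn -> Rn)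
    (M c c' rho : R) (L : nat -> Rn -> Rn -> R) :
  measurable D -> nu D = 1%E -> 0 <= M -> 0 < rho ->
  (forall x, D x -> `|x| <= M /\ `|v x| <= M) ->
  closed_along nu D v ->
  (forall N, continuous (fun z : Rn * Rn => L N z.1 z.2)) ->
  (forall N x u, 0 <= L N x u) -> (forall N x u, L N x u <= L N.+1 x u) ->
  (forall N, jensen_convex (L N)) ->
  (forall N, nu.-integrable D (fun x => (L N x (v x))%:E)) ->
  (forall N, (\int[nu]_(x in D) (L N x (v x))%:E < c%:E)%E) -> c < c' ->
  exists gam : R -> Rn, [/\ forall s t, `|gam t - gam s| <= (M + 1) * `|t - s|,
    forall t, `|gam t| <= M + 2 &
    exists s : nat -> nat, (forall N, (N <= s N)%N) /\
    (\int[leb]_(t in halfline) limn_einf (fun N =>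
       (expR (- (rho * t)) * L N (gam t) (2 ^+ s N *: (gam (t + 2 ^- s N) - gam t)))%:E)
     <= (c' / rho)%:E)%E].
Proof.
move=> mD nuD M0 rho0 DM Dv cL L0 Lmono jL iL Lc cc'.
have M1 : 0 <= M + 1 by lra.
have Lmod N := continuous_modulus (cL N).
have Lle N N' x u : (N <= N')%N -> L N x u <= L N' x u.
  by move=> /subnK <-; elim: (N' - N)%N => // k IH; exact: le_trans IH (Lmono _ _ _).
have c0 : 0 < c.
  rewrite -lte_fin; apply: le_lt_trans (Lc 0%N).
  by apply: integral_ge0 => x _; rewrite lee_fin.
(* The [m]-th chain is cheap for [L m]. Its time step is a power of 2, so that every coarser dyadic
   time is a whole number of steps. *)
have /choice[lp lpP] : forall m, exists lp : nat * (nat -> Rn), [/\ (m <= lp.1)%N,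
    forall k, `|lp.2 k| <= M + 2, forall k, `|lp.2 k.+1 - lp.2 k| <= 2 ^- lp.1 * (M + 1) &
    forall K, \sum_(k < K) expR (- (rho * 2 ^- lp.1)) ^+ k *
         L m (lp.2 k) ((2 ^- lp.1)^-1 *: (lp.2 k.+1 - lp.2 k))
      <= c / (1 - expR (- (rho * 2 ^- lp.1)))].
  move=> m; have [B LB] := continuous_disk_bound (cL m) (M + 2).
  have [h0 h00 h0P] := discrete_chain mD nuD M0 rho0 DM Dv (L0 m) LB (Lmod m M) (iL m) (Lc m).
  have /cvgrPdist_le/(_ _ h00) := cvg_expr2V.
  move=> /(filterI (nbhs_infty_ge m))/filter_ex[l [/= ml]].
  rewrite sub0r normrN (gtr0_norm (expr2V_gt0 _)) => lh.
  have [p [p1 p2 p3]] := h0P _ (expr2V_gt0 l) lh.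
  by exists (l, p).
pose l m := (lp m).1; pose p m := (lp m).2; pose h m : R := 2 ^- l m.
have hgt0 m : 0 < h m by exact: expr2V_gt0.
(* Freezing the chain at negative times gives a limit that is Lipschitz on the whole line, the
   domain of the curves in [path_differentiable]. *)
pose g m t := p m (Num.truncn (Num.max t 0 / h m)).
have gQ m t : `|g m t| <= M + 2 by have [_ pQ _ _] := lpP m; exact: pQ.
have gK m s t : `|g m t - g m s| <= (M + 1) * (`|t - s| + h m).
  have [_ _ pd _] := lpP m.
  apply: (le_trans (step_curve_modulus (hgt0 m) M1 pd _ _)); rewrite ?le_max ?lexx ?orbT//.
  rewrite ler_wpM2l// lerD2r; case: (leP t 0) => t0; case: (leP s 0) => s0.
  - by rewrite subrr normr0.
  - by rewrite sub0r normrN gtr0_norm// distrC ger0_norm ?subr_ge0; lra.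
  - by rewrite subr0 gtr0_norm// ger0_norm ?subr_ge0; lra.
  - by [].
have h0 : h @ \oo --> 0.
  apply/cvgrPdist_le => e e0; have /cvgrPdist_le/(_ _ e0) [J _ JP] := cvg_expr2V.
  exists J => // m /= Jm; have [ml _ _ _] := lpP m.
  exact: (JP (l m) (leq_trans Jm ml)).
have [gam [gamQ gamK [phi [phij gphi]]]] := equi_lipschitz_limit M1 gQ gK h0.
exists gam; split => //.
have cgam : continuous gam by exact: lipschitz_curve_continuous gamK.
pose G N s t := (expR (- (rho * t)) * L N (gam t) (2 ^+ s *: (gam (t + 2 ^- s) - gam t))).
have key N : exists s, (N <= s)%N /\ (\int[leb]_(t in halfline) (G N s t)%:E <= (c' / rho)%:E)%E.
  (* One third each for the factor [expR (rho * 2 ^- s)], for the displacement of the base point,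
     and for the factor [1 + rho * h]. *)
  pose eta := (c' - c) / 3.
  have eta0 : 0 < eta by rewrite divr_gt0// subr_gt0.
  have etaE : c + eta + eta + eta = c' by rewrite /eta; field.
  clearbody eta.
  have [r r0 rP] := Lmod N (M + 2) eta eta0.
  have [s [Ns sr se]] : exists s, [/\ (N <= s)%N, (M + 1) * 2 ^- s <= r &
      expR (rho * 2 ^- s) * c <= c + eta].
    have ce : expR (rho * 2 ^- s) * c @[s --> \oo] --> c.
      have H : expR (rho * 2 ^- s) * c @[s --> \oo] --> expR 0 * c.
        apply: cvgMl; apply: continuous_cvg; first exact: continuous_expR.
        exact: cvg_mul_expr2V.
      by rewrite expR0 mul1r in H.
    have cr := cvg_mul_expr2V (M + 1).
    have /cvgrPdist_le/(_ _ eta0) := ce; have /cvgrPdist_le/(_ _ r0) := cr.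
    move=> H1 H2; have [s [/= Ns [s1 s2]]] := filter_ex (filterI (nbhs_infty_ge N) (filterI H1 H2)).
    exists s; split => //.
      by apply: le_trans s1; rewrite sub0r normrN ler_norm.
    by rewrite -lerBlDl; apply: le_trans s2; rewrite distrC ler_norm.
  have [J [NJ sJ hJ]] : exists J, [/\ (N <= J)%N, (s <= J)%N &
      rho * 2 ^- J * (c + eta + eta) <= eta].
    have cr : rho * 2 ^- J * (c + eta + eta) @[J --> \oo] --> (0 : R).
      under eq_fun do rewrite mulrAC.
      exact: cvg_mul_expr2V.
    have /cvgrPdist_le/(_ _ eta0) H1 := cr.
    have [J [/= NJ [sJ s1]]] := filter_ex (filterI (nbhs_infty_ge N) (filterI (nbhs_infty_ge s) H1)).
    exists J; split => //; apply: le_trans s1; rewrite sub0r normrN; exact: ler_norm.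
  exists s; split => //.
  (* The index is shifted so that every chain considered has a step at most [2 ^- s] and is cheap
     for a Lagrangian above [L N]. *)
  pose m j := phi (j + J)%N.
  have Jm j : (J <= m j)%N by apply: leq_trans (phij _); rewrite leq_addl.
  pose f j t := expR (- (rho * t)) *
     L N (g (m j) t) (2 ^+ s *: (g (m j) (t + 2 ^- s) - g (m j) t)).
  have f0 j t : 0 <= f j t by rewrite mulr_ge0.
  suff H j : measurable_fun halfline (f j) /\
      (\int[leb]_(t in halfline) (f j t)%:E <= (c' / rho)%:E)%E.
    apply: (@fatou_cvg_le_cst _ _ _ leb halfline _ (fun j t => (f j t)%:E)) => //.
    - by move=> j; apply/measurable_EFinP; case: (H j).
    - by move=> j x _; rewrite lee_fin.
    - by move=> j; case: (H j).
    move=> t; rewrite /= in_itv/= andbT => t0.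
    have gm u : 0 <= u -> g (m j) u @[j --> \oo] --> gam u.
      by move=> u0; have := gphi _ u0; rewrite -(cvg_shiftn J).
    apply: cvg_EFin; first exact: nearW.
    apply: cvgMr; apply: (cvg_compose2 (cL N)); first exact: gm.
    apply: cvgZr; apply: cvgB; apply: gm => //.
    by rewrite addr_ge0// ltW// expr2V_gt0.
  have [ml pQ pd pS] := lpP (m j).
  rewrite -/(l (m j)) -/(p (m j)) in ml pQ pd pS *.
  have sl : (s <= l (m j))%N by rewrite (leq_trans sJ)// (leq_trans (Jm j)).
  (* The time [2 ^- s] consists of exactly [q.+1] steps of the chain. *)
  pose q := (2 ^ (l (m j) - s)).-1.
  have q1 : q.+1 = (2 ^ (l (m j) - s))%N by rewrite prednK// expn_gt0.
  have qh : q.+1%:R * 2 ^- (l (m j)) = 2 ^- s :> R.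
    rewrite q1 natrX -[in RHS](subKn sl).
    rewrite -{2}(subnK sl) exprD invfM mulrA divff ?mul1r ?expf_neq0//.
    by rewrite subKn.
  have LNm x u : 0 <= L N x u <= L (m j) x u.
    by rewrite L0 Lle// (leq_trans NJ).
  have shift k i u : (i <= q)%N -> `|u| <= M + 1 ->
      L N (p (m j) k) u <= L N (p (m j) (k + i)%N) u + eta.
    move=> iq uM; apply: rP; first exact: pQ.
    - by lra.
    - rewrite distrC; apply: (le_trans (chain_dist _ _ pd)).
      apply: le_trans sr; rewrite mulrA mulrC ler_wpM2l// -qh ler_wpM2r ?(ltW (expr2V_gt0 _))//.
      by rewrite ler_nat ltnW.
    - by rewrite subrr normr0 ltW.
  have [mF IF] := chain_quotient_bound (expr2V_gt0 _) rho0 (ltW eta0) pd pS LNm (jL N) shift.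
  have fE t : halfline t -> f j t = expR (- (rho * t)) * L N (p (m j) (Num.truncn (t / 2 ^- l (m j))))
     ((q.+1%:R * 2 ^- l (m j))^-1 *: (p (m j) (Num.truncn (t / 2 ^- l (m j)) + q.+1)%N
        - p (m j) (Num.truncn (t / 2 ^- l (m j))))).
    rewrite /= in_itv/= andbT => t0.
    have e0 := @expr2V_gt0 (l (m j)).
    have tr : Num.truncn ((t + 2 ^- s) / 2 ^- l (m j)) = (Num.truncn (t / 2 ^- l (m j)) + q.+1)%N.
      rewrite -qh mulrDl mulfK ?gt_eqF//.
      apply: truncn_def; rewrite -addSn !natrD lerD2r ltrD2r.
      by apply: truncn_itv; rewrite divr_ge0// ltW.
    rewrite /f /g /h qh !max_l//; last by rewrite addr_ge0// ltW// expr2V_gt0.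
    by rewrite tr (invrK (2 ^+ s)).
  split.
    by apply: (eq_measurable_fun _ _ mF) => t /set_mem /fE.
  under eq_integral => t /set_mem tD do rewrite (fE t tD).
  apply: (le_trans IF); rewrite lee_fin qh mulrAC ler_pM2r ?invr_gt0//.
  have hm : 2 ^- (l (m j)) <= 2 ^- J :> R.
    by rewrite lef_pV2 ?posrE ?exprn_gt0// ler_eXn2l ?ltr1n// (leq_trans (Jm j)).
  apply: (@le_trans _ _ ((1 + rho * 2 ^- J) * (c + eta + eta))).
    rewrite ler_pM ?addr_ge0 ?mulr_ge0 ?(ltW rho0) ?(ltW eta0) ?(ltW c0) ?expR_ge0//.
    - by rewrite lerD2l ler_pM2l.
    - by rewrite lerD2r.
  by rewrite mulrDl mul1r; lra.
have cG N s : continuous (G N s).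
  move=> t; apply: cvgM.
    apply: continuous_comp; last exact: continuous_expR.
    by apply: continuousN; apply: mulrl_continuous.
  apply: (cvg_compose2 (cL N)); first exact: cgam.
  apply: cvgZr; apply: cvgB; last exact: cgam.
  apply: continuous_comp; last exact: cgam.
  by apply: cvgD; [exact: cvg_id|exact: cvg_cst].
have /choice[s sP] := key.
exists s; split => [N|]; first by case: (sP N).
apply: fatou_le_cst => //.
- move=> N; apply/measurable_EFinP; apply: measurable_funTS; apply: continuous_measurable_fun; exact: cG.
- by move=> N t _; rewrite lee_fin mulr_ge0.
- by move=> N; case: (sP N).
Qed.

End discounted_curve.

Lemma nonexpansive_continuous {R : realType} {T : normedModType R} (f : T -> R) :
  (forall x y, `|f x - f y| <= `|x - y|) -> continuous f.
Proof.
move=> f1 x; apply/cvgrPdist_le => e e0; apply/nbhs_ballP; exists e => //= y.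
by rewrite -ball_normE/= => xy; apply: (le_trans (f1 _ _)); exact: ltW.
Qed.

(** * Borel regularity and approximation by continuous functions *)

Section inner_radius.
Context {R : realType} {n : nat}.
Local Notation Rn := 'rV[R]_n.
Implicit Types (U : set Rn) (x y : Rn).

(** The distance to the complement of [U], cut at 1. As a supremum of radii it is meaningful even
    when [U] is the whole space. *)
Definition inner_radius U x : R :=
  sup [set r : R | 0 <= r <= 1 /\ forall y, `|y - x| < r -> U y].

Let S U x := [set r : R | 0 <= r <= 1 /\ forall y, `|y - x| < r -> U y].

Let S0 U x : S U x 0.
Proof. by split=> [|y]; [rewrite lexx ler01|rewrite ltNge normr_ge0]. Qed.

Let hasS U x : has_sup (S U x).
Proof. by split; [exists 0; exact: S0|exists 1 => r [/andP[]]]. Qed.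

Lemma inner_radius_ge0 U x : 0 <= inner_radius U x.
Proof. exact: sup_ubound (hasS U x).2 _ (S0 U x). Qed.

Lemma inner_radius_out U x : ~ U x -> inner_radius U x = 0.
Proof.
move=> Ux; apply/eqP; rewrite eq_le inner_radius_ge0 andbT.
apply: ge_sup; first exact: (hasS U x).1.
move=> r [/andP[r0 _] rU]; rewrite leNgt; apply/negP => rp.
by apply/Ux/rU; rewrite subrr normr0.
Qed.

Lemma inner_radius_gt0 U x : open U -> U x -> 0 < inner_radius U x.
Proof.
rewrite openE => oU /oU /nbhs_ballP[e /= e0 eU].
have m0 : 0 < Num.min e 1 by rewrite lt_min e0 ltr01.
apply: (lt_le_trans m0); apply: sup_ubound; first exact: (hasS U x).2.
split=> [|y yx]; first by rewrite (ltW m0) ge_min lexx orbT.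
apply: eU; rewrite -ball_normE /= distrC; apply: lt_le_trans yx _.
by rewrite ge_min lexx.
Qed.

Lemma inner_radius_lip U x y : `|inner_radius U x - inner_radius U y| <= `|x - y|.
Proof.
have H u w : inner_radius U u <= inner_radius U w + `|u - w|.
  apply: ge_sup; first exact: (hasS U u).1.
  move=> r [/andP[r0 r1] rU]; rewrite -lerBlDr.
  have [ruw|ruw] := leP r `|u - w|.
    by apply: le_trans (inner_radius_ge0 U w); rewrite subr_le0.
  apply: sup_ubound; first exact: (hasS U w).2.
  split; first by rewrite subr_ge0 (ltW ruw)/= (le_trans _ r1)// gerBl.
  move=> z zw; apply: rU; rewrite -(subrKA w); apply: le_lt_trans (ler_normD _ _) _.
  by move: zw; rewrite [`|w - u|]distrC; lra.
rewrite ler_norml; have := H x y; have := H y x; rewrite [`|y - x|]distrC => h1 h2.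
by apply/andP; split; lra.
Qed.

Lemma continuous_inner_radius U : continuous (inner_radius U).
Proof.
exact: nonexpansive_continuous (@inner_radius_lip U).
Qed.

(** For open [U] these continuous functions increase to the indicator of [U], and on [U] they reach
    1 after finitely many [N]. *)
Definition open_bump U (N : nat) x : R := Num.min 1 (N%:R * inner_radius U x).

Lemma open_bump_ge0 U N x : 0 <= open_bump U N x.
Proof. by rewrite le_min ler01 mulr_ge0// inner_radius_ge0. Qed.

Lemma open_bump_le1 U N x : open_bump U N x <= 1.
Proof. by rewrite ge_min lexx. Qed.

Lemma open_bumpS U N x : open_bump U N x <= open_bump U N.+1 x.
Proof.
rewrite le_min open_bump_le1/= ge_min; apply/orP; right.
by rewrite ler_wpM2r ?inner_radius_ge0// ler_nat.
Qed.

Lemma open_bump_out U N x : ~ U x -> open_bump U N x = 0.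
Proof. by move=> Ux; rewrite /open_bump inner_radius_out// mulr0 min_r. Qed.

Lemma open_bump_eq1 U x : open U -> U x -> exists N0, forall N, (N0 <= N)%N -> open_bump U N x = 1.
Proof.
move=> oU Ux; have r0 := inner_radius_gt0 oU Ux.
exists (Num.truncn (inner_radius U x)^-1).+1 => N HN; apply: min_l.
rewrite -ler_pdivrMr// mul1r.
have /truncn_itv/andP[_ /ltW/le_trans] : 0 <= (inner_radius U x)^-1 by rewrite invr_ge0 ltW.
by apply; rewrite ler_nat.
Qed.

Lemma continuous_open_bump U N : continuous (open_bump U N).
Proof.
move=> x; apply: (@continuous_min _ _ (fun=> 1) (fun x => N%:R * inner_radius U x)); first exact: cst_continuous.
have H := @continuous_inner_radius U x; by apply: continuousM H; exact: cst_continuous.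
Qed.

End inner_radius.

Section Borel_regularity.
Context {R : realType} {n : nat}.
Local Notation Rn := 'rV[R]_n.
Variable nu : probability Rn R.

Lemma open_measurable_rV (U : set Rn) : open U -> measurable U.
Proof. exact: sub_sigma_algebra. Qed.

Lemma closed_measurable_rV (F : set Rn) : closed F -> measurable F.
Proof.
move=> cF; rewrite -(setCK F); apply: measurableC; apply: open_measurable_rV.
exact: closed_openC.
Qed.

Lemma continuous_measurable_rV (f : Rn -> R) : continuous f -> measurable_fun setT f.
Proof.
move=> cf; apply: (measurability _ (RGenOpens.measurableE R)).
move=> _ [_ [a [b ->]] <-]; rewrite setTI; apply: open_measurable_rV.
by apply: open_comp => [x _|]; [exact: cf|exact: itv_open].
Qed.

Lemma decreasing_measure_small (A : (set Rn)^nat) (e : R) : (forall k, measurable (A k)) ->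
  (forall k, A k.+1 `<=` A k) -> 0 < e ->
  exists k, (nu (A k) <= nu (\bigcap_i A i) + e%:E)%E.
Proof.
move=> mA dA e0.
have nA : nonincreasing_seq A by apply/nonincreasing_seqP => k; apply/subsetPset; exact: dA.
have A0 : (nu (A 0%N) < +oo)%E by rewrite (le_lt_trans (probability_le1 nu (mA 0%N)))// ltry.
have cv := nonincreasing_cvg_mu A0 mA (bigcapT_measurable mA) nA.
apply: contrapT => /forallNP H.
have fB : (nu (\bigcap_i A i) \is a fin_num)%E by apply: fin_num_measure; exact: bigcapT_measurable.
have : (nu (\bigcap_i A i) + e%:E <= nu (\bigcap_i A i))%E.
  rewrite -[X in (_ <= X)%E](cvg_lim _ cv)//; apply: lime_ge; first by apply/cvg_ex; eexists; exact: cv.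
  by apply: nearW => k; have /negP := H k; rewrite -ltNge => /ltW.
by rewrite -{2}[nu _]adde0 leeD2lE// lee_fin leNgt e0.
Qed.

Definition regular_set (E : set Rn) := measurable E /\ forall e : R, 0 < e ->
  exists F U : set Rn, [/\ closed F, open U, F `<=` E, E `<=` U & (nu (U `\` F) <= e%:E)%E].

Lemma regular_open U : open U -> regular_set U.
Proof.
move=> oU; split; first exact: open_measurable_rV.
move=> e e0; pose F k := [set x | k.+1%:R^-1 <= inner_radius U x].
have cF k : closed (F k).
  apply: (@closed_comp _ _ (inner_radius U) [set r | k.+1%:R^-1 <= r]).
    by move=> x _; exact: continuous_inner_radius.
  exact: closed_ge.
have mF k : measurable (U `\` F k).
  by apply: measurableD; [exact: open_measurable_rV|apply: closed_measurable_rV; exact: cF].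
have [k|k kP] := @decreasing_measure_small (fun k => U `\` F k) e mF _ e0.
  apply: setDS => x /= /(le_trans _); apply.
  by rewrite lef_pV2 ?posrE// ler_nat.
exists (F k), U; split => //.
  move=> x /= kx; apply: contrapT => Ux.
  by move: kx; rewrite /F/= inner_radius_out// leNgt invr_gt0 ltr0n.
apply: (le_trans kP); rewrite [X in nu X](_ : _ = set0) ?measure0 ?add0e//.
apply/seteqP; split => // x /= Fx.
have [Ux _] := Fx 0%N I.
have r0 := inner_radius_gt0 oU Ux.
have [_] := Fx (Num.truncn (inner_radius U x)^-1) I; apply => /=.
have /truncn_itv/andP[_ /ltW] : 0 <= (inner_radius U x)^-1 by rewrite invr_ge0 ltW.
by rewrite -[X in _ -> _ <= X]invrK lef_pV2 ?posrE ?invr_gt0.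
Qed.

Lemma Borel_regular E : measurable E -> regular_set E.
Proof.
apply: smallest_sub; last by move=> U; exact: regular_open.
split.
- by apply: regular_open; exact: open0.
- move=> A [mA rA]; rewrite setTD; split; first exact: measurableC.
  move=> e /rA[F [U [cF oU FA AU le]]].
  exists (~` U), (~` F); split; [exact: open_closedC|exact: closed_openC|exact: subsetC|exact: subsetC|].
  by rewrite setDE setCK setIC -setDE.
- move=> A rA; have mA k : measurable (A k) by case: (rA k).
  split; first exact: bigcupT_measurable.
  move=> e e0.
  have /choice[FU FUP] : forall k, exists FU : set Rn * set Rn, [/\ closed FU.1, open FU.2,
      FU.1 `<=` A k, A k `<=` FU.2 & (nu (FU.2 `\` FU.1) <= (e / 2 / (2 ^ k.+1)%:R)%:E)%E].
    move=> k; have [_ /(_ (e / 2 / (2 ^ k.+1)%:R))[|F [U HFU]]] := rA k.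
      by rewrite !divr_gt0// ltr0n expn_gt0.
    by exists (F, U).
  pose F k := (FU k).1; pose U k := (FU k).2.
  have mU : measurable (\bigcup_k U k).
    by apply: bigcupT_measurable => k; apply: open_measurable_rV; case: (FUP k).
  have mF k : measurable (F k) by apply: closed_measurable_rV; case: (FUP k).
  have cF k : closed (\bigcup_(i in `I_k) F i).
    by apply: closed_bigcup => // i _; case: (FUP i).
  (* The union of all [F k] need not be closed, so it is cut to a finite one by continuity from
     above. This uses half of [e]; the other half is spread over the sets [U k] minus [F k]. *)
  have [|k||k kP] := @decreasing_measure_small
    (fun k => (\bigcup_i U i) `\` \bigcup_(i in `I_k) F i) (e / 2).
  - by move=> k; apply: measurableD => //; exact: closed_measurable_rV.
  - by apply: setDS; apply: bigcup_subset => i /= /leq_trans; apply.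
  - by rewrite divr_gt0.
  exists (\bigcup_(i in `I_k) F i), (\bigcup_i U i); split => //.
  - by apply: bigcup_open => i _; case: (FUP i).
  - move=> x [i _ Fx]; exists i => //; by case: (FUP i) => _ _ + _ _; apply.
  - move=> x [i _ Fx]; exists i => //; by case: (FUP i) => _ _ _ + _; apply.
  apply: (le_trans kP).
  apply: (@le_trans _ _ ((e / 2)%:E + (e / 2)%:E)%E); last by rewrite -EFinD -splitr.
  rewrite leeD2r//.
  apply: (@le_trans _ _ (nu (\bigcup_i (U i `\` F i)))).
    apply: le_measure; rewrite ?inE.
    - apply: bigcapT_measurable => i; apply: measurableD => //; exact: closed_measurable_rV.
    - by apply: bigcupT_measurable => i; apply: measurableD => //; apply: open_measurable_rV; case: (FUP i).
    move=> x Hx; have [[i _ Ux] _] := Hx 0%N I; exists i => //; split => // Fx.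
    by have [_] := Hx i.+1 I; apply; exists i => /=.
  apply: le_trans (epsilon_trick0 _ _); last by rewrite divr_ge0// ltW.
  apply: (le_trans (generalized_Boole_inequality _ _ _)).
  - by move=> i; apply: measurableD => //; apply: open_measurable_rV; case: (FUP i).
  - by apply: bigcupT_measurable => i; apply: measurableD => //; apply: open_measurable_rV; case: (FUP i).
  by apply: lee_nneseries => // i _; case: (FUP i).
Qed.

End Borel_regularity.

Section L1_density.
Context {R : realType} {n : nat}.
Local Notation Rn := 'rV[R]_n.
Variable nu : probability Rn R.
Implicit Types (U E D : set Rn) (f w : Rn -> R).

Lemma open_bump_defect U (e : R) : open U -> 0 < e -> exists N,
  measurable [set x | open_bump U N x = 1] /\
  (nu (U `\` [set x | open_bump U N x = 1%R]) <= e%:E)%E.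
Proof.
move=> oU e0.
have mN N : measurable [set x | open_bump U N x = 1].
  rewrite (_ : mkset _ = open_bump U N @^-1` [set 1]); last by apply/seteqP; split.
  rewrite -[X in measurable X]setTI.
  by apply: continuous_measurable_rV => //; exact: continuous_open_bump.
have mU := open_measurable_rV oU.
have [N|N|N NP] := @decreasing_measure_small R n nu (fun N => U `\` [set x | open_bump U N x = 1]) e _ _ e0.
- exact: measurableD.
- apply: setDS => x /= x1; apply/eqP; rewrite eq_le open_bump_le1/= -x1.
  exact: open_bumpS.
exists N; split => //; apply: (le_trans NP).
rewrite [X in nu X](_ : _ = set0) ?measure0 ?add0e//.
apply/seteqP; split => // x /= Hx; have [Ux _] := Hx 0%N I.
have [N0 N0P] := open_bump_eq1 oU Ux.
by have [_] := Hx N0 I; apply; exact: N0P.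
Qed.

Lemma indic_continuous_approx E (e : R) : measurable E -> 0 < e ->
  exists u : Rn -> R, continuous u /\ (\int[nu]_x (`|\1_E x - u x|)%:E <= e%:E)%E.
Proof.
move=> mE e0; have e20 : 0 < e / 2 by rewrite divr_gt0.
have [_ /(_ _ e20)[F [U [cF oU FE EU UF]]]] := Borel_regular nu mE.
have [N [mG NG]] := open_bump_defect oU e20.
set G := [set x | _] in mG NG.
have mU := open_measurable_rV oU.
exists (open_bump U N); split; first exact: continuous_open_bump.
have mUE : measurable (U `\` E) by exact: measurableD.
have mUG : measurable (U `\` G) by exact: measurableD.
have mi : measurable_fun setT (fun x => `|\1_E x - open_bump U N x|).
  apply: measurableT_comp => //; apply: measurable_funB; first exact: measurable_indic.
  by apply: continuous_measurable_rV; exact: continuous_open_bump.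
apply: (@le_trans _ _ (\int[nu]_x ((\1_(U `\` E) x)%:E + (\1_(U `\` G) x)%:E))%E).
  apply: ge0_le_integral => //.
  - exact/measurable_EFinP.
  - by apply: emeasurable_funD; apply/measurable_EFinP; exact: measurable_indic.
  move=> x _; rewrite -EFinD lee_fin.
  have b0 := open_bump_ge0 U N x; have b1 := open_bump_le1 U N x.
  have [Ux|Ux] := pselect (U x); last first.
    have nE : ~ E x by move=> h; apply: Ux; exact: EU.
    rewrite open_bump_out// !indicE !memNset//; [|by case|by case].
    by rewrite subr0 normr0 addr0.
  rewrite !indicE !in_setD (mem_set Ux)/=.
  have [xE|xE] := boolP (x \in E); have [xG|xG] := boolP (x \in G); rewrite /=.
  - by move/set_mem : xG; rewrite /G/= => ->; rewrite subrr normr0 addr0.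
  - by rewrite ger0_norm ?subr_ge0//; lra.
  - by rewrite sub0r normrN ger0_norm; lra.
  - by rewrite sub0r normrN ger0_norm; lra.
rewrite ge0_integralD//; try (apply/measurable_EFinP; exact: measurable_indic).
rewrite !integral_indic// !setIT.
apply: (@le_trans _ _ ((e / 2)%:E + (e / 2)%:E)%E); last by rewrite -EFinD -splitr.
apply: leeD => //; apply: le_trans UF; apply: le_measure; rewrite ?inE//.
  by apply: measurableD => //; exact: closed_measurable_rV.
exact: setDS.
Qed.

(** Binary digits: [f] is half the sum of the indicator of [E], its first digit, and a remainder
    [f'] with values in [[0, 1]]. Each digit halves the truncation error, while the error [e] is
    reproduced as [(e + e) / 2]. *)
Lemma unit_continuous_approx p f (e : R) : measurable_fun setT f ->
  (forall x, 0 <= f x <= 1) -> 0 < e ->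
  exists w, continuous w /\ (\int[nu]_x (`|f x - w x|)%:E <= (2 ^- p + e)%:E)%E.
Proof.
elim: p f e => [|p IH] f e mf f01 e0.
  exists (fun=> 0); split; first exact: cst_continuous.
  apply: (@le_trans _ _ (\int[nu]_x (cst 1%:E x))%E).
    apply: ge0_le_integral => //.
    - by apply/measurable_EFinP; apply: measurableT_comp => //; exact: measurable_funB.
    - move=> x _; have /andP[f0 f1] := f01 x.
      by rewrite lee_fin subr0 ger0_norm.
  rewrite integral_cst// mul1e; apply: (@le_trans _ _ 1%E); first exact: probability_le1.
  by rewrite lee_fin expr0 invr1 lerDl ltW.
pose E := [set x | 2^-1 <= f x].
have mE : measurable E.
  rewrite (_ : E = f @^-1` `[2^-1, +oo[%classic).
    by rewrite -[X in measurable X]setTI; apply: mf.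
  by apply/seteqP; split => x; rewrite /E/= in_itv/= andbT.
pose f' x := 2 * f x - \1_E x.
have mf' : measurable_fun setT f'.
  by apply: measurable_funB; [apply: measurable_funM => //|exact: measurable_indic].
have f'01 x : 0 <= f' x <= 1.
  have /andP[f0 f1] := f01 x; rewrite /f' indicE.
  have [/set_mem|/negP xE] := boolP (x \in E); first by rewrite /E/= => h; apply/andP; split; lra.
  have : f x < 2^-1 by rewrite ltNge; apply/negP => h; apply: xE; exact: mem_set.
  by move=> h; rewrite subr0; apply/andP; split; lra.
have [w' [cw' Iw']] := IH f' e mf' f'01 e0.
have [u [cu Iu]] := indic_continuous_approx mE e0.
exists (fun x => 2^-1 * (w' x + u x)); split.
  exact: (@Ck_mul _ _ 0 _ _ (Ck_cst 0 _) (@Ck_add _ _ 0 _ _ cw' cu)).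
have mw' := continuous_measurable_rV cw'; have mu' := continuous_measurable_rV cu.
have m1 : measurable_fun setT (fun x => (`|f' x - w' x|)%:E).
  by apply/measurable_EFinP; apply: measurableT_comp => //; exact: measurable_funB.
have m2 : measurable_fun setT (fun x => (`|\1_E x - u x|)%:E).
  apply/measurable_EFinP; apply: measurableT_comp => //; apply: measurable_funB => //.
apply: (@le_trans _ _ (\int[nu]_x ((2^-1)%:E * ((`|f' x - w' x|)%:E + (`|\1_E x - u x|)%:E)))%E).
  apply: ge0_le_integral => //.
  - apply/measurable_EFinP; apply: measurableT_comp => //; apply: measurable_funB => //.
    by apply: measurable_funM => //; exact: measurable_funD.
  - by apply: emeasurable_funM => //; exact: emeasurable_funD.
  move=> x _; rewrite -EFinD -EFinM lee_fin.
  rewrite (_ : f x - _ = 2^-1 * ((f' x - w' x) + (\1_E x - u x))); last by rewrite /f'; field.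
  by rewrite normrM gtr0_norm ?invr_gt0// ler_pM2l ?invr_gt0// ler_normD.
rewrite ge0_integralZl//; last 2 first.
- exact: emeasurable_funD.
- by move=> x _; rewrite -EFinD lee_fin addr_ge0.
rewrite ge0_integralD//; try by move=> x _; rewrite lee_fin.
apply: (@le_trans _ _ ((2^-1)%:E * ((2 ^- p + e)%:E + e%:E))%E).
  by apply: lee_wpmul2l; [rewrite lee_fin invr_ge0|exact: leeD].
rewrite -EFinD -EFinM lee_fin exprS invfM.
by rewrite !mulrDr; lra.
Qed.

Lemma L1_continuous_approx D f (M e : R) : measurable D -> measurable_fun setT f ->
  (forall x, D x -> `|f x| <= M) -> 0 < e ->
  exists w, continuous w /\ (\int[nu]_(x in D) (`|f x - w x|)%:E <= e%:E)%E.
Proof.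
move=> mD mf fM e0; pose M' := `|M| + 1.
have M'0 : 0 < M' by rewrite ltr_wpDl.
(* The bound on [f] holds on [D] only; clamping gives a function with values in [[0, 1]] everywhere
   without changing the rescaled [f] on [D]. *)
pose g x := Num.min 1 (Num.max 0 ((f x + M') / (2 * M'))).
have M20 : 0 < 2 * M' by rewrite mulr_gt0.
have mg : measurable_fun setT g.
  apply: measurable_minr => //; apply: measurable_maxr => //.
  by apply: measurable_funM => //; exact: measurable_funD.
have g01 x : 0 <= g x <= 1 by rewrite /g le_min ler01 le_max lexx/= ge_min lexx.
have gD x : D x -> f x = 2 * M' * g x - M'.
  move=> /fM fx; have h : `|f x| <= M' by apply: (le_trans fx); rewrite (le_trans (ler_norm M))// lerDl.
  move: h; rewrite ler_norml => /andP[f1 f2].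
  have a0 : 0 <= (f x + M') / (2 * M') by rewrite divr_ge0 ?(ltW M20)//; lra.
  have a1 : (f x + M') / (2 * M') <= 1 by rewrite ler_pdivrMr//; lra.
  by rewrite /g max_r// min_r//; field; rewrite gt_eqF.
have d0 : 0 < e / (2 * M') / 2 by rewrite !divr_gt0.
have [p pd] : exists p, 2 ^- p <= e / (2 * M') / 2.
  have /cvgrPdist_le/(_ _ d0)/filter_ex[p] := @cvg_expr2V R.
  by rewrite sub0r normrN => /(le_trans (ler_norm _)); exists p.
have [w [cw Iw]] := unit_continuous_approx p mg g01 d0.
exists (fun x => 2 * M' * w x - M'); split.
  exact: (@Ck_add _ _ 0 _ _ (@Ck_mul _ _ 0 _ _ (Ck_cst 0 _) cw) (Ck_cst 0 _)).
have mw := continuous_measurable_rV cw.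
have m1 : measurable_fun setT (fun x => (`|g x - w x|)%:E).
  by apply/measurable_EFinP; apply: measurableT_comp => //; exact: measurable_funB.
apply: (@le_trans _ _ (\int[nu]_(x in D) ((2 * M')%:E * (`|g x - w x|)%:E))%E).
  rewrite le_eqVlt; apply/orP; left; apply/eqP; apply: eq_integral => x /set_mem Dx.
  rewrite (gD x Dx) -EFinM -[in RHS](gtr0_norm M20) -normrM; congr (`| _ |%:E); ring.
rewrite ge0_integralZl//; last 2 first.
- exact: measurable_funTS.
- by rewrite lee_fin ltW.
apply: (@le_trans _ _ ((2 * M')%:E * (2 ^- p + e / (2 * M') / 2)%:E)%E).
  apply: lee_wpmul2l; first by rewrite lee_fin ltW.
  by apply: le_trans Iw; apply: ge0_subset_integral.
rewrite -EFinM lee_fin -ler_pdivlMl// [leRHS]mulrC.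
by rewrite [leRHS]splitr lerD2r.
Qed.

End L1_density.

Lemma cvg_finite_sum {R : realType} {T : Type} (F : set_system T) {FF : Filter F}
    (I : Type) (s : seq I) (f : I -> T -> R) (l : I -> R) :
  (forall i, f i @ F --> l i) -> \sum_(i <- s) f i t @[t --> F] --> \sum_(i <- s) l i.
Proof.
move=> fl; elim: s => [|i s IH].
  rewrite big_nil; under eq_fun do rewrite big_nil.
  exact: cvg_cst.
rewrite big_cons; under eq_fun do rewrite big_cons.
exact: cvgD.
Qed.

Lemma cvg_to_pair {T : Type} {X Y : topologicalType} (F : set_system T) {FF : Filter F}
    (f : T -> X) (g : T -> Y) (x : X) (y : Y) :
  f @ F --> x -> g @ F --> y -> (f t, g t) @[t --> F] --> (x, y).
Proof.
move=> fx gy A [[B C] /= [Bx Cy] BCA].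
have FB : F (f @^-1` B) := fx _ Bx.
have FC : F (g @^-1` C) := gy _ Cy.
rewrite /nbhs/= /fmap/=; apply: filterS (filterI FB FC) => t [Bt Ct].
exact: (BCA (f t, g t)).
Qed.

(** * Steep points of a Lyapunov function *)

Section clarke.
Context {R : realType} {n : nat}.
Local Notation Rn := 'rV[R]_n.
Variable V : Rn -> R.
Implicit Types (x u w : Rn) (delta : R).

Lemma dotrvC u w : dotrv u w = dotrv w u.
Proof. by apply: eq_bigr => i _; rewrite mulrC. Qed.

Lemma continuous_dotrv : continuous (fun z : Rn * Rn => dotrv z.1 z.2).
Proof.
move=> z; apply: cvg_finite_sum => i.
have c1 : (fun z : Rn * Rn => z.1 ord0 i) @ z --> z.1 ord0 i.
  by apply: (@cvg_comp _ _ _ _ (fun x : Rn => x ord0 i)); [exact: cvg_fst|exact: coord_continuous].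
have c2 : (fun z : Rn * Rn => z.2 ord0 i) @ z --> z.2 ord0 i.
  by apply: (@cvg_comp _ _ _ _ (fun x : Rn => x ord0 i)); [exact: cvg_snd|exact: coord_continuous].
exact: (cvgM c1 c2).
Qed.

Definition steep_set delta : set (Rn * Rn) :=
  [set z | differentiable V z.1 /\ delta <= `|dotrv (grad_at V z.1) z.2|].

Lemma clarke_limits_sub x : clarke_limits V x `<=` clarke_subdiff V x.
Proof.
move=> w Vw; apply: subset_closure; exists 1%N, (fun=> 1), (fun=> w); split => //.
  by rewrite big_ord1.
by rewrite big_ord1 scale1r.
Qed.

(** Orthogonality to [u] is a closed linear condition, so if it held for all limits of gradients it
    would hold on their closed convex hull. Hence it fails for one limit [w], and half of the
    absolute value of [dotrv u w] serves as [delta]. *)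
Lemma steep_closure_of_not_perp x u : ~ perp_set (clarke_subdiff V x) u ->
  exists2 delta, 0 < delta & closure (steep_set delta) (x, u).
Proof.
move=> nperp; apply: contrapT => nsteep; apply: nperp.
have lim0 w : clarke_limits V x w -> dotrv u w = 0.
  move=> [y [dy yx gw]]; apply/eqP/negPn/negP => uw0; apply: nsteep.
  have d0 : 0 < `|dotrv u w| / 2 by rewrite divr_gt0 ?normr_gt0.
  exists (`|dotrv u w| / 2) => // B; rewrite nbhsE; case=> [W [oW Wxu] WB].
  have cyu : (y k, u) @[k --> \oo] --> (x, u) by apply: cvg_to_pair => //; exact: cvg_cst.
  have cd : `|dotrv (grad_at V (y k)) u| @[k --> \oo] --> `|dotrv w u|.
    by apply: cvg_norm; apply: (cvg_compose2 continuous_dotrv gw); exact: cvg_cst.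
  have dlt : `|dotrv u w| / 2 < `|dotrv w u| by rewrite [dotrv w u]dotrvC; lra.
  have H1 : \forall k \near \oo, W (y k, u) := cyu _ (open_nbhs_nbhs (conj oW Wxu)).
  have H2 : \forall k \near \oo, `|dotrv u w| / 2 <= `|dotrv (grad_at V (y k)) u|.
    apply: (cvgr_ge _ cd _ dlt).
  have [k [/= Wk dk]] := filter_ex (filterI H1 H2).
  by exists (y k, u); split; [split; [exact: dy|exact: dk]|exact: WB].
move=> a.
have hull0 z : conv_hull (clarke_limits V x) z -> dotrv u z = 0.
  move=> [k [l [b [l0 l1 bV ->]]]]; rewrite dotrv_sumr big1// => i _.
  by rewrite dotrvZr lim0 ?mulr0.
have cl : closed [set z | dotrv u z = 0].
  apply: (@closed_comp _ _ (fun z => dotrv u z) [set 0]); last exact: closed_eq.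
  move=> z _; apply: (continuous_compose2 continuous_dotrv); [exact: cst_continuous|by move=> ?; exact: cvg_id].
by move=> /(closureS hull0); rewrite -((closure_id _).1 cl).
Qed.

Lemma grad_at_bounded x : locally_lipschitz V ->
  exists r K : R, [/\ 0 < r, 0 <= K & forall y, ball x r y -> differentiable V y -> `|grad_at V y| <= K].
Proof.
move=> /(_ x)[r [L [r0 VL]]]; exists r, `|L|; split => // y xy dy.
apply: normr_rV_le => // i; rewrite mxE -deriveE//.
set e : Rn := delta_mx ord0 i.
have dd : derivable V y e by exact: diff_derivable.
have e1 : `|e| <= 1.
  by apply: normr_rV_le => // j; rewrite mxE eqxx/=; case: (j == i); rewrite ?normr1 ?normr0.
have xyr : 0 < r - `|x - y|.
  by move: xy; rewrite -ball_normE/= subr_gt0.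
have cv : `|h^-1 *: (V (h *: e + y) - V y)| @[h --> 0^'] --> `|'D_e V y| by exact: cvg_norm.
apply: (cvgr_to_le cv); near=> h.
have h0 : h != 0 by near: h; exact: nbhs_dnbhs_neq.
rewrite normrZ normfV ler_pdivrMl ?normr_gt0//.
have hr : `|h| < r - `|x - y| by near: h; exact: dnbhs0_lt.
have yh : ball x r (h *: e + y).
  rewrite -ball_normE/= opprD addrCA; apply: le_lt_trans (ler_normD _ _) _.
  rewrite normrN normrZ; apply: (@le_lt_trans _ _ (`|h| * 1 + `|x - y|)).
    by rewrite lerD2r ler_wpM2l.
  by lra.
apply: (le_trans (VL _ _ yh xy)); rewrite addrK normrZ.
apply: (@le_trans _ _ (`|L| * (`|h| * `|e|))); first by rewrite ler_wpM2r ?mulr_ge0// ler_norm.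
by rewrite mulrCA ler_wpM2l// ler_piMr.
Unshelve. all: by end_near. Qed.

(** Steep pairs tending to [(x, u)] have bounded gradients, because [V] is Lipschitz on the ball of
    radius [r]. A cluster point of these gradients is a limit of gradients at [x] and inherits the
    bound [delta]. *)
Lemma steep_closure_witness x u delta : locally_lipschitz V ->
  closure (steep_set delta) (x, u) ->
  exists2 w, clarke_subdiff V x w & delta <= `|dotrv w u|.
Proof.
move=> /(grad_at_bounded x)[r [K [r0 K0 gK]]] clxu.
have /choice[z zP] : forall m : nat, exists z : Rn * Rn, [/\ steep_set delta z,
    ball x (Num.min r m.+1%:R^-1) z.1 & ball u m.+1%:R^-1 z.2].
  move=> m; have m0 : 0 < m.+1%:R^-1 :> R by rewrite invr_gt0.
  have rm0 : 0 < Num.min r m.+1%:R^-1 by rewrite lt_min r0.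
  have [|z [zS [/= z1 z2]]] := clxu (ball x (Num.min r m.+1%:R^-1) `*` ball u m.+1%:R^-1).
    by exists (ball x (Num.min r m.+1%:R^-1), ball u m.+1%:R^-1) => //=; split; exact: nbhsx_ballx.
  by exists z.
pose g m := grad_at V (z m).1.
have gB m : `|g m| <= K.
  have [[dz _] zb _] := zP m; apply: gK => //; apply: le_ball zb.
  by rewrite ge_min lexx.
have [w [wK wcl]] := @compact_closed_normr_le R n K (g @ \oo) _ (@filterE _ \oo _ (g @^-1` [set x : Rn | `|x| <= K]) gB).
have /choice[m mP] : forall k : nat, exists m, (k <= m)%N /\ ball w k.+1%:R^-1 (g m).
  move=> k; have k0 : 0 < k.+1%:R^-1 :> R by rewrite invr_gt0.
  have [|_ [[m km <-] wm]] := wcl (g @` [set m | (k <= m)%N]) (ball w k.+1%:R^-1) _ (nbhsx_ballx _ _ k0).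
    by exists k => // m km; exists m.
  by exists m.
have cvgk (T : normedModType R) (p : nat -> T) q : (forall k, ball q k.+1%:R^-1 (p k)) -> p @ \oo --> q.
  move=> pq; apply/cvgrPdist_lt => e e0.
  have /cvgrPdist_lt/(_ _ e0) := @cvg_harmonic R.
  apply: filterS => k; rewrite sub0r normrN /harmonic/= => ke.
  have := pq k; rewrite -ball_normE/= => /lt_le_trans; apply.
  by apply: le_trans (ltW ke); rewrite ler_norm.
have inv_le k : (m k).+1%:R^-1 <= k.+1%:R^-1 :> R.
  by rewrite lef_pV2 ?posrE// ler_nat ltnS; case: (mP k).
have gw : g (m k) @[k --> \oo] --> w by apply: cvgk => k; case: (mP k).
have zx : (z (m k)).1 @[k --> \oo] --> x.
  apply: cvgk => k; have [_ zb _] := zP (m k); apply: le_ball zb.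
  by rewrite ge_min inv_le orbT.
have zu : (z (m k)).2 @[k --> \oo] --> u.
  by apply: cvgk => k; have [_ _ zb] := zP (m k); exact: le_ball zb.
exists w.
  apply: clarke_limits_sub; exists (fun k => (z (m k)).1); split => // k.
  by have [[]] := zP (m k).
have cd : `|dotrv (g (m k)) (z (m k)).2| @[k --> \oo] --> `|dotrv w u|.
  by apply: cvg_norm; exact: (cvg_compose2 continuous_dotrv gw zu).
by apply: (cvgr_to_ge cd); apply: nearW => k; have [[]] := zP (m k).
Qed.

End clarke.

(** * Discounted integrals on the half-line *)

Section real_line.
Context {R : realType}.
Local Notation leb := (@lebesgue_measure R).
Local Notation halfline := (`[0, +oo[%classic : set R).

Lemma lebesgue_measure_shift (s : R) (A : set R) : measurable A ->
  leb ((fun t => s + t) @^-1` A) = leb A.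
Proof.
have ms : measurable_fun setT ((fun t => s + t) : measurableTypeR R -> measurableTypeR R).
  by apply: measurable_funD.
move=> mA; apply/esym.
apply: (lebesgue_measure_unique (mu := pushforward leb ((fun t => s + t) : measurableTypeR R -> measurableTypeR R))) => //.
move=> _ [[a b]] _ <-; rewrite /pushforward; transitivity (leb `]a - s, b - s]%classic).
  by rewrite !lebesgue_measure_itv/= !lte_fin ltrD2r -!EFinD opprB addrA subrK.
congr (leb _); apply/seteqP; split => t /=; by rewrite !in_itv/= ltrBlDl lerBrDl.
Qed.

Lemma ae_shift (P : R -> Prop) (s : R) : {ae leb, forall t, P t} -> {ae leb, forall t, P (s + t)}.
Proof.
move=> [A [mA A0 PA]]; exists ((fun t => s + t) @^-1` A); split.
- by rewrite -[X in measurable X]setTI; apply: measurable_funD.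
- by rewrite lebesgue_measure_shift.
- by move=> t /= Pt; apply: PA.
Qed.

(** Read off from the total mass 1 of the exponential law. *)
Lemma integral_expRN_halfline (rho : R) : 0 < rho ->
  ((rho^-1)%:E <= \int[leb]_(t in halfline) (expR (- (rho * t)))%:E)%E.
Proof.
move=> rho0.
have ce : continuous (fun t : R => expR (- (rho * t))).
  move=> t; apply: continuous_comp; last exact: continuous_expR.
  by apply: continuousN; apply: mulrl_continuous.
have H := integral_exponential_pdf rho0.
have me : measurable_fun halfline (fun t => (expR (- (rho * t)))%:E).
  by apply/measurable_EFinP; apply: measurable_funTS; exact: continuous_measurable_fun.
rewrite -(setUv halfline) ge0_integral_setU//= in H; first last.
- exact/disj_setPCl.
- by move=> x _; rewrite lee_fin exponential_pdf_ge0// ltW.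
- by rewrite setUv; apply/measurable_EFinP; exact: measurable_exponential_pdf.
- exact: measurableC.
rewrite [X in (_ + X)%E]integral0_eq ?adde0 in H; last first.
  by move=> x x0; rewrite /exponential_pdf patchE ifF// memNset.
rewrite -(@lee_pmul2l _ rho%:E) ?lte_fin// -EFinM divff ?gt_eqF// -H.
rewrite -ge0_integralZl//; last by rewrite lee_fin ltW.
rewrite le_eqVlt; apply/orP; left; apply/eqP; apply: eq_integral => x /set_mem x0.
by rewrite -EFinM exponential_pdfE/= ?mulNr//; move: x0; rewrite /= in_itv/= andbT.
Qed.

Lemma limn_einf_ge (u a : nat -> \bar R) (l : \bar R) (N0 : nat) :
  (forall N, (N0 <= N)%N -> (a N <= u N)%E) -> a @ \oo --> l -> (l <= limn_einf u)%E.
Proof.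
move=> au al; have [<- _] := cvg_limn_einf_sup al; rewrite !limn_einf_lim.
apply: lee_lim; [exact: is_cvg_einfs|exact: is_cvg_einfs|].
exists N0 => // N /= N0N; apply: le_ereal_inf_tmp => _ [k /= Nk <-].
apply: le_trans (au k _); last exact: leq_trans Nk.
by apply: ereal_inf_lbound; exists k.
Qed.

(** No fundamental theorem of calculus is involved: for each mesh the decrements telescope to four
    values of [F], whence [4 * Q], the discount is bounded by 1, and Fatou removes the mesh. *)
Lemma monotone_decrease_le (F : R -> R) (rho Q : R) : 0 < rho -> continuous F ->
  (forall t, 0 <= t -> `|F t| <= Q) ->
  (forall s t, 0 <= s -> s <= t -> F t <= F s) ->
  (\int[leb]_(t in halfline) limn_einf (fun j =>
     (expR (- (rho * t)) * (2 ^+ j * (F t - F (t + 2 ^- j))))%:E) <= (4 * Q)%:E)%E.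
Proof.
move=> rho0 cF FQ Fdec.
have ce : continuous (fun t : R => expR (- (rho * t))).
  move=> t; apply: continuous_comp; last exact: continuous_expR.
  by apply: continuousN; apply: mulrl_continuous.
have e0 j : 0 < 2 ^- j :> R by exact: expr2V_gt0.
have mf j : measurable_fun halfline (fun t => expR (- (rho * t)) * (2 ^+ j * (F t - F (t + 2 ^- j)))).
  apply: measurable_funTS; apply: measurable_funM; first exact: continuous_measurable_fun.
  apply: measurable_funM => //; apply: measurable_funB; first exact: continuous_measurable_fun.
  apply: continuous_measurable_fun => t; apply: continuous_comp; last exact: cF.
  by apply: continuousD; [exact: cvg_id|exact: cst_continuous].
apply: fatou_le_cst => //.
- by move=> j; apply/measurable_EFinP; exact: mf.
- move=> j t; rewrite /= in_itv/= andbT => t0; rewrite lee_fin mulr_ge0 ?expR_ge0// mulr_ge0 ?exprn_ge0//.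
  by rewrite subr_ge0 Fdec// lerDl ltW.
move=> j; pose h : R := 2 ^- j.
(* Two steps instead of one, since [t] and [t + h] lie in adjacent intervals whose union ends at
   [k.+2%:R * h]. *)
pose a k := 2 ^+ j * (F (k%:R * h) - F (k.+2%:R * h)).
have a0 k : 0 <= a k.
  rewrite mulr_ge0 ?exprn_ge0// subr_ge0 Fdec ?mulr_ge0 ?(ltW (e0 _))//.
  by rewrite ler_wpM2r ?(ltW (e0 _))// ler_nat -addn2 leq_addr.
have Q0 : 0 <= Q by apply: le_trans (FQ 0 _).
have aS K : \sum_(k < K) expR (- (rho * h)) ^+ k * a k <= 2 ^+ j * (4 * Q).
  apply: (@le_trans _ _ (\sum_(k < K) a k)).
    apply: ler_sum => k _; rewrite ler_piMl//.
    by rewrite exprn_ile1 ?expR_ge0// expR_le1 oppr_le0 mulr_ge0 ?ltW// /h.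
  rewrite -mulr_sumr ler_pM2l ?exprn_gt0//.
  have Fb i : - Q <= F (i%:R * h) <= Q by rewrite -ler_norml FQ// mulr_ge0 ?(ltW (e0 j))//.
  have -> : \sum_(k < K) (F (k%:R * h) - F (k.+2%:R * h)) =
      F (0%:R * h) + F (1%:R * h) - F (K%:R * h) - F (K.+1%:R * h).
    elim: K => [|K IH]; first by rewrite big_ord0; ring.
    by rewrite big_ord_recr/= IH; ring.
  have := Fb 0%N; have := Fb 1%N; have := Fb K; have := Fb K.+1.
  by move=> /andP[? ?] /andP[? ?] /andP[? ?] /andP[? ?]; lra.
have [ma Ia] := integral_step_le (e0 j) rho0 a0 aS.
rewrite mulrA mulVf ?mul1r ?expf_neq0// in Ia; apply: le_trans Ia.
apply: ge0_le_integral => //.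
- move=> t; rewrite /= in_itv/= andbT => t0; rewrite lee_fin mulr_ge0 ?expR_ge0// mulr_ge0 ?exprn_ge0//.
  by rewrite subr_ge0 Fdec// lerDl ltW.
- apply/measurable_EFinP; exact: mf.
- exact/measurable_EFinP.
move=> t; rewrite /= in_itv/= andbT => t0; rewrite lee_fin ler_pM2l ?expR_gt0//.
rewrite ler_pM2l ?exprn_gt0//.
have /truncn_itv/andP[k1 k2] : 0 <= t / 2 ^- j by rewrite divr_ge0// ltW.
rewrite ler_pdivlMr// in k1; rewrite ltr_pdivrMr// in k2.
set k := Num.truncn _ in k1 k2 *.
rewrite lerB//; first by apply: Fdec => //; rewrite mulr_ge0 ?(ltW (e0 j))//.
apply: Fdec; first by rewrite addr_ge0 ?(ltW (e0 j))//.
by rewrite -[k.+2%:R]natr1 mulrDl mul1r lerD2r ltW.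
Qed.

End real_line.

Lemma lipschitz_abs_cont {R : realType} {n : nat} (a b K : R) (g : R -> 'rV[R]_n) :
  (forall s t, `|g t - g s| <= K * `|t - s|) -> abs_cont_on a b g.
Proof.
move=> gK e e0; have K1 : 0 < `|K| + 1 by rewrite ltr_wpDl.
exists (e / (`|K| + 1)); first by rewrite divr_gt0.
move=> k s t st _ ts.
apply: (@le_lt_trans _ _ (\sum_(i < k) (`|K| + 1) * (t i - s i))).
  apply: ler_sum => i _; have [_ [sti _]] := st i.
  apply: (le_trans (gK _ _)); rewrite [`|t i - s i|]ger0_norm ?subr_ge0//.
  by rewrite ler_wpM2r ?subr_ge0// (le_trans (ler_norm K))// lerDl.
by rewrite -mulr_sumr mulrC -ltr_pdivlMr.
Qed.

Lemma bounded_series_cvg0 {R : realType} (a : nat -> R) (B : R) :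
  (forall i, 0 <= a i) -> (forall K, \sum_(i < K) a i <= B) -> a @ \oo --> 0.
Proof.
move=> a0 aB; apply: cvg_series_cvg_0.
apply: nondecreasing_is_cvgn.
  by apply/nondecreasing_seqP => k; rewrite /series/= big_nat_recr//= lerDl.
by exists B => _ [K _ <-]; rewrite /series/= big_mkord.
Qed.

Section approximating_fields.
Context {R : realType} {n : nat}.
Local Notation Rn := 'rV[R]_n.
Variables (nu : probability Rn R) (D : set Rn) (v : Rn -> Rn) (M : R).
Hypotheses (mD : measurable D) (mv : forall l, measurable_fun setT (fun x => v x ord0 l))
  (vM : forall x, D x -> `|v x| <= M).

Lemma approximating_fields : exists w : nat -> 'I_n -> Rn -> R,
  [/\ forall i l, continuous (w i l),
      forall i, (\int[nu]_(x in D) (\sum_l `|v x ord0 l - w i l x|)%:E <= (2 ^- i.+1)%:E)%E &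
      exists N1, [/\ measurable N1, nu N1 = 0%E &
        forall x l, D x -> ~ N1 x -> w i l x @[i --> \oo] --> v x ord0 l]].
Proof.
have /choice[w0 w0P] : forall il : nat * 'I_n, exists w, continuous w /\
    (\int[nu]_(x in D) (`|v x ord0 il.2 - w x|)%:E <= (2 ^- il.1.+1 / n%:R)%:E)%E.
  move=> [i l]; apply: (@L1_continuous_approx R n nu D (fun x => v x ord0 l) M _ mD (mv l)) => /=.
    by move=> x Dx; apply: le_trans (vM Dx); exact: normr_coord_le.
  by rewrite divr_gt0 ?expr2V_gt0// ltr0n (leq_ltn_trans _ (ltn_ord l)).
pose w i l := w0 (i, l).
have cw i l : continuous (w i l) by case: (w0P (i, l)).
have mw i l : measurable_fun D (fun x => (`|v x ord0 l - w i l x|)%:E).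
  apply/measurable_EFinP; apply: measurable_funTS; apply: measurableT_comp => //.
  by apply: measurable_funB => //; exact: continuous_measurable_rV.
have iw i : (\int[nu]_(x in D) (\sum_l `|v x ord0 l - w i l x|)%:E <= (2 ^- i.+1)%:E)%E.
  under eq_integral do rewrite -sumEFin.
  rewrite ge0_integral_sum//.
  apply: (@le_trans _ _ (\sum_(l < n) (2 ^- i.+1 / n%:R)%:E)%E).
    by apply: lee_sum => l _; case: (w0P (i, l)).
  rewrite sumEFin lee_fin sumr_const card_ord -[leLHS]mulr_natl mulrCA.
  (* For [n = 0] the factor [n%:R / n%:R] is 0 rather than 1. *)
  by rewrite ler_piMr ?(ltW (expr2V_gt0 _))//; case: (n) => [|m]; rewrite ?mul0r ?divff.
exists w; split => //.
pose s i x := (\sum_l `|v x ord0 l - w i l x|)%:E.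
have s0 i x : (0 <= s i x)%E by rewrite lee_fin sumr_ge0.
have ms i : measurable_fun D (s i).
  by apply/measurable_EFinP; apply: measurable_sum => l; apply/measurable_EFinP; exact: mw.
pose S x := (\sum_(i <oo) s i x)%E.
have mS : measurable_fun D S by apply: ge0_emeasurable_sum => // i x _ _; exact: s0.
have S0 x : (0 <= S x)%E by exact: nneseries_ge0.
have iS : nu.-integrable D S.
  apply/integrableP; split => //.
  under eq_integral do rewrite gee0_abs//.
  rewrite integral_nneseries//.
  apply: (@le_lt_trans _ _ (\sum_(i <oo) (1 / (2 ^ i.+1)%:R)%:E)%E).
    apply: lee_nneseries => [i *|i *]; first by apply: integral_ge0 => x _; exact: s0.
    by rewrite natrX mul1r; exact: iw.
  by apply: le_lt_trans (epsilon_trick0 _ _) _; rewrite ?ltry.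
have [N1 [mN1 N10 SN1]] := integrable_ae mD iS.
exists N1; split => // x l Dx N1x.
have fS : S x \is a fin_num.
  by apply: contrapT => nf; apply: N1x; apply: SN1 => /= H; apply: nf; exact: H.
have s_cvg : (fun i => \sum_l `|v x ord0 l - w i l x|) @ \oo --> (0 : R).
  apply: (@bounded_series_cvg0 _ _ (fine (S x))) => [i|K]; first exact: sumr_ge0.
  rewrite -lee_fin fineK// -sumEFin.
  rewrite /S (nneseries_split 0 K)// add0n -(big_mkord xpredT (fun i => s i x)).
  rewrite leeDl//; apply: nneseries_ge0 => //.
apply/cvgrPdist_le => e e0; have /cvgrPdist_le/(_ _ e0) := s_cvg.
apply: filterS => i; rewrite sub0r normrN; apply: le_trans.
apply: le_trans (ler_norm _); rewrite (bigD1 l)//= lerDl.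
exact: sumr_ge0.
Qed.

End approximating_fields.

(** * The penalised Lagrangians *)

Section lagrangian.
Context {R : realType} {n : nat}.
Local Notation Rn := 'rV[R]_n.
Variables (U0 : set Rn) (U : nat -> set Rn) (w : nat -> 'I_n -> Rn -> R) (eta : R).
Hypotheses (oU0 : open U0) (oU : forall i, open (U i)) (cw : forall i l, continuous (w i l))
  (eta0 : 0 < eta).

Definition penalty (N i : nat) (x u : Rn) : R :=
  open_bump (U i) N x + \sum_l `|u ord0 l - w i l x|.

(** The number of penalties and the sharpness of the bumps grow with the same [N], so the sequence
    increases. The factor [eta] only makes the penalties cheap on average: it does not affect where
    their infinite sum is finite. *)
Definition lagrangian (N : nat) (x u : Rn) : R :=
  open_bump U0 N x + eta * \sum_(i < N) penalty N i x u.

Lemma penalty_ge0 N i x u : 0 <= penalty N i x u.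
Proof. by rewrite addr_ge0 ?open_bump_ge0// sumr_ge0. Qed.

Lemma lagrangian_ge0 N x u : 0 <= lagrangian N x u.
Proof.
rewrite addr_ge0 ?open_bump_ge0// mulr_ge0 ?(ltW eta0)// sumr_ge0// => i _.
exact: penalty_ge0.
Qed.

Lemma lagrangianS N x u : lagrangian N x u <= lagrangian N.+1 x u.
Proof.
rewrite lerD ?open_bumpS// ler_pM2l// big_ord_recr/=.
apply: (@le_trans _ _ (\sum_(i < N) penalty N.+1 i x u)).
  by apply: ler_sum => i _; rewrite lerD2r open_bumpS.
by rewrite lerDl penalty_ge0.
Qed.

Lemma continuous_lagrangian N : continuous (fun z : Rn * Rn => lagrangian N z.1 z.2).
Proof.
have c1 (f : Rn -> R) : continuous f -> continuous (fun z : Rn * Rn => f z.1).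
  by move=> cf z; apply: (@cvg_comp _ _ _ fst f); [exact: cvg_fst|exact: cf].
have c2 (f : Rn -> R) : continuous f -> continuous (fun z : Rn * Rn => f z.2).
  by move=> cf z; apply: (@cvg_comp _ _ _ snd f); [exact: cvg_snd|exact: cf].
have cb A := c1 _ (@continuous_open_bump R n A N).
move=> z; apply: cvgD; first exact: cb.
apply: cvgM; first exact: cvg_cst.
apply: cvg_finite_sum => i; apply: cvgD; first exact: cb.
apply: cvg_finite_sum => l; apply: cvg_norm; apply: cvgB.
  exact: (c2 _ (@coord_continuous _ _ _ ord0 l)).
exact: (c1 _ (@cw i l)).
Qed.

Lemma jensen_lagrangian N : jensen_convex (lagrangian N).
Proof.
move=> x q u; set a := q.+1%:R^-1.
have a0 : 0 < a :> R by rewrite invr_gt0.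
have avg (c : R) : a * \sum_(k < q.+1) c = c.
  by rewrite sumr_const card_ord -[X in _ * X]mulr_natl mulrA mulVf ?mul1r// pnatr_eq0.
rewrite /lagrangian [in leRHS]big_split/= [leRHS]mulrDr avg lerD2l -mulr_sumr mulrCA ler_pM2l//.
rewrite [in leRHS]exchange_big/= mulr_sumr; apply: ler_sum => i _.
rewrite /penalty [in leRHS]big_split/= [leRHS]mulrDr avg lerD2l.
rewrite [in leRHS]exchange_big/= mulr_sumr; apply: ler_sum => l _.
rewrite -{1}(avg (w i l x)) mxE summxE -mulrBr -sumrB normrM gtr0_norm// ler_pM2l//.
exact: ler_norm_sum.
Qed.

(* Bumps increase to indicators, so the full infinite penalty is recovered in the limit. *)
Lemma lagrangian_liminf (a : R) (x d : Rn) (u : nat -> Rn) (K : nat) : 0 <= a ->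
  u @ \oo --> d ->
  ((a * (\1_U0 x + eta * \sum_(i < K) (\1_(U i) x + \sum_l `|d ord0 l - w i l x|)))%:E <=
   limn_einf (fun N => (a * lagrangian N x (u N))%:E))%E.
Proof.
move=> a0 ud.
have cb (A : set Rn) : open A -> open_bump A N x @[N --> \oo] --> (\1_A x : R).
  move=> oA; have [Ax|Ax] := pselect (A x).
    rewrite indicE mem_set//; have [N0 N0P] := open_bump_eq1 oA Ax.
    by apply: cvg_near_cst; exists N0 => // N; exact: N0P.
  rewrite indicE memNset//; apply: cvg_near_cst; apply: nearW => N.
  exact: open_bump_out.
pose g N := open_bump U0 N x + eta * \sum_(i < K) penalty N i x (u N).
have gc : a * g N @[N --> \oo] --> a * (\1_U0 x + eta * \sum_(i < K) (\1_(U i) x + \sum_l `|d ord0 l - w i l x|)).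
  apply: cvgM; first exact: cvg_cst.
  apply: cvgD; first exact: cb.
  apply: cvgM; first exact: cvg_cst.
  apply: cvg_finite_sum => i; apply: cvgD; first exact: cb.
  apply: cvg_finite_sum => l; apply: cvg_norm; apply: cvgB; last exact: cvg_cst.
  by apply: (@cvg_comp _ _ _ u (fun y : Rn => y ord0 l)); [exact: ud|exact: coord_continuous].
apply: (@limn_einf_ge _ _ (fun N => (a * g N)%:E) _ K); last first.
  by apply: cvg_EFin; [exact: nearW|exact: gc].
move=> N KN; rewrite lee_fin ler_wpM2l// lerD2l ler_pM2l//.
rewrite -(subnKC KN) big_split_ord/= lerDl sumr_ge0// => i _.
exact: penalty_ge0.
Qed.

End lagrangian.

Section sampled_limits.
Context {R : realType}.

Lemma cvg_dnbhs_seq {T : Type} (f : R -> T) (G : set_system T) (h : nat -> R) :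
  f @ 0^' --> G -> h @ \oo --> 0 -> (forall N, h N != 0) -> f (h N) @[N --> \oo] --> G.
Proof.
move=> fG h0 hn A /fG fA.
have hA : \forall N \near \oo, h N != 0 -> A (f (h N)) := h0 _ fA.
by apply: filterS hA => N; apply.
Qed.

Lemma cvg_expr2V_subseq (s : nat -> nat) : (forall N, (N <= s N)%N) ->
  2 ^- s N @[N --> \oo] --> (0 : R).
Proof.
move=> sN; apply: (@squeeze_cvgr _ _ _ _ (fun=> 0) (fun N => 2 ^- N)).
- apply: nearW => N; rewrite (ltW (expr2V_gt0 _))/=.
  by rewrite lef_pV2 ?posrE ?exprn_gt0// ler_eXn2l// ltr1n.
- exact: cvg_cst.
- exact: cvg_expr2V.
Qed.

Lemma cvg_dyadic_quotient {W : normedModType R} (g : R -> W) (t : R) (s : nat -> nat) :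
  (forall N, (N <= s N)%N) -> derivable g t 1 ->
  2 ^+ s N *: (g (t + 2 ^- s N) - g t) @[N --> \oo] --> 'D_1 g t.
Proof.
move=> sN dg; have := cvg_dnbhs_seq dg (cvg_expr2V_subseq sN).
move=> /(_ (fun N => lt0r_neq0 (expr2V_gt0 (s N)))); apply: cvg_trans.
apply: near_eq_cvg; near=> N; rewrite /= invrK [X in g X](_ : _ = t + 2 ^- s N)//.
by rewrite /GRing.scale/= mulr1 addrC.
Unshelve. all: by end_near. Qed.

Lemma derive_translate {W : normedModType R} (g : R -> W) (s t : R) :
  derivable g (s + t) 1 ->
  derivable (fun u => g (s + u)) t 1 /\ 'D_1 (fun u => g (s + u)) t = 'D_1 g (s + t).
Proof.
move=> dg.
have E : (fun h : R => h^-1 *: (g (s + (h *: 1 + t)) - g (s + t))) =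
         (fun h : R => h^-1 *: (g (h *: 1 + (s + t)) - g (s + t))).
  by apply/funext => h; rewrite addrCA.
by split; [rewrite /derivable E|rewrite /derive E].
Qed.

End sampled_limits.

Section measurable_sections.
Context {R : realType} {n : nat}.
Local Notation Rn := 'rV[R]_n.

Lemma cvg_rV {T : Type} (F : set_system T) {FF : Filter F} (f : T -> Rn) (x : Rn) :
  (forall l, f t ord0 l @[t --> F] --> x ord0 l) -> f @ F --> x.
Proof.
move=> fx; apply/cvgrPdist_le => e e0.
have H : \forall t \near F, forall l, `|x ord0 l - f t ord0 l| <= e.
  by apply: filter_forall => l; have /cvgrPdist_le := fx l; apply.
apply: filterS H => t Ht; apply: normr_rV_le; first exact: ltW.
by move=> l; rewrite !mxE.
Qed.

(** On [G] the field is a pointwise limit of the continuous [W i]. Hence [(x, v x)] lies in the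
    closed set [C] iff, for every [m], the points [(x, W i x)] eventually lie in the open
    neighbourhood [Cm m], which is a countable combination of open conditions on [x]. *)
Lemma measurable_closed_section (C : set (Rn * Rn)) (G : set Rn) (v : Rn -> Rn)
    (w : nat -> 'I_n -> Rn -> R) :
  closed C -> measurable G -> (forall i l, continuous (w i l)) ->
  (forall x l, G x -> w i l x @[i --> \oo] --> v x ord0 l) ->
  measurable (G `&` [set x | C (x, v x)]).
Proof.
move=> cC mG cw wv.
pose W i x : Rn := \row_l w i l x.
have cW i : continuous (W i).
  move=> x; apply: (@cvg_rV _ (nbhs x) _ (W i) (W i x)) => l.
  rewrite (_ : (fun t => _) = w i l); first by rewrite mxE; exact: cw.
  by apply/funext => y; rewrite mxE.
have Wv x : G x -> W i x @[i --> \oo] --> v x.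
  move=> Gx; apply: cvg_rV => l.
  by rewrite (_ : (fun t => _) = fun i => w i l x); [exact: wv|apply/funext => y; rewrite mxE].
pose Cm (m : nat) := \bigcup_(z in C) ball z (m.+1%:R^-1 : R).
have oCm m : open (Cm m) by apply: bigcup_open => z _; exact: ball_open.
have m0 m : 0 < m.+1%:R^-1 :> R by rewrite invr_gt0.
pose O m i := [set x | Cm m (x, W i x)].
have oO m i : open (O m i).
  apply: (@open_comp _ _ (fun x => (x, W i x)) (Cm m)) => // x _.
  exact: (@cvg_to_pair _ _ _ (nbhs x) _ id (W i) x (W i x) (@cvg_id _ _) (cW i x)).
have -> : G `&` [set x | C (x, v x)] = G `&` \bigcap_m \bigcup_j \bigcap_i O m (j + i)%N.
  apply/seteqP; split => x [Gx Hx]; split => //.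
    move=> m _.
    have : (x, W i x) @[i --> \oo] --> (x, v x) by apply: cvg_to_pair; [exact: cvg_cst|exact: Wv].
    move=> /(_ _ (nbhsx_ballx _ _ (m0 m)))[j _ jP]; exists j => // i _.
    by exists (x, v x) => //; apply: jP => /=; exact: leq_addr.
  rewrite /= ((closure_id _).1 cC) => B /nbhs_ballP[e /= e0 eB].
  have e20 : 0 < e / 2 by rewrite divr_gt0.
  have [m me] : exists m, m.+1%:R^-1 <= e / 2.
    have /cvgrPdist_le/(_ _ e20)/filter_ex[m] := @cvg_harmonic R.
    by rewrite sub0r normrN => /(le_trans (ler_norm _)); exists m.
  have [j _ jP] := Hx m I.
  have : (x, W i x) @[i --> \oo] --> (x, v x) by apply: cvg_to_pair; [exact: cvg_cst|exact: Wv].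
  move=> /(_ _ (nbhsx_ballx _ _ e20))[k _ kP].
  have [z Cz zW] := jP k I.
  exists z; split => //; apply: eB; rewrite (splitr e).
  apply: (ball_triangle (y := (x, W (j + k)%N x))).
    by apply: kP => /=; exact: leq_addl.
  by apply: ball_sym; exact: le_ball zW.
apply: measurableI => //; apply: bigcapT_measurable => m; apply: bigcupT_measurable => j.
by apply: bigcapT_measurable => i; exact: open_measurable_rV.
Qed.

End measurable_sections.

Lemma measurable_fun_limn_einf d (T : measurableType d) (R : realType) (D : set T)
    (f : (T -> \bar R)^nat) : (forall k, measurable_fun D (f k)) ->
  measurable_fun D (fun x => limn_einf (f ^~ x)).
Proof.
move=> mf; rewrite /limn_einf; apply: measurableT_comp => //.
apply: (measurable_fun_limn_esup (f := fun k x => (- f k x)%E)) => k.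
exact: measurableT_comp.
Qed.

Section lyapunov_curves.
Context {R : realType} {n : nat}.
Local Notation Rn := 'rV[R]_n.
Local Notation leb := (@lebesgue_measure R).
Local Notation halfline := (`[0, +oo[%classic : set R).

(** The Lyapunov condition compares only with time 0; the inclusion is autonomous, so the curve
    restarted at time [s] is again a solution. *)
Lemma lyapunov_nonincreasing (H : Rn -> set Rn) (Lam : set Rn) (V : Rn -> R) (gam : R -> Rn) (K : R) :
  lyapunov H Lam V -> (forall s t, `|gam t - gam s| <= K * `|t - s|) ->
  {ae leb, forall t, 0 < t -> derivable gam t 1 /\ H (gam t) ('D_1 gam t)} ->
  forall s t, 0 <= s -> s <= t -> V (gam t) <= V (gam s).
Proof.
move=> [_ LV] gK sol s t s0; rewrite le_eqVlt => /orP[/eqP ->//|st].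
have sol_s : is_solution H (fun u => gam (s + u)).
  split=> [b _|].
    by apply: (@lipschitz_abs_cont _ _ 0 b K) => u u'; apply: (le_trans (gK _ _)); rewrite opprD addrACA subrr add0r.
  have [A [mA A0 HA]] := ae_shift s sol.
  exists A; split => // u Hu; apply: HA => sol_u; apply: Hu => u0.
  have [|du Hdu] := sol_u; first by rewrite ltr_wpDl.
  by have [d1 ->] := derive_translate du.
have [+ _] := LV _ sol_s (t - s) (eqbRL (subr_gt0 _ _) st).
by rewrite addr0 addrC subrK.
Qed.

Lemma integrable_of_le_cst (nu : probability Rn R) (D : set Rn) (f : Rn -> R) (B : R) :
  measurable D -> measurable_fun D f -> (forall x, 0 <= f x) ->
  (\int[nu]_(x in D) (f x)%:E <= B%:E)%E -> nu.-integrable D (fun x => (f x)%:E).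
Proof.
move=> mD mf f0 fB; apply/integrableP; split; first exact/measurable_EFinP.
under eq_integral do rewrite gee0_abs ?lee_fin//.
exact: le_lt_trans fB (ltry _).
Qed.

Lemma outer_null_cover (nu : probability Rn R) (N : set Rn) : measurable N -> nu N = 0%E ->
  exists U : nat -> set Rn, forall i, [/\ open (U i), N `<=` U i & (nu (U i) <= (2 ^- i.+1)%:E)%E].
Proof.
move=> mN N0.
suff /choice[U UP] : forall i, exists U : set Rn,
  [/\ open U, N `<=` U & (nu U <= (2 ^- i.+1)%:E)%E] by exists U.
move=> i.
have [_ /(_ _ (expr2V_gt0 i.+1))[F [U [cF oU FN NU UF]]]] := Borel_regular nu mN.
exists U; split => //.
have mF := closed_measurable_rV cF; have mU := open_measurable_rV oU.
have F0 : nu F = 0%E by apply/eqP; rewrite -measure_le0 -N0 le_measure ?inE.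
rewrite -(setDUK (subset_trans FN NU)) measureU//; last 2 first.
- exact: measurableD.
- by rewrite setDIK.
by rewrite [X in (X + _)%E](_ : _ = 0%E) ?add0e.
Qed.

(** A closed subset is wanted because its complement is open and so has continuous bumps. The
    constant [b] is half the measure of [B]. *)
Lemma inner_closed_positive (nu : probability Rn R) (B : set Rn) : measurable B -> nu B != 0%E ->
  exists A (b : R), [/\ closed A, A `<=` B, 0 < b & (nu (~` A) <= (1 - b)%:E)%E].
Proof.
move=> mB B0; have fB : nu B \is a fin_num by exact: fin_num_measure.
set a := fine (nu B); have aE : nu B = a%:E by rewrite fineK.
have a0 : 0 < a by rewrite -lte_fin -aE lt0e B0 measure_ge0.
have a20 : 0 < a / 2 by rewrite divr_gt0.
have [_ /(_ _ a20)[F [U [cF oU FB BU UF]]]] := Borel_regular nu mB.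
have mF := closed_measurable_rV cF; have mU := open_measurable_rV oU.
exists F, (a / 2); split => //.
have h1 : (nu B <= nu F + (a / 2)%:E)%E.
  apply: (@le_trans _ _ (nu F + nu (B `\` F))%E).
    rewrite -{1}(setDUK FB) measureU//; [exact: measurableD|by rewrite setDIK].
  rewrite leeD2l//; apply: le_trans UF; apply: le_measure; rewrite ?inE.
  - exact: measurableD.
  - exact: measurableD.
  - exact: setSD.
have fF : nu F \is a fin_num by exact: fin_num_measure.
rewrite probability_setC//; move: h1; rewrite aE -(fineK fF) -!EFinD !lee_fin => h1.
by lra.
Qed.

Lemma lagrangian_integral_le (nu : probability Rn R) (D : set Rn) (v : Rn -> Rn)
    (U0 : set Rn) (U : nat -> set Rn) (w : nat -> 'I_n -> Rn -> R) (eta b : R) (N : nat) :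
  measurable D -> (forall l, measurable_fun setT (fun x => v x ord0 l)) ->
  open U0 -> (forall i, open (U i)) -> (forall i l, continuous (w i l)) -> 0 < eta ->
  (nu U0 <= (1 - b)%:E)%E -> (forall i, (nu (U i) <= (2 ^- i.+1)%:E)%E) ->
  (forall i, (\int[nu]_(x in D) (\sum_l `|v x ord0 l - w i l x|)%:E <= (2 ^- i.+1)%:E)%E) ->
  measurable_fun D (fun x => lagrangian U0 U w eta N x (v x)) /\
  (\int[nu]_(x in D) (lagrangian U0 U w eta N x (v x))%:E <= (1 - b + 2 * eta)%:E)%E.
Proof.
move=> mD mv oU0 oU cw eta0 U0b Ub wb.
have mb A : measurable_fun D (open_bump A N).
  by apply: measurable_funTS; apply: continuous_measurable_rV; exact: continuous_open_bump.
have ms i : measurable_fun D (fun x => \sum_l `|v x ord0 l - w i l x|).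
  apply: measurable_sum => l; apply: measurable_funTS; apply: measurableT_comp => //.
  by apply: measurable_funB => //; exact: continuous_measurable_rV.
have mp i : measurable_fun D (fun x => penalty U w N i x (v x)) by exact: measurable_funD.
split.
  by apply: measurable_funD => //; apply: measurable_funM => //; exact: measurable_sum.
have Ib A (c : R) : open A -> (nu A <= c%:E)%E -> (\int[nu]_(x in D) (open_bump A N x)%:E <= c%:E)%E.
  move=> oA Ac; have mA := open_measurable_rV oA; apply: le_trans Ac.
  apply: (@le_trans _ _ (\int[nu]_(x in D) (\1_A x)%:E)%E).
    apply: ge0_le_integral => //.
    - by move=> x _; rewrite lee_fin open_bump_ge0.
    - exact/measurable_EFinP.
    - by apply/measurable_EFinP; exact: measurable_indic.
    move=> x _; rewrite lee_fin; have [Ax|Ax] := pselect (A x).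
      by rewrite indicE mem_set// open_bump_le1.
    by rewrite open_bump_out.
  rewrite integral_indic//; apply: le_measure; rewrite ?inE//; exact: measurableI.
have Ip i : (\int[nu]_(x in D) (penalty U w N i x (v x))%:E <= (2 ^- i.+1 + 2 ^- i.+1)%:E)%E.
  under eq_integral do rewrite EFinD.
  rewrite ge0_integralD//; first by rewrite EFinD leeD// Ib.
  - by move=> x _; rewrite lee_fin open_bump_ge0.
  - exact/measurable_EFinP.
  - by move=> x _; rewrite lee_fin sumr_ge0.
  - exact/measurable_EFinP.
(* Each penalty costs [2 ^- i.+1] for its open set and as much for its field. *)
have geo K : \sum_(i < K) (2 ^- i.+1 + 2 ^- i.+1) <= 2 :> R.
  suff -> : \sum_(i < K) (2 ^- i.+1 + 2 ^- i.+1) = 2 - 2 * 2 ^- K :> R.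
    by rewrite gerBl mulr_ge0// ltW// expr2V_gt0.
  elim: K => [|K IH]; first by rewrite big_ord0 expr0 invr1; ring.
  by rewrite big_ord_recr/= IH exprS invfM; field; rewrite expf_neq0.
under eq_integral do rewrite /lagrangian EFinD EFinM.
rewrite ge0_integralD//.
- rewrite EFinD leeD//; first exact: Ib.
  rewrite ge0_integralZl//.
  + rewrite EFinM muleC lee_pmul2r//.
    under eq_integral do rewrite -sumEFin.
    rewrite ge0_integral_sum//.
    * apply: (@le_trans _ _ (\sum_(i < N) (2 ^- i.+1 + 2 ^- i.+1)%:E)%E).
        by apply: lee_sum => i _; exact: Ip.
      by rewrite sumEFin lee_fin.
    * by move=> i; apply/measurable_EFinP; exact: mp.
    * by move=> i x _; rewrite lee_fin penalty_ge0.
  + by apply/measurable_EFinP; exact: measurable_sum.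
  + by move=> x _; rewrite lee_fin sumr_ge0// => i _; exact: penalty_ge0.
  + by rewrite lee_fin ltW.
- by move=> x _; rewrite lee_fin open_bump_ge0.
- exact/measurable_EFinP.
- by move=> x _; rewrite lee_fin mulr_ge0 ?(ltW eta0)// sumr_ge0// => i _; exact: penalty_ge0.
- by apply/measurable_EFinP; apply: measurable_funM => //; exact: measurable_sum.
Qed.

End lyapunov_curves.

(** * Orthogonality for a vector field *)

Section closed_orthogonality.
Context {R : realType} {n : nat}.
Local Notation Rn := 'rV[R]_n.
Local Notation leb := (@lebesgue_measure R).
Local Notation halfline := (`[0, +oo[%classic : set R).
Variables (H : Rn -> set Rn) (Lam : set Rn) (V : Rn -> R).
Variables (nu : probability Rn R) (D : set Rn) (v : Rn -> Rn) (M : R).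
Hypotheses (pdV : path_differentiable V) (LV : lyapunov H Lam V) (M0 : 0 <= M)
  (mD : measurable D) (nuD : nu D = 1%E)
  (mv : forall l, measurable_fun setT (fun x => v x ord0 l))
  (DM : forall x, D x -> `|x| <= M /\ `|v x| <= M) (DH : forall x, D x -> H x (v x))
  (Dv : closed_along nu D v).
Variables (w : nat -> 'I_n -> Rn -> R) (G : set Rn).
Hypotheses (mG : measurable G) (GD : G `<=` D) (nuG : nu (~` G) = 0%E)
  (cw : forall i l, continuous (w i l))
  (Iw : forall i, (\int[nu]_(x in D) (\sum_l `|v x ord0 l - w i l x|)%:E <= (2 ^- i.+1)%:E)%E)
  (wv : forall x l, G x -> w i l x @[i --> \oo] --> v x ord0 l).

Let steep_points (delta : R) : set Rn := G `&` [set x | closure (steep_set V delta) (x, v x)].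

(* A curve spending a positive proportion of its time in the steep points
   would make the bounded function [V] decrease at a definite rate. *)
Lemma steep_points_null (delta : R) : 0 < delta -> nu (steep_points delta) = 0%E.
Proof.
move=> delta0; apply/eqP/negPn/negP => B0.
have mB : measurable (steep_points delta).
  apply: measurable_closed_section cw wv => //; exact: closed_closure.
have [A [b [cA AB b0 Ab]]] := inner_closed_positive mB B0.
have [U UP] := outer_null_cover (measurableC mG) nuG.
have oU i : open (U i) by case: (UP i).
have oA : open (~` A) by exact: closed_openC.
(* The mean cost is at most [1 - b + b / 4], below the level [1 - b / 2]; the curve will satisfy the
   level [1 - b / 4]. *)
pose eta := b / 8; have eta0 : 0 < eta by rewrite divr_gt0.
pose L := lagrangian (~` A) U w eta.
have IL N := @lagrangian_integral_le R n nu D v (~` A) U w eta b N mD mv oA oU cw eta0 Ab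
  (fun i => let: And3 _ _ h := UP i in h) Iw.
have L0 N x u : 0 <= L N x u by exact: lagrangian_ge0.
have iL N : nu.-integrable D (fun x => (L N x (v x))%:E).
  by have [mL IL'] := IL N; exact: integrable_of_le_cst IL'.
have Lc N : (\int[nu]_(x in D) (L N x (v x))%:E < (1 - b / 2)%:E)%E.
  by have [_ IL'] := IL N; apply: (le_lt_trans IL'); rewrite lte_fin /eta; lra.
have [cV _] := LV.
have [Q VQ] : exists Q, forall x : Rn, `|x| <= M + 2 -> `|V x| <= Q.
  have cVV : continuous (fun z : Rn * Rn => `|V z.1|).
    move=> z; apply: cvg_norm; apply: (@cvg_comp _ _ _ fst V); [exact: cvg_fst|exact: cV].
  exact: (@continuous_disk_bound R n (fun x _ => `|V x|) cVV).
have Q0 : 0 <= Q by apply: le_trans (VQ 0 _); rewrite ?normr0//; have := M0; lra.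
(* Chosen so that [b / 4 / rho], the discounted time forced in [A], equals [4 * (Q + 1) / delta],
   more than the bound [4 * Q / delta] allowed by the decrease of [V]. *)
pose rho := b * delta / (16 * (Q + 1)).
have rho0 : 0 < rho by rewrite divr_gt0 ?mulr_gt0//; lra.
have [|gam [gamK gamQ [s [sN Igam]]]] := @discounted_curve R n nu D v M (1 - b / 2) (1 - b / 4)
  rho L mD nuD M0 rho0 DM Dv (@continuous_lagrangian R n (~` A) U w eta cw) L0
  (@lagrangianS R n (~` A) U w eta eta0) (@jensen_lagrangian R n (~` A) U w eta eta0) iL Lc.
  by lra.
have cgam : continuous gam by exact: lipschitz_curve_continuous gamK.
have ce : continuous (fun t : R => expR (- (rho * t))).
  move=> t; apply: continuous_comp; last exact: continuous_expR.
  by apply: continuousN; apply: mulrl_continuous.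
pose P N t := (expR (- (rho * t)) * L N (gam t) (2 ^+ s N *: (gam (t + 2 ^- s N) - gam t)))%:E.
pose Psi t := limn_einf (fun N => P N t).
have mP N : measurable_fun halfline (P N).
  apply/measurable_EFinP; apply: measurable_funTS; apply: measurable_funM.
    exact: continuous_measurable_fun.
  apply: continuous_measurable_fun.
  apply: (@continuous_compose2 R n (L N) (@continuous_lagrangian R n (~` A) U w eta cw N) _ gam
    (fun t => 2 ^+ s N *: (gam (t + 2 ^- s N) - gam t))) => // t.
  apply: cvgZr; apply: cvgB; last exact: cgam.
  apply: continuous_comp; last exact: cgam.
  by apply: cvgD; [exact: cvg_id|exact: cvg_cst].
have P0 N t : (0 <= P N t)%E by rewrite lee_fin mulr_ge0// expR_ge0.
have mPsi : measurable_fun halfline Psi by exact: measurable_fun_limn_einf.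
have Psi0 t : (0 <= Psi t)%E.
  by apply: (@limn_einf_ge _ _ (fun=> 0%E) _ 0%N) => //; exact: cvg_cst.
have iPsi : leb.-integrable halfline Psi.
  apply/integrableP; split => //; under eq_integral do rewrite gee0_abs//.
  exact: le_lt_trans Igam (ltry _).
have Psi_ge t K : derivable gam t 1 ->
  ((expR (- (rho * t)) * (\1_(~` A) (gam t) + eta * \sum_(i < K) (\1_(U i) (gam t) +
     \sum_l `|('D_1 gam t) ord0 l - w i l (gam t)|)))%:E <= Psi t)%E.
  move=> dg; apply: lagrangian_liminf => //.
  exact: cvg_dyadic_quotient.
(* A finite [Psi t] bounds all partial sums of the penalties, so [q i] tends to 0. Outside [G] every
   indicator in [q] would be 1, and the other part of [q] makes [w i] converge to the derivative as
   well as to [v]. *)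
have good t : derivable gam t 1 -> Psi t \is a fin_num -> G (gam t) /\ 'D_1 gam t = v (gam t).
  move=> dg fPsi.
  pose q i := \1_(U i) (gam t) + \sum_l `|('D_1 gam t) ord0 l - w i l (gam t)|.
  have q0 i : 0 <= q i by rewrite addr_ge0 ?sumr_ge0// indicE.
  have qc : q @ \oo --> 0.
    apply: (@bounded_series_cvg0 _ _ (eta^-1 * (expR (rho * t) * fine (Psi t)))) => // K.
    rewrite ler_pdivlMl// -(ler_pM2l (expR_gt0 (- (rho * t)))).
    rewrite [leRHS]mulrA -expRD addNr expR0 mul1r -lee_fin fineK//.
    apply: le_trans (Psi_ge t K dg); rewrite lee_fin ler_pM2l ?expR_gt0//.
    by rewrite lerDr indicE.
  have Gt : G (gam t).
    apply: contrapT => nG.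
    have /cvgrPdist_lt/(_ _ (@ltr01 R))/filter_ex[i] := qc.
    rewrite sub0r normrN ger0_norm// ltNge => /negP; apply.
    have [_ NU _] := UP i.
    by rewrite /q indicE mem_set ?lerDl ?sumr_ge0//; exact: NU.
  split => //; apply/rowP => l.
  have c1 : w i l (gam t) @[i --> \oo] --> ('D_1 gam t) ord0 l.
    apply/cvgrPdist_le => e e0; have /cvgrPdist_le/(_ _ e0) := qc.
    apply: filterS => i; rewrite sub0r normrN ger0_norm//; apply: le_trans.
    rewrite /q (bigD1 l)//= addrCA lerDl addr_ge0 ?sumr_ge0// indicE//.
  by have := cvg_unique _ c1 (wv (x := gam t) (l := l) Gt); apply.
have gam_ll : locally_lipschitz gam.
  by move=> t; exists 1, (M + 1); split => // y z _ _; exact: gamK.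
have [_ /(_ gam gam_ll) ae1] := pdV.
have ae2 : {ae leb, forall t, halfline t -> Psi t \is a fin_num} by exact: integrable_ae.
have FFae : Filter (almost_everywhere leb) by apply: ae_filter_ringOfSetsType.
have sol : {ae leb, forall t, 0 < t -> derivable gam t 1 /\ H (gam t) ('D_1 gam t)}.
  apply: (@filterS2 _ _ FFae _ _ _ _ ae1 ae2) => t [_ dg _] fPsi t0; split => //.
  have [|Gt ->] := good t dg; last by apply: DH; exact: GD.
  by apply: fPsi; rewrite /= in_itv/= andbT ltW.
have Fdec := lyapunov_nonincreasing LV gamK sol.
pose F t := V (gam t).
have cF : continuous F by move=> t; apply: continuous_comp; [exact: cgam|exact: cV].
have IPhi := monotone_decrease_le rho0 cF (fun t _ => VQ _ (gamQ t)) Fdec.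
pose p j t := (expR (- (rho * t)) * (2 ^+ j * (F t - F (t + 2 ^- j))))%:E.
pose Phi t := limn_einf (fun j => p j t).
have mp j : measurable_fun halfline (p j).
  apply/measurable_EFinP; apply: measurable_funTS; apply: measurable_funM.
    exact: continuous_measurable_fun.
  apply: measurable_funM => //; apply: measurable_funB; first exact: continuous_measurable_fun.
  apply: continuous_measurable_fun => t; apply: continuous_comp; last exact: cF.
  by apply: cvgD; [exact: cvg_id|exact: cvg_cst].
have mPhi : measurable_fun halfline Phi by exact: measurable_fun_limn_einf.
have p0 j t : 0 <= t -> (0 <= p j t)%E.
  move=> t0; rewrite lee_fin mulr_ge0 ?expR_ge0// mulr_ge0 ?exprn_ge0//.
  by rewrite subr_ge0 Fdec// lerDl ltW// expr2V_gt0.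
have Phi0 t : 0 <= t -> (0 <= Phi t)%E.
  by move=> t0; apply: (@limn_einf_ge _ _ (fun=> 0%E) _ 0%N) => [N _|]; [exact: p0|exact: cvg_cst].
have key : {ae leb, forall t, halfline t ->
    ((expR (- (rho * t)))%:E <= Psi t + (delta^-1)%:E * Phi t)%E}.
  apply: (@filterS2 _ _ FFae _ _ _ _ ae1 ae2) => t [dF dg gradF] fPsi t0.
  have t00 : 0 <= t by move: t0; rewrite /= in_itv/= andbT.
  have [Gt Dg] := good t dg (fPsi t0).
  (* Outside [A] the indicator in [Psi] alone supplies the weight, already with no penalties
     ([K = 0]). In [A] a Clarke subgradient at [gam t] gives a derivative of [V] along [gam] of size
     at least [delta]; it is nonpositive by monotonicity. *)
  have [At|At] := pselect (A (gam t)); last first.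
    apply: (@le_trans _ _ (Psi t)).
      apply: le_trans (Psi_ge t 0%N dg).
      by rewrite big_ord0 mulr0 addr0 indicE mem_set// mulr1.
    by rewrite leeDl// mule_ge0 ?Phi0// lee_fin invr_ge0 ltW.
  have [_ cl] := AB _ At; have [Vll _] := pdV.
  have [z Vz dz] := steep_closure_witness Vll cl.
  have F't := gradF _ Vz; rewrite Dg in F't; rewrite -F't in dz.
  have qc := cvg_dyadic_quotient (s := id) (fun N => leqnn N) dF.
  have qc' : expR (- (rho * t)) * (2 ^+ j * (F t - F (t + 2 ^- j))) @[j --> \oo] -->
      expR (- (rho * t)) * (- 'D_1 (V \o gam) t).
    apply: cvgM; first exact: cvg_cst.
    rewrite (_ : (fun j => _) = fun j => - (2 ^+ j *: ((V \o gam) (t + 2 ^- j) - (V \o gam) t))).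
      exact: cvgN qc.
    by apply/funext => j; rewrite /F/= /GRing.scale/= -mulrN opprB.
  have F'0 : 'D_1 (V \o gam) t <= 0.
    rewrite -oppr_ge0 -(pmulr_rge0 _ (expR_gt0 (- (rho * t)))).
    by apply: (cvgr_to_ge qc'); apply: nearW => j; rewrite -lee_fin; exact: p0.
  have PhiE : Phi t = (expR (- (rho * t)) * (- 'D_1 (V \o gam) t))%:E.
    have pc : p j t @[j --> \oo] --> (expR (- (rho * t)) * (- 'D_1 (V \o gam) t))%:E.
      by apply: cvg_EFin; [exact: nearW|exact: qc'].
    by have [E _] := cvg_limn_einf_sup pc; exact: E.
  apply: (@le_trans _ _ ((delta^-1)%:E * Phi t)%E); last by rewrite leeDr.
  rewrite PhiE -EFinM lee_fin mulrCA ler_peMr ?expR_ge0//.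
  by rewrite ler_pdivlMl// mulr1 -ler0_norm.
have : ((rho^-1)%:E <= ((1 - b / 4) / rho + delta^-1 * (4 * Q))%:E)%E.
  apply: (le_trans (integral_expRN_halfline rho0)).
  have mdPhi : measurable_fun halfline (fun t => (delta^-1)%:E * Phi t)%E by exact: emeasurable_funM.
  have dPhi0 t : halfline t -> (0 <= (delta^-1)%:E * Phi t)%E.
    by rewrite /= in_itv/= andbT => t0; rewrite mule_ge0 ?Phi0// lee_fin invr_ge0 ltW.
  apply: (@le_trans _ _ (\int[leb]_(t in halfline) (Psi t + (delta^-1)%:E * Phi t))%E).
    apply: ae_ge0_le_integral => //.
    - by apply/measurable_EFinP; apply: measurable_funTS; exact: continuous_measurable_fun.
    - by move=> t t0; rewrite adde_ge0// dPhi0.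
    - exact: emeasurable_funD.
  rewrite ge0_integralD//.
  rewrite EFinD leeD// EFinM ge0_integralZl//.
  - by rewrite lee_pmul2l ?lte_fin ?invr_gt0.
  - by move=> t; rewrite /= in_itv/= andbT => t0; exact: Phi0.
  - by rewrite lee_fin invr_ge0 ltW.
rewrite lee_fin -lerBlDl -{1}(div1r rho) -mulrBl opprB addrC subrK.
rewrite /rho (_ : b / 4 / _ = 4 * (Q + 1) / delta); last first.
  by field; rewrite !gt_eqF//; lra.
by rewrite [_ * (4 * Q)]mulrC ler_pM2r ?invr_gt0//; lra.
Qed.

(** The steep points grow as [delta] decreases, so the countably many values [1 / (k + 1)] exhaust
    the exceptional set inside [G]. *)
Lemma not_perp_negligible : nu.-negligible [set x | ~ perp_set (clarke_subdiff V x) (v x)].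
Proof.
have d0 k : 0 < k.+1%:R^-1 :> R by rewrite invr_gt0.
apply: (@negligibleS _ _ _ _ (~` G `|` \bigcup_k steep_points k.+1%:R^-1)); last first.
  apply: negligibleU; first by apply/negligibleP => //; exact: measurableC.
  apply: negligible_bigcup => k; apply/negligibleP; last exact: steep_points_null.
  apply: measurable_closed_section cw wv => //; exact: closed_closure.
move=> x /= nperp; have [Gx|] := pselect (G x); last by left.
right; have [delta delta0 cl] := steep_closure_of_not_perp nperp.
have [k kd] : exists k, k.+1%:R^-1 <= delta.
  have /cvgrPdist_le/(_ _ delta0)/filter_ex[m] := @cvg_harmonic R.
  by rewrite sub0r normrN => /(le_trans (ler_norm _)); exists m.
exists k => //; split => //=; apply: closureS cl => z [dz zd]; split => //.
exact: le_trans zd.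
Qed.

End closed_orthogonality.

(** * The barycentric field of a disintegration *)

Section mixture.
Local Open Scope ereal_scope.
Import HBNNSimple.
Context d d' (X : measurableType d) (Y : measurableType d') (R : realType).
Variables (nu : {measure set X -> \bar R}) (k : R.-pker X ~> Y) (mu : {measure set Y -> \bar R}).
Hypothesis muE : forall A, measurable A -> mu A = \int[nu]_x k x A.

Lemma integral_mixture (f : Y -> \bar R) : (forall y, 0 <= f y) -> measurable_fun setT f ->
  \int[mu]_y f y = \int[nu]_x \int[k x]_y f y.
Proof.
move=> f0 mf; pose g := nnsfun_approx measurableT mf.
have mk A : measurable A -> measurable_fun setT (k ^~ A) by exact: measurable_kernel.
have gE (m : {measure set Y -> \bar R}) n : \int[m]_y (g n y)%:E =
    \sum_(r \in range (g n)) r%:E * m (g n @^-1` [set r]).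
  by rewrite -sintegralE -integralT_nnsfun; apply: eq_integral.
have H n : \int[mu]_y (g n y)%:E = \int[nu]_x \int[k x]_y (g n y)%:E.
  rewrite gE; under [RHS]eq_integral do rewrite gE.
  rewrite ge0_integral_fsum//.
  - apply: eq_fsbigr => r /set_mem[y _ <-].
    by rewrite muE// ge0_integralZl ?lee_fin//; exact: mk.
  - move=> r; apply: emeasurable_funM => //; exact: mk.
  - move=> r x _; have [[z <-]|nr] := pselect (exists y, g n y = r).
      by rewrite mule_ge0// lee_fin.
    rewrite (_ : _ @^-1` _ = set0) ?measure0 ?mule0//.
    by apply/seteqP; split => // z /= zr; apply: nr; exists z.
have gf (m : {measure set Y -> \bar R}) : \int[m]_y (g n y)%:E @[n --> \oo] --> \int[m]_y f y.
  rewrite (_ : \int[m]_y f y = \int[m]_y (lim ((g n y)%:E @[n --> \oo]))); last first.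
    by apply: eq_integral => y _; apply/esym/cvg_lim => //; exact: cvg_nnsfun_approx.
  apply: cvg_monotone_convergence => //.
  - by move=> n; exact/measurable_EFinP.
  - by move=> n y _; rewrite lee_fin.
  - by move=> y _ a b ab; rewrite lee_fin; exact/lefP/nd_nnsfun_approx.
have mg n : measurable_fun setT (fun x => \int[k x]_y (g n y)%:E).
  apply: measurable_fun_integral_kernel => //; first by move=> y; rewrite lee_fin.
  exact/measurable_EFinP.
rewrite -(cvg_lim _ (gf mu))//; under eq_fun do rewrite H.
rewrite -monotone_convergence//.
- by apply: eq_integral => x _; apply/cvg_lim => //; exact: gf.
- by move=> n x _; apply: integral_ge0 => y _; rewrite lee_fin.
- move=> x _ a b ab; apply: ge0_le_integral => //.
  + by move=> y _; rewrite lee_fin.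
  + exact/measurable_EFinP.
  + exact/measurable_EFinP.
  + by move=> y _; rewrite lee_fin; exact/lefP/nd_nnsfun_approx.
Qed.

End mixture.

Section product_compact.
Context {R : realType} {n : nat}.
Local Notation Rn := 'rV[R]_n.

Lemma compact_prod_bounded (K : set (Rn * Rn)) : compact K ->
  exists2 M : R, 0 <= M & forall z, K z -> `|z.1| <= M /\ `|z.2| <= M.
Proof.
move=> /compact_bounded[M [_ HM]]; exists (`|M| + 1); first by rewrite addr_ge0.
move=> z Kz; have : `|z| <= `|M| + 1 by apply: HM => //; rewrite ltr_pwDr// ler_norm.
rewrite prod_normE => h; split; apply: le_trans h.
  by rewrite num_le_max lexx.
by rewrite num_le_max lexx orbT.
Qed.

(** The product sigma-algebra is generated by rectangles, so topology must be turned into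
    rectangles: [K] is the intersection over [m] of the countable unions of cells of radius
    [1 / (m + 1)] that meet [K]. *)
Lemma compact_prod_measurable (K : set (Rn * Rn)) : compact K -> measurable K.
Proof.
move=> cK; have clK : closed K by apply: compact_closed cK; exact: norm_hausdorff.
have [M M0 KM] := compact_prod_bounded cK.
have m0 m : 0 < m.+1%:R^-1 :> R by rewrite invr_gt0.
have /choice[y yP] : forall m : nat, exists y : nat -> Rn,
    forall x, `|x| <= M -> exists i, `|y i - x| <= m.+1%:R^-1.
  move=> m; have [k [y [_ ynet]]] := @finite_net R n M _ M0 (m0 m).
  exists (fun i => y (inord i)) => x /ynet[i yx]; exists i.
  by rewrite inord_val.
pose cell m i j := [set x | `|y m i - x| <= m.+1%:R^-1] `*` [set u | `|y m j - u| <= m.+1%:R^-1].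
have mdisk (a : Rn) (e : R) : measurable [set x | `|a - x| <= e].
  apply: closed_measurable_rV; apply: (@closed_comp _ _ (fun x : Rn => `|a - x|) [set r | r <= e]).
    move=> x _; apply: (nonexpansive_continuous (f := fun x : Rn => `|a - x|)) => b c.
    by apply: le_trans (ler_dist_dist _ _) _; rewrite opprB addrC subrKA distrC.
  exact: closed_le.
have mcell m i j : measurable (cell m i j) by exact: measurableX.
pose R_ m := \bigcup_i \bigcup_j [set z | cell m i j z /\ K `&` cell m i j !=set0].
have mR m : measurable (R_ m).
  apply: bigcupT_measurable => i; apply: bigcupT_measurable => j.
  have [Kc|Kc] := pselect (K `&` cell m i j !=set0).
    by rewrite (_ : mkset _ = cell m i j)//; apply/seteqP; split => z // [].
  by rewrite (_ : mkset _ = set0)//; apply/seteqP; split => z // [].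
rewrite (_ : K = \bigcap_m R_ m); first exact: bigcapT_measurable.
apply/seteqP; split=> [z Kz m _|z Hz].
  have [z1 z2] := KM z Kz; have [i yi] := yP m _ z1; have [j yj] := yP m _ z2.
  by exists i => //; exists j => //; split; [split|exists z; split => //; split].
rewrite ((closure_id _).1 clK) => B /nbhs_ballP[e /= e0 eB].
have e20 : 0 < e / 2 by rewrite divr_gt0.
have [m me] : exists m, m.+1%:R^-1 < e / 2.
  have /cvgrPdist_lt/(_ _ e20)/filter_ex[m] := @cvg_harmonic R.
  by rewrite sub0r normrN => /(le_lt_trans (ler_norm _)); exists m.
have [i _ [j _ [[z1 z2] [x [Kx [x1 x2]]]]]] := Hz m I.
have tri (a b c : Rn) : `|a - b| <= m.+1%:R^-1 -> `|a - c| <= m.+1%:R^-1 -> ball b e c.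
  move=> ab ac; rewrite -ball_normE/= -(subrKA a); apply: le_lt_trans (ler_normD _ _) _.
  by rewrite distrC (splitr e) ltrD//; apply: le_lt_trans me.
by exists x; split => //; apply: eB; split; [exact: tri z1 x1|exact: tri z2 x2].
Qed.

End product_compact.

Section derive_expansion.
Context {R : realType} {n : nat}.
Local Notation Rn := 'rV[R]_n.

Lemma derive_sum_coord (g : Rn -> R) (x u : Rn) : differentiable g x ->
  'D_u g x = \sum_l u ord0 l * 'D_(delta_mx ord0 l) g x.
Proof.
move=> dg; rewrite deriveE// {1}(row_sum_delta u) linear_sum/=.
by apply: eq_bigr => l _; rewrite linearZ/= -deriveE.
Qed.

Lemma continuous_bounded_disk (f : Rn -> R) (M : R) : continuous f ->
  exists2 B, 0 <= B & forall x, `|x| <= M -> `|f x| <= B.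
Proof.
move=> cf; have cff : continuous (fun z : Rn * Rn => `|f z.1|).
  by move=> z; apply: cvg_norm; apply: (@cvg_comp _ _ _ fst f); [exact: cvg_fst|exact: cf].
have [B BP] := @continuous_disk_bound R n (fun x _ => `|f x|) cff M.
exists `|B| => // x xM; apply: le_trans (BP x xM) _; exact: ler_norm.
Qed.

End derive_expansion.

Section barycenter.
Context {R : realType} {n : nat}.
Local Notation Rn := 'rV[R]_n.
Variables (mu : probability (Rn * Rn)%type R) (k : R.-pker Rn ~> (Rn * Rn)%type).
Variable nu : probability Rn R.
Hypotheses (nuE : forall A, nu A = proj_measure mu A)
  (muk : forall A, measurable A -> (mu A = \int[nu]_x k x A)%E)
  (kfib : nu.-negligible (~` [set x | k x ([set x] `*` [set: Rn]) = 1%E]))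
  (clmu : closed_measure mu).

Let msnd (l : 'I_n) : measurable_fun setT (fun z : Rn * Rn => z.2 ord0 l).
Proof.
apply: (measurableT_comp (f := fun u : Rn => u ord0 l)); last exact: measurable_snd.
by apply: continuous_measurable_rV => x; exact: coord_continuous.
Qed.

Lemma measurable_v_mu l : measurable_fun setT (fun x => v_mu k x ord0 l).
Proof.
under eq_fun do rewrite mxE.
apply: (measurableT_comp (f := fine)); first exact: fine_measurable.
under eq_fun do rewrite integralE.
apply: emeasurable_funB.
  apply: measurable_fun_integral_kernel => //; last by apply: measurable_funepos; exact/measurable_EFinP.
  exact: measurable_kernel.
apply: measurable_fun_integral_kernel => //; last by apply: measurable_funeneg; exact/measurable_EFinP.
exact: measurable_kernel.
Qed.

Let box (M : R) : set (Rn * Rn) := [set x | `|x| <= M] `*` [set u | `|u| <= M].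

Let mdisk (M : R) : measurable [set x : Rn | `|x| <= M].
Proof.
apply: closed_measurable_rV; apply: compact_closed; last exact: compact_closed_normr_le.
exact: norm_hausdorff.
Qed.

Let mbox M : measurable (box M). Proof. exact: measurableX. Qed.

Lemma fibers_concentrated : exists M N, [/\ 0 <= M, measurable N, nu N = 0%E,
  mu (~` box M) = 0%E &
  forall x, ~ N x -> `|x| <= M /\
    {ae k x, forall z, z.1 = x /\ box M z}].
Proof.
have [[K [cK K0]] _] := clmu.
have mK := compact_prod_measurable cK.
have [M M0 KM] := compact_prod_bounded cK.
have box0 : mu (~` box M) = 0%E.
  apply/eqP; rewrite -measure_le0 -K0; apply: le_measure; rewrite ?inE; try exact: measurableC.
  by apply: subsetC => z /KM.
have neg1 : nu.-negligible (~` [set x | `|x| <= M]).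
  apply/negligibleP; first exact: measurableC.
  apply: etrans (nuE _) _; rewrite /proj_measure /pushforward; apply/eqP; rewrite -measure_le0 -box0.
  apply: le_measure; rewrite ?inE; last by move=> z /= zM [].
    by rewrite -[X in measurable X]setTI; apply: measurable_fst => //; exact: measurableC.
  exact: measurableC.
have neg2 : nu.-negligible (~` [set x | k x (~` box M) = 0%E]).
  have mk0 : measurable_fun setT (k ^~ (~` box M)) by apply: measurable_kernel; exact: measurableC.
  have : (\int[nu]_x `|k x (~` box M)| = 0)%E.
    under eq_integral do rewrite gee0_abs//.
    by rewrite -muk//; exact: measurableC.
  move/(ae_eq_integral_abs _ measurableT mk0) => [A [mA A0 HA]].
  by exists A; split => // x nx; apply: HA => /= h; apply: nx; exact: h.
have [N [mN N0 NP]] := negligibleU neg1 (negligibleU neg2 kfib).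
exists M, N; split => // x Nx.
have xM : `|x| <= M by apply: contrapT => h; apply: Nx; apply: NP; left.
have kb : k x (~` box M) = 0%E by apply: contrapT => h; apply: Nx; apply: NP; right; left.
have kx : k x ([set x] `*` [set: Rn]) = 1%E.
  by apply: contrapT => h; apply: Nx; apply: NP; right; right.
split => //.
have mx : measurable ([set x] `*` [set: Rn]).
  apply: measurableX => //; apply: closed_measurable_rV.
  exact: (accessible_closed_set1 (hausdorff_accessible (@norm_hausdorff _ _))).
exists ((~` ([set x] `*` [set: Rn])) `|` ~` box M); split.
- by apply: measurableU; exact: measurableC.
- have kx0 : k x (~` ([set x] `*` [set: Rn])) = 0%E.
    have k1 : k x setT = 1%E by exact: prob_kernel.
    rewrite -setTD; apply: etrans (measureD _ _ _) _ => //.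
      by rewrite [X in (X < _)%E]k1 ltry.
    by rewrite setTI [X in (X - _)%E]k1 [X in (_ - X)%E]kx subee.
  apply/eqP; rewrite -measure_le0.
  apply: (@le_trans _ _ (k x (~` ([set x] `*` [set: Rn])) + k x (~` box M))%E).
    by apply: measureU2; exact: measurableC.
  by rewrite kx0 kb adde0.
- move=> z nz; apply: contrapT => /not_orP[/contrapT[zx _] /contrapT zb].
  by apply: nz; split.
Qed.

Section good_fiber.
Variables (M : R) (x : Rn).
Hypotheses (M0 : 0 <= M) (fib : {ae k x, forall z, z.1 = x /\ box M z}).

Let abs_le l : (\int[k x]_z `|(z.2 ord0 l)%:E| <= M%:E)%E.
Proof.
apply: (@le_trans _ _ (\int[k x]_z (cst M%:E z))%E).
  apply: ae_ge0_le_integral => //.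
  - by apply: measurableT_comp => //; exact/measurable_EFinP.
  - have FF : Filter (almost_everywhere (k x)) by apply: ae_filter_ringOfSetsType.
    apply: (@filterS _ _ FF _ _ _ fib) => z [_ [_ zM]] _.
    by rewrite lee_fin; apply: le_trans zM; exact: normr_coord_le.
by rewrite integral_cst// prob_kernel mule1.
Qed.

Lemma integrable_velocity l : (k x).-integrable setT (fun z => (z.2 ord0 l)%:E).
Proof.
apply/integrableP; split; first exact/measurable_EFinP.
exact: le_lt_trans (abs_le l) (ltry _).
Qed.

Lemma integral_velocity l : (\int[k x]_z (z.2 ord0 l)%:E = (v_mu k x ord0 l)%:E)%E.
Proof. by rewrite mxE fineK//; apply: integrable_fin_num => //; exact: integrable_velocity. Qed.

Lemma v_mu_le : `|v_mu k x| <= M.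
Proof.
apply: normr_rV_le => // l; rewrite -lee_fin -abse_EFin -integral_velocity.
apply: le_trans (abs_le l); apply: le_abse_integral => //; exact/measurable_EFinP.
Qed.

(** The directional derivative is linear in the velocity, so averaging it over the fiber gives the
    derivative along the barycenter. The constant [Q] is carried along for the nonnegative integrand
    of [closed_along_v_mu]. *)
Lemma integral_derive_fiber (g : Rn -> R) (Q : R) : differentiable g x ->
  (\int[k x]_z ('D_(z.2) g x + Q)%:E = ('D_(v_mu k x) g x + Q)%:E)%E.
Proof.
move=> dg; have ic l : (k x).-integrable setT
    (fun z => ('D_(delta_mx ord0 l) g x)%:E * (z.2 ord0 l)%:E)%E.
  by apply: integrableZl => //; exact: integrable_velocity.
have -> : (\int[k x]_z ('D_(z.2) g x + Q)%:E =
  \int[k x]_z ((\sum_l ('D_(delta_mx ord0 l) g x)%:E * (z.2 ord0 l)%:E) + Q%:E))%E.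
  apply: eq_integral => z _; rewrite (derive_sum_coord _ dg) EFinD -sumEFin.
  by congr (_ + _)%E; apply: eq_bigr => l _; rewrite EFinM muleC.
have icst : (k x).-integrable setT (cst Q%:E).
  apply/integrableP; split => //; under eq_integral do rewrite abse_EFin.
  by rewrite integral_cst// prob_kernel mule1 ltry.
rewrite integralD//; last exact: integrable_sum.
rewrite integral_cst// prob_kernel mule1 integral_sum//.
rewrite (derive_sum_coord _ dg) EFinD -sumEFin; congr (_ + _)%E; apply: eq_bigr => l _.
by rewrite integralZl//; [rewrite integral_velocity EFinM muleC|exact: integrable_velocity].
Qed.

End good_fiber.

(** One integral is computed twice: over [mu] closedness leaves [Q], and over the fibers it is the
    integral along [v_mu] plus [Q]. *)
Lemma closed_along_v_mu (M : R) (N : set Rn) : 0 <= M -> measurable N -> nu N = 0%E ->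
  mu (~` box M) = 0%E ->
  (forall x, ~ N x -> `|x| <= M /\ {ae k x, forall z, z.1 = x /\ box M z}) ->
  closed_along nu (~` N) (v_mu k).
Proof.
move=> M0 mN N0 box0 NP g sg.
have dg x : differentiable g x by exact: (Ck_differentiable x (sg 1%N)).
pose c l x := 'D_(delta_mx ord0 l) g x.
have cc l : continuous (c l) by have [_ /(_ (delta_mx ord0 l))] := sg 1%N.
have mD : measurable (~` N) by exact: measurableC.
have mc l : measurable_fun setT (c l) by exact: continuous_measurable_rV.
have /choice[B BP] : forall l, exists B, 0 <= B /\ forall x, `|x| <= M -> `|c l x| <= B.
  by move=> l; have [B B0 BP] := continuous_bounded_disk M (cc l); exists B.
pose Q := \sum_l M * B l.
have Q0 : 0 <= Q by apply: sumr_ge0 => l _; rewrite mulr_ge0//; case: (BP l).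
have Db x u : `|x| <= M -> `|u| <= M -> `|'D_u g x| <= Q.
  move=> xM uM; rewrite derive_sum_coord//; apply: (le_trans (ler_norm_sum _ _ _)).
  apply: ler_sum => l _; rewrite normrM ler_pM//; last by have [_] := BP l; apply.
  exact: le_trans (normr_coord_le _ _) uM.
pose f (z : Rn * Rn) := 'D_(z.2) g z.1.
have mf : measurable_fun setT f.
  rewrite (_ : f = fun z => \sum_l z.2 ord0 l * c l z.1); last first.
    by apply/funext => z; exact: derive_sum_coord.
  apply: measurable_sum => l; apply: measurable_funM => //.
  by apply: measurableT_comp => //; exact: measurable_fst.
(* Cutting to the box, where [f] is bounded by [Q], and adding [Q] makes the integrand nonnegative,
   as [integral_mixture] demands; [mu] and the good fibers do not see the cut. *)
pose fQ z := (f z * \1_(box M) z + Q)%:E.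
have fQ0 z : (0 <= fQ z)%E.
  rewrite lee_fin indicE; have [/set_mem[z1 z2]|_] := boolP (z \in box M); last by rewrite mulr0 add0r.
  rewrite mulr1 -lerBlDr sub0r.
  by have := Db _ _ z1 z2; rewrite ler_norml => /andP[].
have mfQ : measurable_fun setT fQ.
  apply/measurable_EFinP; apply: measurable_funD => //; apply: measurable_funM => //.
have mv : measurable_fun (~` N) (fun x => 'D_(v_mu k x) g x).
  rewrite (_ : (fun x => _) = fun x => \sum_l v_mu k x ord0 l * c l x); last first.
    by apply/funext => x; exact: derive_sum_coord.
  apply: measurable_sum => l; apply: measurable_funM; apply: measurable_funTS => //.
  exact: measurable_v_mu.
have nuD : nu (~` N) = 1%E by rewrite probability_setC// N0 sube0.
have iv : nu.-integrable (~` N) (fun x => ('D_(v_mu k x) g x)%:E).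
  apply/integrableP; split; first exact/measurable_EFinP.
  apply: (@le_lt_trans _ _ (\int[nu]_(x in ~` N) (cst Q%:E x))%E); last first.
    by rewrite integral_cst// [X in (_ * X)%E]nuD mule1 ltry.
  apply: ge0_le_integral => //.
  - by apply: measurableT_comp => //; exact/measurable_EFinP.
  - by move=> x /NP[xM fib]; rewrite lee_fin Db//; exact: v_mu_le fib.
split=> //.
have mu1 : mu setT = 1%E by exact: probability_setT.
have lhs : (\int[mu]_z fQ z = Q%:E)%E.
  have if1 : mu.-integrable setT (fun z => (f z * \1_(box M) z)%:E).
    apply/integrableP; split; first by apply/measurable_EFinP; exact: measurable_funM.
    apply: (@le_lt_trans _ _ (\int[mu]_z (cst Q%:E z))%E); last first.
      by rewrite integral_cst// [X in (_ * X)%E]mu1 mule1 ltry.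
    apply: ge0_le_integral => //.
    - by apply: measurableT_comp => //; apply/measurable_EFinP; exact: measurable_funM.
    - move=> z _; rewrite lee_fin indicE; have [/set_mem[z1 z2]|_] := boolP (z \in box M).
        by rewrite mulr1 Db.
      by rewrite mulr0 normr0.
  rewrite /fQ; under eq_integral do rewrite EFinD.
  rewrite integralD//; last exact: finite_measure_integrable_cst.
  rewrite integral_cst// [X in (_ * X)%E]mu1 mule1.
  have [_ /(_ g sg) g0] := clmu.
  rewrite [X in (X + _)%E](_ : _ = 0%E) ?add0e// -g0.
  apply: ae_eq_integral => //; [|exact/measurable_EFinP|].
  - by apply/measurable_EFinP; exact: measurable_funM.
  - exists (~` box M); split => //; first exact: measurableC.
    move=> z nz zb; apply: nz => _; rewrite indicE mem_set// mulr1//.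
have rhs : (\int[mu]_z fQ z = \int[nu]_(x in ~` N) ('D_(v_mu k x) g x)%:E + Q%:E)%E.
  rewrite (integral_mixture muk fQ0 mfQ).
  rewrite (ge0_negligible_integral mN measurableT _ _ N0)//; last 2 first.
  - by apply: measurable_fun_integral_kernel => //; exact: measurable_kernel.
  - by move=> x _; apply: integral_ge0.
  rewrite setTD -[X in (_ + X)%E](_ : \int[nu]_(x in ~` N) (cst Q%:E x) = _)%E; last first.
    by rewrite integral_cst// [X in (_ * X)%E]nuD mule1.
  rewrite -integralD//; last exact: finite_measure_integrable_cst.
  apply: eq_integral => x /set_mem/NP[xM fib].
  rewrite -EFinD -(integral_derive_fiber M0 fib Q (dg x)).
  apply: ae_eq_integral => //.
  - apply/measurable_EFinP; apply: measurable_funD => //.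
    rewrite (_ : (fun z : Rn * Rn => _) = fun z => \sum_l z.2 ord0 l * c l x); last first.
      by apply/funext => z; exact: derive_sum_coord.
    by apply: measurable_sum => l; exact: measurable_funM.
  - have FF : Filter (almost_everywhere (k x)) by apply: ae_filter_ringOfSetsType.
    apply: (@filterS _ _ FF _ _ _ fib) => z [zx zb] _.
    by rewrite /fQ indicE mem_set// mulr1 /f zx.
move: lhs; rewrite rhs.
move=> h; have fi : (\int[nu]_(x in ~` N) ('D_(v_mu k x) g x)%:E)%E \is a fin_num.
  exact: integrable_fin_num.
by move: h; rewrite -(fineK fi) -EFinD => -[]; rewrite -[RHS]add0r => /addIr ->.
Qed.

End barycenter.

Theorem mainTheorem5 (R : realType) (n : nat)
    (H : 'rV[R]_n -> set 'rV[R]_n) (Lam : set 'rV[R]_n) (V : 'rV[R]_n -> R)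
    (mu : probability ('rV[R]_n * 'rV[R]_n)%type R)
    (k : R.-pker 'rV[R]_n ~> ('rV[R]_n * 'rV[R]_n)%type) :
  usc H ->
  (forall x, H x !=set0 /\ compact (H x)) ->
  convex_values H ->
  path_differentiable V ->
  lyapunov H Lam V ->
  closed_measure mu ->
  is_disintegration mu k ->
  proj_ae mu [set x | H x (v_mu k x)] ->
  proj_ae mu [set x | perp_set (clarke_subdiff V x) (v_mu k x)].
Proof.
move=> _ _ _ pdV LV clmu [muk kfib] Hv.
(* The law of the first projection is [proj_measure mu] with the structure of a probability, which
   the earlier results take as input. *)
pose X : {mfun ('rV[R]_n * 'rV[R]_n)%type >-> 'rV[R]_n} :=
  mfun_Sub (mem_set measurable_fst).
pose nu : probability 'rV[R]_n R := distribution mu X.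
have nuE A : nu A = proj_measure mu A by [].
have mukn A : measurable A -> (mu A = \int[nu]_x k x A)%E by move/muk.
have kfibn : nu.-negligible (~` [set x | k x ([set x] `*` [set: 'rV[R]_n]) = 1%E]).
  exact: kfib.
have [M [N [M0 mN N0 box0 NP]]] := fibers_concentrated nuE mukn kfibn clmu.
have [N' [mN' N'0 N'P]] : nu.-negligible (~` [set x | H x (v_mu k x)]) by exact: Hv.
have mN2 : measurable (N `|` N') by exact: measurableU.
have N20 : nu (N `|` N') = 0%E.
  apply/eqP; rewrite -measure_le0; apply: (@le_trans _ _ (nu N + nu N')%E).
    exact: measureU2.
  by rewrite N0 N'0 adde0.
have N2P x : ~ (N `|` N') x -> `|x| <= M /\
    {ae k x, forall z, z.1 = x /\ ([set y | `|y| <= M] `*` [set u | `|u| <= M]) z}.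
  by move=> /not_orP[/NP].
have Dcl := closed_along_v_mu mukn clmu M0 mN2 N20 box0 N2P.
set D := ~` (N `|` N') in Dcl.
have mD : measurable D by exact: measurableC.
have nuD : nu D = 1%E by rewrite probability_setC// N20 sube0.
have vM x : D x -> `|v_mu k x| <= M by move=> /N2P[_ fib]; exact: v_mu_le fib.
have mv := measurable_v_mu k.
have [w [cw Iw [N1 [mN1 N10 wv]]]] := approximating_fields nu mD mv vM.
have HD x : D x -> H x (v_mu k x).
  by move=> /not_orP[_ nN']; apply: contrapT => h; exact: nN' (N'P _ h).
apply: (not_perp_negligible (G := D `\` N1) pdV LV M0 mD nuD mv _ HD Dcl _ _ _ cw Iw).
- by move=> x Dx; split; [have [] := N2P x Dx|exact: vM].
- exact: measurableD.
- by move=> x [].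
- rewrite setCD setCK; apply/eqP; rewrite -measure_le0.
  apply: (@le_trans _ _ (nu (N `|` N') + nu N1)%E); first exact: measureU2.
  by rewrite N20 N10 adde0.
- by move=> x l [Dx nN1]; exact: wv.
Qed.
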